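(* Let $X$ be a real affine variety and let $f:X(\mathbb{R})\to \mathbb{R}$ be a function. Then $f\in\mathcal{K}^{R+}(X(\mathbb{R}))$ if and only if it satisfies the following properties: 1) $f\in \mathcal{K}(X)$, i.e. $f$ is rational. 2) There exists a monic polynomial $P(t)\in \mathbb{R}[X][t]$ such that $P(f)=0$ on $X(\mathbb{R})$. 3) The graph $\Gamma_f$ is Zariski closed in $X(\mathbb{R})\times\mathbb{A}^1(\mathbb{R})$. 4) For all $x\in X(\mathbb{R})$, we have $\overline{\Gamma_f}^{\mathbb{C}} \cap \left( \{x\}\times\mathbb{A}^1(\mathbb{C}) \right) = \{(x,f(x))\}$.
   Context: Rings are commutative with unit. An ideal $I$ of a ring $A$ is real if $\sum a_i^2\in I$ (finite sum) implies that every $a_i\in I$; $\mathrm{R\text{-}Spec}(A)$ is the set of real prime ideals of $A$. For an integral extension $A\hookrightarrow B$, put $A_B^{R+}=\{b\in B\mid \forall \mathfrak{p}\in\mathrm{R\text{-}Spec}(A),\ b_{\mathfrak p}\in A_{\mathfrak p}+\mathrm{Rad}(B_{\mathfrak p})\}$, where $B_{\mathfrak p}=(A\setminus\mathfrak p)^{-1}B$, $b_{\mathfrak p}$ is the image of $b$ in $B_{\mathfrak p}$, and $\mathrm{Rad}$ is the Jacobson radical. A real affine variety is $X=\mathrm{Spec}(\mathbb{R}[X])$ with $\mathbb{R}[X]\simeq\mathbb{R}[x_1,\dots,x_n]/I$ and $I$ a real ideal ($X$ may be reducible). $X(\mathbb{R})\subset\mathbb{R}^n$ is the set of real points and $X(\mathbb{C})\subset\mathbb{C}^n$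 the set of complex points. $\mathcal{K}(X)$ is the total ring of fractions of $\mathbb{R}[X]$. The normalization $X'$ has coordinate ring $\mathbb{R}[X']$, the integral closure of $\mathbb{R}[X]$ in $\mathcal{K}(X)$. The R-seminormalization of $X$ is $X^{R+}=\mathrm{Spec}\big(\mathbb{R}[X]^{R+}_{\mathbb{R}[X']}\big)$, with canonical morphism $\pi^{R+}:X^{R+}\to X$ and induced map $\pi^{R+}_{\mathbb{R}}:X^{R+}(\mathbb{R})\to X(\mathbb{R})$. $\mathcal{K}^{R+}(X(\mathbb{R}))$ is the ring of functions $f:X(\mathbb{R})\to\mathbb{R}$ such that $f\circ\pi^{R+}_{\mathbb{R}}\in\mathbb{R}[X^{R+}]$, i.e. such that $f\circ\pi^{R+}_{\mathbb{R}}$ is the function on $X^{R+}(\mathbb{R})$ given by an element of $\mathbb{R}[X^{R+}]$. A function $f:X(\mathbb{R})\to\mathbb{R}$ is rational (written $f\in\mathcal{K}(X)$) if there are $p,q\in\mathbb{R}[X]$, $q$ a non-zero-divisor, with $f=p/q$ on $\{x\in X(\mathbb{R})\mid q(x)\neq0\}$. $\Gamma_f=\{(x,f(x))\mid x\in X(\mathbb{R})\}$ is the graph of $f$, and $\overline{\Gamma_f}^{\mathbb{C}}$ is the Zariski closure of $\Gamma_f$ in $X(\mathbb{C})\times\mathbb{A}^1(\mathbb{C})$. *)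

(* Defs.v *)
From HB Require Import structures.
From mathcomp Require Import all_boot all_order all_algebra ring.
From mathcomp Require Import boolp classical_sets reals.
From mathcomp Require Import complex.
From mathcomp Require Import mpoly.

Set Implicit Arguments.
Unset Strict Implicit.
Unset Printing Implicit Defensive.

Import GRing.Theory.

Local Open Scope classical_set_scope.
Local Open Scope ring_scope.
Local Open Scope quotient_scope.

(* All the rings are [comPzRingType], i.e. the zero ring is allowed: it is the
   coordinate ring of the empty variety.  This is why neither [idealr] (proper
   ideals, with a nonzero quotient) nor [integralOver] (stated with [{poly _}],
   hence for nonzero rings) can be used directly. *)

Section Ideals.
Variable A : comPzRingType.

Record ideal := Ideal {
  ideal_set :> A -> Prop;
  ideal0 : ideal_set 0;
  idealD : forall a b, ideal_set a -> ideal_set b -> ideal_set (a + b);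
  idealM : forall a b, ideal_set b -> ideal_set (a * b) }.

Definition prime_ideal (p : ideal) : Prop :=
  ~ p 1 /\ forall a b, p (a * b) -> p a \/ p b.

Definition maximal_ideal (m : ideal) : Prop :=
  ~ m 1 /\ forall J : ideal, (forall a, m a -> J a) -> ~ J 1 -> forall a, J a -> m a.

Definition real_ideal (I : ideal) : Prop :=
  forall (k : nat) (a : 'I_k -> A), I (\sum_i a i ^+ 2) -> forall i, I (a i).

Definition jacobson_radical : set A :=
  [set b | forall m : ideal, maximal_ideal m -> m b].

Definition ideal_pred (I : ideal) : {pred A} := fun a => `[< I a >].

Lemma ideal_pred_zmod_closed (I : ideal) : zmod_closed (ideal_pred I).
Proof.
split=> [|x y]; first exact/asboolP/ideal0.
move=> /asboolP Ix /asboolP Iy; apply/asboolP/idealD => //.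
by rewrite -mulN1r; apply: idealM.
Qed.

HB.instance Definition _ (I : ideal) :=
  GRing.isZmodClosed.Build A (ideal_pred I) (ideal_pred_zmod_closed I).

End Ideals.

Section QuotientRing.
Variables (A : comPzRingType) (I : ideal A).

Definition quotient_ring : Type := Quotient.quot (ideal_pred I).
HB.instance Definition _ := GRing.Zmodule.on quotient_ring.
HB.instance Definition _ :=
  EqQuotient.on quotient_ring.

Local Notation Q := quotient_ring.

Definition quo (a : A) : Q := \pi a.

Lemma quo_eqP a b : quo a = quo b <-> I (a - b).
Proof.
split=> [/eqP|Iab]; last by apply/eqP; rewrite -Quotient.idealrBE; apply/asboolP.
by rewrite -Quotient.idealrBE => /asboolP.
Qed.

Lemma quo_repr (x : Q) : quo (repr x) = x.
Proof. exact: reprK. Qed.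

Lemma quo_zmod : zmod_morphism quo.
Proof.
move=> a b; have := @Quotient.pi_add A (ideal_pred I) a (- b).
by rewrite Quotient.pi_opp.
Qed.

HB.instance Definition _ := GRing.isZmodMorphism.Build A Q quo quo_zmod.

Definition quo_mul (x y : Q) : Q := quo (repr x * repr y).

Lemma quo_mulE a b : quo_mul (quo a) (quo b) = quo (a * b).
Proof.
apply/quo_eqP; set a' := repr _; set b' := repr _.
have Ia : I (a' - a) by apply/quo_eqP; rewrite quo_repr.
have Ib : I (b' - b) by apply/quo_eqP; rewrite quo_repr.
have -> : a' * b' - a * b = a' * (b' - b) + b * (a' - a) by ring.
by apply: idealD; apply: idealM.
Qed.

Lemma quo_mulA : associative quo_mul.
Proof.
move=> x y z; rewrite -[x]quo_repr -[y]quo_repr -[z]quo_repr.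
by rewrite !quo_mulE mulrA.
Qed.

Lemma quo_mulC : commutative quo_mul.
Proof. by move=> x y; rewrite /quo_mul mulrC. Qed.

Lemma quo_mul1 : left_id (quo 1) quo_mul.
Proof. by move=> x; rewrite -[x]quo_repr quo_mulE mul1r. Qed.

Lemma quo_mulDl : left_distributive quo_mul +%R.
Proof.
move=> x y z; rewrite -[x]quo_repr -[y]quo_repr -[z]quo_repr.
by rewrite -raddfD !quo_mulE mulrDl raddfD.
Qed.

HB.instance Definition _ := GRing.Zmodule_isComPzRing.Build Q
  quo_mulA quo_mulC quo_mul1 quo_mulDl.

Lemma quo_monoid : GRing.monoid_morphism quo.
Proof.
by split=> [|a b]; [reflexivity | apply: esym (quo_mulE a b)].
Qed.

HB.instance Definition _ := GRing.isMonoidMorphism.Build A Q quo quo_monoid.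

End QuotientRing.

Section Localization.

Record mul_set (B : comPzRingType) := MulSet {
  mul_set_set :> B -> Prop;
  mul_set1 : mul_set_set 1;
  mul_setM : forall s t, mul_set_set s -> mul_set_set t -> mul_set_set (s * t) }.

Variables (B : comPzRingType) (S : mul_set B).

Local Notation Den := (set_type (mul_set_set S)).

Definition preloc : Type := (B * Den)%type.
HB.instance Definition _ := Choice.on preloc.

Definition loc_eqv (x y : preloc) : bool :=
  `[< exists2 u, S u & u * (x.1 * val y.2) = u * (y.1 * val x.2) >].

Lemma loc_eqv_class : equiv_class_of loc_eqv.
Proof.
split=> [x|x y|y x z].
- by apply/asboolP; exists 1 => //; apply: mul_set1.
- by apply/asboolP/asboolP => -[u Su e]; exists u.
- move=> /asboolP[u Su e] /asboolP[v Sv e']; apply/asboolP.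
  exists (u * v * val y.2).
    apply: mul_setM; first exact: mul_setM.
    exact/set_mem/(valP y.2).
  transitivity (v * val z.2 * (u * (x.1 * val y.2))); first by ring.
  rewrite e; transitivity (u * val x.2 * (v * (y.1 * val z.2))); first by ring.
  by rewrite e'; ring.
Qed.

Canonical loc_equiv := EquivRelPack loc_eqv_class.
Canonical loc_encModRel := defaultEncModRel loc_eqv.

(* The ring of fractions S^-1 B; S may contain zero divisors. *)
Definition localization : Type := {eq_quot loc_eqv}.
HB.instance Definition _ := Choice.on localization.
HB.instance Definition _ := EqQuotient.on localization.

Local Notation L := localization.

Definition frac (b : B) (s : Den) : L := \pi_L (b, s).

Lemma frac_eqP b s c t :
  frac b s = frac c t <-> exists2 u, S u & u * (b * val t) = u * (c * val s).
Proof. by split=> [/eqmodP/asboolP|h] //; apply/eqmodP/asboolP. Qed.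

Lemma frac_ind (P : L -> Prop) : (forall b s, P (frac b s)) -> forall x, P x.
Proof. by move=> h x; rewrite -[x]reprK; case: (repr x) => b s; apply: h. Qed.

Definition den1 : Den := exist _ 1 (mem_set (mul_set1 S)).
Definition denM (s t : Den) : Den :=
  exist _ (val s * val t)
    (mem_set (mul_setM (set_mem (valP s)) (set_mem (valP t)))).

Lemma denE : (val den1 = 1) * (forall s t, val (denM s t) = val s * val t).
Proof. by []. Qed.

Definition loc_op (op : preloc -> preloc -> preloc) (x y : L) : L :=
  \pi_L (op (repr x) (repr y)).

Definition loc_add : L -> L -> L := loc_op (fun x y =>
  (x.1 * val y.2 + y.1 * val x.2, denM x.2 y.2)).
Definition loc_mul : L -> L -> L := loc_op (fun x y =>
  (x.1 * y.1, denM x.2 y.2)).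
Definition loc_opp (x : L) : L := frac (- (repr x).1) (repr x).2.

Lemma frac_repr b s (x := repr (frac b s)) :
  exists2 u, S u & u * (x.1 * val s) = u * (b * val x.2).
Proof. by apply/frac_eqP; rewrite /x /frac -surjective_pairing reprK. Qed.

Lemma loc_addE b s c t : loc_add (frac b s) (frac c t) =
  frac (b * val t + c * val s) (denM s t).
Proof.
rewrite /loc_add /loc_op -/(frac _ _); apply/frac_eqP; cbn [fst snd]; rewrite ?denE.
have [u Su eu] := frac_repr b s; have [v Sv ev] := frac_repr c t.
move: eu ev; set x := repr _; set y := repr _ => eu ev.
exists (u * v); first exact: mul_setM.
transitivity (u * (x.1 * val s) * (v * val t * val y.2)
            + v * (y.1 * val t) * (u * val s * val x.2)); first by ring.
by rewrite eu ev; ring.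
Qed.

Lemma loc_mulE b s c t :
  loc_mul (frac b s) (frac c t) = frac (b * c) (denM s t).
Proof.
rewrite /loc_mul /loc_op -/(frac _ _); apply/frac_eqP; cbn [fst snd]; rewrite ?denE.
have [u Su eu] := frac_repr b s; have [v Sv ev] := frac_repr c t.
move: eu ev; set x := repr _; set y := repr _ => eu ev.
exists (u * v); first exact: mul_setM.
transitivity (u * (x.1 * val s) * (v * (y.1 * val t))); first by ring.
by rewrite eu ev; ring.
Qed.

Lemma loc_oppE b s : loc_opp (frac b s) = frac (- b) s.
Proof.
apply/frac_eqP; have [u Su eu] := frac_repr b s; exists u => //.
by rewrite !mulNr !mulrN eu.
Qed.

Lemma frac_eq b s c t : b * val t = c * val s -> frac b s = frac c t.
Proof. by move=> e; apply/frac_eqP; exists 1; rewrite ?e //; apply: mul_set1. Qed.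

Lemma loc_addA : associative loc_add.
Proof.
elim/frac_ind=> b s; elim/frac_ind=> c t; elim/frac_ind=> d r.
by rewrite !loc_addE; apply: frac_eq; rewrite ?denE; ring.
Qed.

Lemma loc_addC : commutative loc_add.
Proof.
elim/frac_ind=> b s; elim/frac_ind=> c t.
by rewrite !loc_addE; apply: frac_eq; rewrite ?denE; ring.
Qed.

Lemma loc_add0 : left_id (frac 0 den1) loc_add.
Proof.
by elim/frac_ind=> b s; rewrite !loc_addE; apply: frac_eq; rewrite ?denE; ring.
Qed.

Lemma loc_addN : left_inverse (frac 0 den1) loc_opp loc_add.
Proof.
elim/frac_ind=> b s; rewrite loc_oppE !loc_addE.
by apply: frac_eq; rewrite ?denE; ring.
Qed.

HB.instance Definition _ :=
  GRing.isZmodule.Build L loc_addA loc_addC loc_add0 loc_addN.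

Lemma loc_mulA : associative loc_mul.
Proof.
elim/frac_ind=> b s; elim/frac_ind=> c t; elim/frac_ind=> d r.
by rewrite !loc_mulE; apply: frac_eq; rewrite ?denE; ring.
Qed.

Lemma loc_mulC : commutative loc_mul.
Proof.
elim/frac_ind=> b s; elim/frac_ind=> c t.
by rewrite !loc_mulE; apply: frac_eq; rewrite ?denE; ring.
Qed.

Lemma loc_mul1 : left_id (frac 1 den1) loc_mul.
Proof.
by elim/frac_ind=> b s; rewrite !loc_mulE; apply: frac_eq; rewrite ?denE; ring.
Qed.

Lemma loc_mulDl : left_distributive loc_mul loc_add.
Proof.
elim/frac_ind=> b s; elim/frac_ind=> c t; elim/frac_ind=> d r.
by rewrite !(loc_mulE, loc_addE); apply: frac_eq; rewrite ?denE; ring.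
Qed.

HB.instance Definition _ := GRing.Zmodule_isComPzRing.Build L
  loc_mulA loc_mulC loc_mul1 loc_mulDl.

Lemma fracD b s c t :
  frac b s + frac c t = frac (b * val t + c * val s) (denM s t).
Proof. exact: loc_addE. Qed.

Lemma fracN b s : - frac b s = frac (- b) s.
Proof. exact: loc_oppE. Qed.

Lemma fracM b s c t : frac b s * frac c t = frac (b * c) (denM s t).
Proof. exact: loc_mulE. Qed.

Definition to_loc (b : B) : L := frac b den1.

Lemma to_loc_zmod : zmod_morphism to_loc.
Proof.
by move=> a b; rewrite /to_loc fracN fracD; apply: frac_eq; rewrite ?denE; ring.
Qed.

HB.instance Definition _ := GRing.isZmodMorphism.Build B L to_loc to_loc_zmod.

Lemma to_loc_monoid : GRing.monoid_morphism to_loc.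
Proof.
split=> [|a b]; first by [].
by rewrite /to_loc fracM; apply: frac_eq; rewrite ?denE; ring.
Qed.

HB.instance Definition _ :=
  GRing.isMonoidMorphism.Build B L to_loc to_loc_monoid.

End Localization.

Section MulSets.
Variables (A B : comPzRingType) (phi : {rmorphism A -> B}).

Definition regular_set : set A := [set a | forall b, a * b = 0 -> b = 0].

Lemma regular1 : regular_set 1.
Proof. by move=> b; rewrite mul1r. Qed.

Lemma regularM a b : regular_set a -> regular_set b -> regular_set (a * b).
Proof. by move=> ra rb c; rewrite -mulrA => /ra/rb. Qed.

Definition regular : mul_set A := MulSet regular1 regularM.

(* The image in B of the complement of a prime ideal of A. *)
Variables (p : ideal A) (pP : prime_ideal p).

Definition compl_set : set B := phi @` [set s | ~ p s].

Lemma compl1 : compl_set 1.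
Proof. by exists 1; [exact: pP.1 | exact: rmorph1]. Qed.

Lemma complM s t : compl_set s -> compl_set t -> compl_set (s * t).
Proof.
move=> [a pa <-] [b pb <-]; exists (a * b); last exact: rmorphM.
by move=> /pP.2[].
Qed.

Definition compl : mul_set B := MulSet compl1 complM.

Definition compl_den (s : A) (ps : ~ p s) : set_type (mul_set_set compl) :=
  exist _ (phi s) (mem_set (ex_intro2 (fun a => ~ p a) (fun a => phi a = phi s)
    s ps erefl)).

(* The image of A_p in B_p. *)
Definition loc_base : set (localization compl) :=
  [set x | exists a s (ps : ~ p s), x = frac (phi a) (compl_den ps)].

End MulSets.

Definition total_fractions (A : comPzRingType) : comPzRingType :=
  localization (regular A).

Definition to_fractions (A : comPzRingType) :
    {rmorphism A -> total_fractions A} :=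
  @to_loc A (regular A).

Section IntegralClosure.
Variables (A B : comPzRingType) (phi : {rmorphism A -> B}).

Definition integral (b : B) : Prop :=
  exists d (c : 'I_d -> A), b ^+ d + \sum_(i < d) phi (c i) * b ^+ i = 0.

Definition integral_pred : {pred B} := fun b => `[< integral b >].

End IntegralClosure.

Lemma integralE (A B : comNzRingType) (phi : {rmorphism A -> B}) (b : B) :
  integral phi b <-> integralOver phi b.
Proof.
split=> [[d [c e]]|[p mp rp]].
  pose q := \poly_(i < d) oapp c 0 (insub i).
  have sq : (size q < size ('X^d : {poly A}))%N.
    by rewrite size_polyXn ltnS size_poly.
  exists ('X^d + q); first by rewrite monicE lead_coefDl // lead_coefXn.
  rewrite rootE rmorphD /= map_polyXn hornerD hornerXn -[X in _ == X]e.
  apply/eqP; congr (_ + _).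
  rewrite (@horner_coef_wide _ d); last first.
    by rewrite (leq_trans (size_poly _ _)) ?size_poly.
  by apply: eq_bigr => i _; rewrite coef_map coef_poly ltn_ord valK.
move: rp; rewrite rootE (@horner_coef_wide _ (size p).-1.+1); last first.
  by rewrite (leq_trans (size_poly _ _)) // leqSpred.
have e1 : (map_poly phi p)`_(size p).-1 = 1.
  rewrite coef_map -[p`__]/(lead_coef p) (monicP mp); exact: rmorph1.
rewrite big_ord_recr /= addrC e1 mul1r => /eqP e; exists (size p).-1, (fun i => p`_i).
by rewrite -[RHS]e; congr (_ + _); apply: eq_bigr => i _; rewrite coef_map.
Qed.

Section IntegralClosureRing.
Variables (A B : comPzRingType) (phi : {rmorphism A -> B}).

Lemma integral_phi a : integral phi (phi a).
Proof.
exists 1, (fun=> - a); rewrite expr1 big_ord1 expr0 mulr1 rmorphN.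
exact: subrr.
Qed.

Lemma integral_closed u v : integral phi u -> integral phi v ->
  integral phi (u - v) /\ integral phi (u * v).
Proof.
have [B0|B1] := eqVneq (1 : B) 0.
  have int0 (b : B) : integral phi b.
    exists 0, (fun=> 0).
    by rewrite big_ord0 addr0 expr0.
  by split; exact: int0.
have A1 : (1 : A) != 0.
  by apply: contraNneq B1 => A0; rewrite -(rmorph1 phi) A0 rmorph0.
pose A' : comNzRingType := HB.pack (GRing.ComPzRing.sort A)
  (GRing.PzSemiRing_isNonZero.Build A A1).
pose B' : comNzRingType := HB.pack (GRing.ComPzRing.sort B)
  (GRing.PzSemiRing_isNonZero.Build B B1).
pose phi' : {rmorphism A' -> B'} := phi.
move=> /(@integralE A' B' phi' u) iu /(@integralE A' B' phi' v) iv.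
split; apply/(@integralE A' B' phi').
  exact: integral_sub.
exact: integral_mul.
Qed.

Lemma integral_subring_closed : subring_closed (integral_pred phi).
Proof.
split=> [|u v|u v].
- by apply/asboolP; rewrite -(rmorph1 phi); apply: integral_phi.
- by move=> /asboolP iu /asboolP iv; apply/asboolP; case: (integral_closed iu iv).
- by move=> /asboolP iu /asboolP iv; apply/asboolP; case: (integral_closed iu iv).
Qed.

HB.instance Definition _ :=
  GRing.isSubringClosed.Build B (integral_pred phi) integral_subring_closed.

Definition integral_closure : Type := {b : B | b \in integral_pred phi}.
HB.instance Definition _ := SubChoice.on integral_closure.
HB.instance Definition _ := GRing.SubChoice_isSubComPzRing.Build B
  (integral_pred phi) integral_closure integral_subring_closed.

Definition to_integral_closure (a : A) : integral_closure :=
  exist _ (phi a) (asboolT (integral_phi a)).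

Lemma to_integral_closure_zmod : zmod_morphism to_integral_closure.
Proof. by move=> a b; apply/val_inj/rmorphB. Qed.

Lemma to_integral_closure_monoid : GRing.monoid_morphism to_integral_closure.
Proof.
split=> [|a b]; apply: val_inj; first exact: (rmorph1 phi).
exact: (rmorphM phi).
Qed.

HB.instance Definition _ := GRing.isZmodMorphism.Build A integral_closure
  to_integral_closure to_integral_closure_zmod.
HB.instance Definition _ := GRing.isMonoidMorphism.Build A integral_closure
  to_integral_closure to_integral_closure_monoid.

End IntegralClosureRing.

Section RSeminormalization.
Variables (A B : comPzRingType) (phi : {rmorphism A -> B}).

(* For every p in R-Spec A, b_p belongs to A_p + Rad(B_p). *)
Definition R_seminormal (b : B) : Prop :=
  forall (p : ideal A) (pP : prime_ideal p), real_ideal p ->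
  exists x r : localization (compl phi pP),
    [/\ loc_base x, jacobson_radical r & to_loc (compl phi pP) b = x + r].

Definition R_seminormal_pred : {pred B} := fun b => `[< R_seminormal b >].

Lemma R_seminormal_phi a : R_seminormal (phi a).
Proof.
move=> p pP _; exists (to_loc _ (phi a)), 0; split; last by rewrite addr0.
- exists a, 1, pP.1; apply: frac_eq.
  by rewrite denE mulr1 /= rmorph1 mulr1.
- by move=> m _; apply: ideal0.
Qed.

Lemma loc_base_closed (p : ideal A) (pP : prime_ideal p)
    (x y : localization (compl phi pP)) :
  loc_base x -> loc_base y -> loc_base (x - y) /\ loc_base (x * y).
Proof.
move=> [a [s [ps ->]]] [b [t [pt ->]]].
have pst : ~ p (s * t) by move=> /pP.2[].
split; [exists (a * t - b * s) | exists (a * b)]; exists (s * t), pst.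
- rewrite fracN fracD; apply: frac_eq; rewrite denE /=.
  by rewrite rmorphB !rmorphM; ring.
- rewrite fracM; apply: frac_eq; rewrite denE /=.
  by rewrite !rmorphM; ring.
Qed.

Lemma R_seminormal_closed u v : R_seminormal u -> R_seminormal v ->
  R_seminormal (u - v) /\ R_seminormal (u * v).
Proof.
move=> su sv; split=> p pP pR; have [x [r [bx Rr eu]]] := su p pP pR;
  have [y [q [b_y Rq ev]]] := sv p pP pR; have [bB bM] := loc_base_closed bx b_y.
- exists (x - y), (r - q); split=> //; last by rewrite rmorphB /= eu ev; ring.
  move=> m mm; apply: idealD (Rr m mm) _.
  by rewrite -mulN1r; apply: idealM (Rq m mm).
- exists (x * y), ((x + r) * q + y * r); split=> //.
    by move=> m mm; apply: idealD; apply: idealM; [apply: Rq | apply: Rr].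
  by rewrite rmorphM /= eu ev; ring.
Qed.

Lemma R_seminormal_subring_closed : subring_closed R_seminormal_pred.
Proof.
split=> [|u v|u v].
- by apply/asboolP; rewrite -(rmorph1 phi); apply: R_seminormal_phi.
- move=> /asboolP su /asboolP sv; apply/asboolP.
  by case: (R_seminormal_closed su sv).
- move=> /asboolP su /asboolP sv; apply/asboolP.
  by case: (R_seminormal_closed su sv).
Qed.

HB.instance Definition _ := GRing.isSubringClosed.Build B R_seminormal_pred
  R_seminormal_subring_closed.

Definition R_seminormalization : Type := {b : B | b \in R_seminormal_pred}.
HB.instance Definition _ := SubChoice.on R_seminormalization.
HB.instance Definition _ := GRing.SubChoice_isSubComPzRing.Build B
  R_seminormal_pred R_seminormalization R_seminormal_subring_closed.

Definition to_R_seminormalization (a : A) : R_seminormalization :=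
  exist _ (phi a) (asboolT (R_seminormal_phi a)).

Lemma to_R_seminormalization_zmod : zmod_morphism to_R_seminormalization.
Proof. by move=> a b; apply/val_inj/rmorphB. Qed.

Lemma to_R_seminormalization_monoid :
  GRing.monoid_morphism to_R_seminormalization.
Proof.
split=> [|a b]; apply: val_inj; first exact: (rmorph1 phi).
exact: (rmorphM phi).
Qed.

HB.instance Definition _ := GRing.isZmodMorphism.Build A R_seminormalization
  to_R_seminormalization to_R_seminormalization_zmod.
HB.instance Definition _ := GRing.isMonoidMorphism.Build A R_seminormalization
  to_R_seminormalization to_R_seminormalization_monoid.

End RSeminormalization.

Section Zariski.
Variables (K : fieldType) (m : nat).
Implicit Types Y Z : set ('I_m -> K).

Definition zeros (E : set {mpoly K[m]}) : set ('I_m -> K) :=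
  [set z | forall p, E p -> p.@[z] = 0].

(* Zariski topology on Y, as a subspace of the affine space K^m. *)
Definition zariski_closed_in Y Z : Prop :=
  exists E : set {mpoly K[m]}, Z = Y `&` zeros E.

Definition zariski_closure_in Y Z : set ('I_m -> K) :=
  [set z | Y z /\ forall C, zariski_closed_in Y C -> Z `<=` C -> C z].

End Zariski.

(* Points of K^n * K, seen in K^(n+1) with the last coordinate in K. *)
Definition pair_pt (K : Type) (n : nat) (x : 'I_n -> K) (t : K) :
    'I_n.+1 -> K := fun i => oapp x t (unlift ord_max i).

Definition times_line (K : Type) (n : nat) (Y : set ('I_n -> K)) :
  set ('I_n.+1 -> K) := [set z | exists2 x, Y x & exists t, z = pair_pt x t].

Section RealVarieties.
Variables (R : realType) (n : nat).

Record real_variety := RealVariety {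
  variety_ideal :> ideal {mpoly R[n]};
  variety_real : real_ideal variety_ideal }.

Variable X : real_variety.

Definition real_points : set ('I_n -> R) :=
  [set x | forall p, X p -> p.@[x] = 0].

Definition complex_points : set ('I_n -> R[i]) :=
  [set z | forall p, X p -> (map_mpoly (real_complex R) p).@[z] = 0].

Definition coord_ring : comPzRingType := quotient_ring X.

Definition eval_at (x : real_points) (p : coord_ring) : R :=
  (repr p : {mpoly R[n]}).@[val x].

Lemma eval_at_quo (x : real_points) (p : {mpoly R[n]}) :
  eval_at x (quo X p) = p.@[val x].
Proof.
apply/eqP; rewrite -subr_eq0 -mevalB; apply/eqP; apply: (set_mem (valP x)).
by apply/quo_eqP; rewrite quo_repr.
Qed.

Definition normal_ring : comPzRingType :=
  integral_closure (to_fractions coord_ring).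

Definition coord_to_normal : {rmorphism coord_ring -> normal_ring} :=
  to_integral_closure (to_fractions coord_ring).

Definition Rplus_ring : comPzRingType := R_seminormalization coord_to_normal.

Definition coord_to_Rplus : {rmorphism coord_ring -> Rplus_ring} :=
  to_R_seminormalization coord_to_normal.

(* Real points of X^{R+}: the R-algebra morphisms from its coordinate ring to
   R. *)
Definition Rplus_points : Type :=
  { u : {rmorphism Rplus_ring -> R} |
    forall c : R, u (coord_to_Rplus (quo X c%:MP)) = c }.

Definition Rplus_proj_pt (u : Rplus_points) : 'I_n -> R :=
  fun i => sval u (coord_to_Rplus (quo X 'X_i)).

Lemma Rplus_proj_meval (u : Rplus_points) (p : {mpoly R[n]}) :
  p.@[Rplus_proj_pt u] = sval u (coord_to_Rplus (quo X p)).
Proof.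
case: u => u uC; rewrite /Rplus_proj_pt /=.
rewrite mevalE [in RHS](mpolyE p) !raddf_sum; apply: eq_bigr => m _ /=.
rewrite -mul_mpolyC mpolyXE_id !rmorphM uC; congr (_ * _).
by rewrite !rmorph_prod; apply: eq_bigr => i _; rewrite !rmorphXn.
Qed.

Lemma Rplus_proj_real (u : Rplus_points) : real_points (Rplus_proj_pt u).
Proof.
move=> p Xp; rewrite Rplus_proj_meval.
have -> : quo X p = 0.
  by rewrite -(raddf0 (quo X)); apply/quo_eqP; rewrite subr0.
by rewrite !rmorph0.
Qed.

Definition Rplus_proj (u : Rplus_points) : real_points :=
  exist _ (Rplus_proj_pt u) (mem_set (Rplus_proj_real u)).

Variable f : real_points -> R.

Definition in_K_Rplus : Prop :=
  exists g : Rplus_ring, forall u : Rplus_points, f (Rplus_proj u) = sval u g.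

Definition rational_fun : Prop :=
  exists p q : coord_ring, regular_set q /\
    forall x, eval_at x q != 0 -> f x = eval_at x p / eval_at x q.

(* A monic polynomial t^d + sum_(i < d) c_i t^i over R[X] that vanishes at f. *)
Definition integral_fun : Prop :=
  exists d (c : 'I_d -> coord_ring), forall x,
    f x ^+ d + \sum_(i < d) eval_at x (c i) * f x ^+ i = 0.

Definition graph : set ('I_n.+1 -> R) :=
  [set pair_pt (val x) (f x) | x in [set: real_points]].

Definition to_complex (m : nat) (z : 'I_m -> R) : 'I_m -> R[i] :=
  fun i => real_complex R (z i).

Definition complex_graph_closure : set ('I_n.+1 -> R[i]) :=
  zariski_closure_in (times_line complex_points) (@to_complex n.+1 @` graph).

End RealVarieties.

(* Main.v *)
Require Import Defs.
From HB Require Import structures.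
From mathcomp Require Import all_boot all_order all_algebra ring lra zify.
From mathcomp Require Import boolp classical_sets reals.
From mathcomp Require Import polyrcf complex mpoly.

Set Implicit Arguments.
Unset Strict Implicit.
Unset Printing Implicit Defensive.

Import Order.TTheory GRing.Theory Num.Theory.

Local Open Scope classical_set_scope.
Local Open Scope ring_scope.

(** Write A for the coordinate ring of X, B for its integral closure in the
   total ring of fractions, C for the R-seminormalization, and M for the
   polynomial ring of which A is a quotient.

   Necessity.  Over a real point x an element c of C has a single value, which
   is real, and this remains so when complex values are admitted.  By definition
   c is, up to the Jacobson radical of B_x, a fraction over A, hence it is
   congruent to the real number t that this fraction takes at x.  Put r = c - t
   and let z be a complex number which satisfies, after specialization at x,
   every polynomial relation of r over A.  If z were nonzero, the real
   polynomial k = (T - z)(T - conj z) would have a nonzero constant term, so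
   that k(r) would be a unit of B_x; the integral equation of its inverse,
   multiplied by a power of k(r), is then a relation of r that specializes to a
   nonzero constant at z ([jacobson_only_zero]).  So c |-> t is the only real
   point of X^{R+} above x, and if f is given by g in C, the relations of g over
   A cut out the graph of f both over the reals and over the complex numbers
   ([Rplus_graph_equations]).

   Sufficiency.  The tool is the real Nullstellensatz ([real_nullstellensatz]).
   If f = p/q, it shows that every polynomial relation satisfied by f on the
   real points is satisfied by the fraction g = p/q
   ([fraction_root_of_vanishing]); hence g is in B.  Let P be a real prime of A
   and let F be, among the relations of f that are nonzero modulo P, one of
   minimal degree e modulo P, with leading coefficient s.  At a real zero x of P
   with s(x) <> 0, the complex roots of F(x, T) are common roots of all the
   relations of f ([minimal_equation]), so that condition 4 leaves f(x) only and
   F(x, T) = s(x) (T - f(x))^e.  The value f(x) can be read on the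
   coefficient of degree e - 1, and by the Nullstellensatz for P the resulting
   identity between coefficients holds modulo P ([power_equation]).  Therefore
   g + F_(e-1) / (e s) is nilpotent modulo P B_P, and lies in Rad(B_P)
   ([graph_seminormal_at]).

   The real Nullstellensatz.  If h is not in the real ideal I, Zorn's lemma
   yields an ordered field L and a point of L^n where I vanishes and h does not
   ([ordered_field_of_preordering]).  By Hilbert's basis theorem this point is
   described by finitely many sign conditions, which are transferred from L to
   the reals one variable at a time ([transfer_one_variable]).  In one variable,
   the family of polynomials is first closed under derivation and remainders, and
   the roots are then matched by increasing degrees ([transfer_point]): between
   consecutive roots of the polynomials of smaller degree the derivative of u
   has no root, so that the signs of u at both ends decide everything; and at a
   root of u the sign of another polynomial is that of its remainder by u.  The
   field L has to contain enough roots for this: it is enlarged by adjoining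
   roots of the finitely many polynomials at hand until they have the
   intermediate value property ([extension_with_roots]). *)

(** * Orderings *)

(** The union of the empty chain is empty; working with the sets S `|` X
   replaces it by S, so that only nonempty chains have to be considered. *)
Lemma Zorn_above (U : Type) (G : set (set U)) (S : set U) :
  G S ->
  (forall F : set (set U), F !=set0 -> (forall X, F X -> G X /\ S `<=` X) ->
     total_on F subset -> G (\bigcup_(X in F) X)) ->
  exists M, [/\ S `<=` M, G M & forall N, M `<=` N -> G N -> N `<=` M].
Proof.
move=> GS chainG.
have [|M [GM maxM]] := @Zorn_bigcup U (fun X => G (S `|` X)).
  move=> F GF totF; have [F0|F0] := pselect (F !=set0); last first.
    suff -> : \bigcup_(X in F) X = set0 by rewrite setU0.
    by apply/seteqP; split=> // x [X FX _]; case: F0; exists X.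
  have -> : S `|` \bigcup_(X in F) X
      = \bigcup_(Y in [set S `|` X | X in F]) Y.
    apply/seteqP; split=> [x [Sx|[X FX Xx]]|x [_ [X FX <-]] [Sx|Xx]].
    - by have [X FX] := F0; exists (S `|` X); [exists X|left].
    - by exists (S `|` X); [exists X|right].
    - by left.
    - by right; exists X.
  apply: chainG.
  - by have [X FX] := F0; exists (S `|` X), X.
  - by move=> _ [X FX <-]; split; [exact: GF | left].
  move=> _ _ [X FX <-] [Y FY <-].
  by have [sub|sub] := totF _ _ FX FY; [left|right]; apply: setUS.
exists (S `|` M); split=> [x Sx||N sub GN]; [by left|by []|].
have SN : S `|` N = N by apply/setUidPr => x Sx; apply: sub; left.
have [//|nsub] := pselect (N `<=` S `|` M).
case: (maxM N); last by rewrite SN.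
split=> [x Mx|NM]; first by apply: sub; right.
by apply: nsub => x /NM; right.
Qed.

Section Preorderings.
Variable A : comPzRingType.

Record preordering (T : set A) : Prop := Preordering {
  preorderingD : forall a b, T a -> T b -> T (a + b);
  preorderingM : forall a b, T a -> T b -> T (a * b);
  preordering_sqr : forall a, T (a ^+ 2) }.

(** For h = 1 this says that -1 is not in T; in general, that -1 is not in the
   preordering generated by T in the localization at h. *)
Definition proper_at (h : A) (T : set A) := forall k, ~ T (- (h ^+ k) ^+ 2).

Lemma preordering0 T : preordering T -> T 0.
Proof. by move=> /preordering_sqr/(_ 0); rewrite expr0n. Qed.

Lemma preordering_adjoin T a : preordering T ->
  preordering [set x | exists s t, [/\ T s, T t & x = s + a * t]].
Proof.
move=> pT; have [TD TM Tsq] := pT; split=> [? ?|? ?|b].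
- move=> [s [t [Ts Tt ->]]] [s' [t' [Ts' Tt' ->]]].
  by exists (s + s'), (t + t'); split; [exact: (TD)|exact: (TD)|ring].
- move=> [s [t [Ts Tt ->]]] [s' [t' [Ts' Tt' ->]]].
  exists (s * s' + a ^+ 2 * (t * t')), (s * t' + s' * t); split; last by ring.
  + by apply: (TD); apply: (TM) => //; apply: (TM).
  + by apply: (TD); apply: (TM).
- by exists (b ^+ 2), 0; split; [|exact: preordering0|rewrite mulr0 addr0].
Qed.

Section MaximalPreordering.
Variables (h : A) (P : set A).
Hypotheses (pP : preordering P) (avP : proper_at h P).
Hypothesis maxP : forall N, P `<=` N -> preordering N /\ proper_at h N -> N `<=` P.

(** Otherwise P + a P would be a larger proper preordering. *)
Lemma notin_maximal_preordering a : ~ P a ->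
  exists k s t, [/\ P s, P t & - (h ^+ k) ^+ 2 = s + a * t].
Proof.
move=> nPa; apply: contrapT => none; apply: nPa.
apply: (maxP _ (conj (preordering_adjoin a pP) _)).
- by move=> x Px; exists x, 0; rewrite mulr0 addr0; split=> //; exact: preordering0.
- by move=> k [s [t [Ps Pt e]]]; apply: none; exists k, s, t.
- exists 0, 1; rewrite add0r mulr1; split=> //; first exact: preordering0.
  by rewrite -(expr1n _ 2); apply: preordering_sqr.
Qed.

(** If neither a nor - a were in P, then a t and - a t' would both be of the form
   - (h^2k + s); the product of the two relations puts - h^2(k+l) into P. *)
Lemma maximal_preordering_total a : P a \/ P (- a).
Proof.
have [PD PM Psq] := pP.
apply: contrapT => /not_orP[] /notin_maximal_preordering[k [s [t [Ps Pt e]]]].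
move=> /notin_maximal_preordering[l [s' [t' [Ps' Pt' e']]]].
apply: (avP (k := k + l)).
have -> : - (h ^+ (k + l)) ^+ 2 = a ^+ 2 * (t * t')
    + ((h ^+ k) ^+ 2 * s' + (s * (h ^+ l) ^+ 2 + s * s')).
  have et : a * t = - (h ^+ k) ^+ 2 - s by rewrite e; ring.
  have et' : a * t' = (h ^+ l) ^+ 2 + s' by rewrite -[_ ^+ 2]opprK e'; ring.
  have -> : a ^+ 2 * (t * t') = (a * t) * (a * t') by ring.
  by rewrite et et' exprD; ring.
by apply: (PD); [|apply: (PD); [|apply: (PD)]]; do ?[exact: (PM) | apply: (PM) => //].
Qed.

Definition support_set a := P a /\ P (- a).

Lemma support0 : support_set 0.
Proof. by split; rewrite ?oppr0; exact: preordering0. Qed.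

Lemma supportD a b : support_set a -> support_set b -> support_set (a + b).
Proof.
by have [PD _ _] := pP; move=> [? ?] [? ?]; split; rewrite ?opprD; exact: (PD).
Qed.

Lemma supportM a b : support_set b -> support_set (a * b).
Proof.
have [_ PM _] := pP; move=> [Pb Nb].
have [Pa|Na] := maximal_preordering_total a; split.
- exact: (PM).
- by rewrite -mulrN; exact: (PM).
- by rewrite -mulrNN; exact: (PM).
- by rewrite -mulNr; exact: (PM).
Qed.

Definition support : ideal A := Ideal support0 supportD supportM.

Lemma support_proper k : ~ support (h ^+ k).
Proof. by move=> sh; have [_] := supportM (h ^+ k) sh; rewrite -expr2 => /avP. Qed.

(** Up to signs, - a and - b are not in P, so a t = h^2k + s and b t' = h^2l + s';
   if a b were in the support, the product would put - h^2(k+l) into P. *)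
Lemma support_prime : prime_ideal support.
Proof.
split=> [|a b [Pab Nab]]; first by rewrite -(expr0 h); exact: support_proper.
have [PD PM Psq] := pP; apply: contrapT => /not_orP[na nb].
wlog nPa : a Pab Nab na / ~ P (- a) => [wl|].
  have [Na|] := pselect (P (- a)); last exact: wl.
  apply: (wl (- a)); rewrite ?mulNr ?opprK //.
    by move=> [?]; rewrite opprK => ?; apply: na; split.
  by move=> Pa; apply: na; split.
wlog nPb : b Pab Nab nb / ~ P (- b) => [wl|].
  have [Nb|] := pselect (P (- b)); last exact: wl.
  apply: (wl (- b)); rewrite ?mulrN ?opprK //.
    by move=> [?]; rewrite opprK => ?; apply: nb; split.
  by move=> Pb; apply: nb; split.
have [k [s [t [Ps Pt e]]]] := notin_maximal_preordering nPa.
have [l [s' [t' [Ps' Pt' e']]]] := notin_maximal_preordering nPb.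
apply: (avP (k := k + l)).
have -> : - (h ^+ (k + l)) ^+ 2 = - (a * b) * (t * t')
    + ((h ^+ k) ^+ 2 * s' + (s * (h ^+ l) ^+ 2 + s * s')).
  have et : a * t = (h ^+ k) ^+ 2 + s by rewrite -[_ ^+ 2]opprK e; ring.
  have et' : b * t' = (h ^+ l) ^+ 2 + s' by rewrite -[_ ^+ 2]opprK e'; ring.
  have -> : - (a * b) * (t * t') = - ((a * t) * (b * t')) by ring.
  by rewrite et et' exprD; ring.
by apply: (PD); [|apply: (PD); [|apply: (PD)]]; do ?[exact: (PM) | apply: (PM) => //].
Qed.

End MaximalPreordering.
End Preorderings.

Lemma prime_quotient_idomain (A : comPzRingType) (p : ideal A) :
  prime_ideal p ->
  exists (D : idomainType) (phi : {rmorphism A -> D}),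
    (forall a, phi a = 0 <-> p a) /\ (forall d, exists a, d = phi a).
Proof.
move=> [p1 pM]; pose Q := quotient_ring p.
have quo0 a : quo p a = 0 <-> p a.
  by rewrite -(rmorph0 (quo p)); split=> [/quo_eqP|pa]; last apply/quo_eqP; rewrite subr0.
have Q1 : (1 : Q) != 0.
  by apply/eqP; rewrite -(rmorph1 (quo p)) => /quo0.
have QM (x y : Q) : x * y = 0 -> (x == 0) || (y == 0).
  rewrite -[x]quo_repr -[y]quo_repr -rmorphM => /quo0/pM.
  by move=> -[] /quo0 ->; rewrite eqxx ?orbT.
pose inv (x : Q) : Q := if pselect (exists y, y * x = 1) is left e
  then projT1 (cid e) else x.
pose U : {pred Q} := fun x => `[< exists y, y * x = 1 >].
have mulV : {in U, left_inverse 1 inv *%R}.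
  move=> x /asboolP ux; rewrite /inv; case: pselect => // e.
  by case: cid.
have unitP x y : y * x = 1 -> U x by move=> e; apply/asboolP; exists y.
have inv_out : {in [predC U], inv =1 id}.
  move=> x /negP nu; rewrite /inv; case: pselect => // e.
  by case: nu; apply/asboolP.
pose Q' : comNzRingType := HB.pack Q (GRing.PzSemiRing_isNonZero.Build Q Q1).
pose D1 : comUnitRingType := HB.pack Q'
  (GRing.ComNzRing_hasMulInverse.Build Q' mulV unitP inv_out).
pose D : idomainType := HB.pack D1
  (GRing.ComUnitRing_isIntegral.Build D1 QM).
exists D, (quo p : {rmorphism A -> Q}); split=> [a|d]; first exact: quo0.
by exists (repr (d : Q)); exact/esym/(quo_repr (d : Q)).
Qed.

(** A maximal proper preordering induces a total ordering on the quotient by its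
   support; it extends to fractions by declaring a / b nonnegative when a b is. *)
Lemma ordered_field_of_preordering (A : comPzRingType) (T : set A) (h : A) :
  preordering T -> proper_at h T ->
  exists (L : realFieldType) (phi : {rmorphism A -> L}),
    (forall a, T a -> 0 <= phi a) /\ phi h != 0.
Proof.
move=> pT avT.
have [||P [TP [pP avP] maxP]] :=
    @Zorn_above _ [set P | preordering P /\ proper_at h P] T.
- by split.
- move=> F [X0 FX0] GF totF; split; last first.
    by move=> k [X /GF[[_ avX] _]]; exact: (avX).
  have both a b : (\bigcup_(X in F) X) a -> (\bigcup_(X in F) X) b ->
      exists2 X, F X & X a /\ X b.
    move=> [X FX Xa] [Y FY Yb].
    by have [XY|YX] := totF _ _ FX FY;
      [exists Y|exists X] => //; split=> //; [apply: XY|apply: YX].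
  split=> [a b ua ub|a b ua ub|a].
  + have [X FX [Xa Xb]] := both a b ua ub.
    by have [[pX _] _] := GF X FX; exists X => //; apply: preorderingD.
  + have [X FX [Xa Xb]] := both a b ua ub.
    by have [[pX _] _] := GF X FX; exists X => //; apply: preorderingM.
  + by have [[pX _] _] := GF X0 FX0; exists X0 => //; apply: preordering_sqr.
have [PD PM Psq] := pP.
have tot := maximal_preordering_total pP avP maxP.
set N := support pP avP maxP.
have [D [phi [phi0 phiS]]] := prime_quotient_idomain (support_prime pP avP maxP).
have PN a b : P a -> phi a = phi b -> P b.
  move=> Pa e; have : N (b - a) by apply/phi0; rewrite rmorphB e subrr.
  by move=> [Pba _]; rewrite -[b](subrK a); apply: (PD).
pose F := {fraction D}; pose fr : {rmorphism D -> F} := @FracField.tofrac D.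
have fr_inj a b : (fr a == fr b) = (a == b) by exact: tofrac_eq.
have fr_eq0 a : (fr a == 0) = (a == 0) by exact: tofrac_eq0.
have frV (x : F) : exists a b, [/\ phi b != 0 & x = fr (phi a) / fr (phi b)].
  elim/quotW: x => x; have [a ea] := phiS x.1; have [b eb] := phiS x.2.
  exists a, b; rewrite -eb -ea denom_ratioP; split=> //.
  apply/(canRL (mulfK _)); first by rewrite fr_eq0 denom_ratioP.
  rewrite /fr /=; unlock FracField.tofrac; rewrite -[LHS]FracField.pi_mul.
  apply/eqmodP; rewrite /= FracField.equivfE /FracField.mulf.
  by rewrite !numden_Ratio ?mulf_neq0 ?oner_neq0 ?denom_ratioP // !mulr1 mulrC.
pose pos (x : F) := exists a b, [/\ phi b != 0, P (a * b) & x = fr (phi a) / fr (phi b)].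
have fr_neq0 b : phi b != 0 -> fr (phi b) != 0 by rewrite fr_eq0.
(* the sign of a fraction can be read on any of its representatives *)
have posE a b : phi b != 0 -> pos (fr (phi a) / fr (phi b)) -> P (a * b).
  move=> b0 [c [d [d0 Pcd]]] /eqP; rewrite eqr_div ?fr_neq0 //.
  rewrite -!rmorphM fr_inj => /eqP e.
  have Pd : P (d ^+ 2 * (a * b)).
    apply: (@PN (b ^+ 2 * (c * d))); first exact: (PM).
    have -> : b ^+ 2 * (c * d) = (c * b) * (b * d) by ring.
    have -> : d ^+ 2 * (a * b) = (a * d) * (b * d) by ring.
    by rewrite rmorphM -e -rmorphM.
  have [//|Nab] := tot (a * b).
  have sup : N (d ^+ 2 * (a * b)) by split=> //; rewrite -mulrN; apply: (PM).
  apply: (PN 0); first exact: preordering0.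
  move/phi0: sup; rewrite rmorphM rmorphXn => /eqP.
  by rewrite mulf_eq0 expf_eq0 /= (negPf d0) /= => /eqP ->; rewrite rmorph0.
have posD x y : pos x -> pos y -> pos (x + y).
  move=> [a [b [b0 Pab ->]]] [c [d [d0 Pcd ->]]].
  exists (a * d + c * b), (b * d); split; first by rewrite rmorphM mulf_neq0.
    have -> : (a * d + c * b) * (b * d) = a * b * d ^+ 2 + c * d * b ^+ 2 by ring.
    by apply: (PD); apply: (PM).
  by rewrite addf_div ?fr_neq0 // !(rmorphM, rmorphD).
have posM x y : pos x -> pos y -> pos (x * y).
  move=> [a [b [b0 Pab ->]]] [c [d [d0 Pcd ->]]].
  exists (a * c), (b * d); split; first by rewrite rmorphM mulf_neq0.
    have -> : a * c * (b * d) = a * b * (c * d) by ring.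
    exact: (PM).
  by rewrite mulf_div !rmorphM.
have pos_total x : pos x \/ pos (- x).
  have [a [b [b0 ->]]] := frV x.
  have [Pab|Nab] := tot (a * b); [left|right].
    by exists a, b.
  by exists (- a), b; split; rewrite ?mulNr // !rmorphN mulNr.
have pos_anti x : pos x -> pos (- x) -> x = 0.
  have [a [b [b0 ->]]] := frV x => /(posE _ _ b0) Pab.
  rewrite -mulNr -!rmorphN => /(posE _ _ b0); rewrite mulNr => Nab.
  have : N (a * b) by split.
  move=> /phi0 /eqP; rewrite rmorphM mulf_eq0 (negPf b0) orbF => /eqP ->.
  by rewrite rmorph0 mul0r.
pose le : rel F := fun x y => `[< pos (y - x) >].
pose lt : rel F := fun x y => (y != x) && le x y.
pose nrm x := if le 0 x then x else - x.
have le0 x : le 0 x <-> pos x by rewrite /le subr0; split=> /asboolP.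
have le0N x : le x 0 <-> pos (- x) by rewrite /le sub0r; split=> /asboolP.
have nrmN x : nrm (- x) = nrm x.
  rewrite /nrm; case: ifP => [/le0 Nx|/negP nNx]; case: ifP => [/le0 Px|/negP nx] //.
  - by rewrite (pos_anti x Px Nx) oppr0.
  - by rewrite opprK.
  - by have [Px|Nx] := pos_total x; [case: nx|case: nNx]; apply/le0.
have le_add x y : le 0 x -> le 0 y -> le 0 (x + y).
  by rewrite !le0 => /posD; apply.
have le_mul x y : le 0 x -> le 0 y -> le 0 (x * y).
  by rewrite !le0 => /posM; apply.
have le_anti x : le 0 x -> le x 0 -> x = 0.
  by rewrite le0 le0N; exact: pos_anti.
have le_sub x y : le 0 (y - x) = le x y by rewrite /le subr0.
have le_total x : le 0 x || le x 0.
  by apply/orP; rewrite le0 le0N; exact: pos_total.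
have ge0_nrm x : le 0 x -> nrm x = x by rewrite /nrm => ->.
have lt_def x y : lt x y = (y != x) && le x y by [].
pose L : realFieldType := HB.pack F (Num.IntegralDomain_isLeReal.Build F
  le_add le_mul le_anti le_sub le_total nrmN ge0_nrm lt_def).
exists L, (fr \o phi : {rmorphism A -> F}); split=> [a /TP Pa|].
  apply/le0; exists a, 1; rewrite mulr1 !rmorph1 divr1; split=> //.
  exact: oner_neq0.
rewrite /= fr_eq0; apply/eqP => /phi0.
exact: (@support_proper _ _ _ pP avP maxP 1).
Qed.

(** * Adjoining roots to an ordered field *)

(** For one given polynomial this can be reached by adjoining finitely many roots.
   The divisors are included because the proof of Rolle's theorem uses the
   intermediate value property for cofactors of u and of its derivative. *)
Definition ivt_divisors (K : realFieldType) (F : {poly K}) : Prop :=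
  forall g, g %| F -> forall a b, a < b -> g.[a] * g.[b] < 0 ->
  exists2 c, a < c < b & root g c.

Definition weighted_sos (K : realFieldType) (r : seq (K * {poly K})) : {poly K} :=
  \sum_(x <- r) x.1 *: x.2 ^+ 2.

Lemma weighted_sos_ge0 (K : realFieldType) (r : seq (K * {poly K})) (a : K) :
  (forall x, x \in r -> 0 <= x.1) -> 0 <= (weighted_sos r).[a].
Proof.
rewrite /weighted_sos => r0; rewrite horner_sum big_seq; apply: sumr_ge0 => x xr.
by rewrite hornerZ horner_exp mulr_ge0 ?r0 ?sqr_ge0.
Qed.

Lemma weighted_sosM (K : realFieldType) (r s : seq (K * {poly K})) :
  weighted_sos [seq (x.1 * y.1, x.2 * y.2) | x <- r, y <- s]
    = weighted_sos r * weighted_sos s.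
Proof.
rewrite /weighted_sos big_distrlr /= big_flatten big_map.
apply: eq_bigr => x _; rewrite big_map; apply: eq_bigr => y _ /=.
by rewrite exprMn -scalerAl -scalerAr scalerA.
Qed.

Lemma sign_change_size (K : realDomainType) (f : {poly K}) (a b : K) :
  f.[a] * f.[b] < 0 -> (1 < size f)%N.
Proof.
move=> fab; rewrite ltnNge; apply/negP => /size1_polyC ef; move: fab.
by rewrite ef !hornerC -expr2 ltNge sqr_ge0.
Qed.

(** Descent on the degree of f: once the squared polynomials are reduced modulo f,
   the cofactor h has a smaller degree than f, and it changes sign together with
   f because the left-hand side is positive at a and b. *)
Lemma sign_change_not_sos (K : realFieldType) (a b : K) (f h : {poly K}) r :
  f.[a] * f.[b] < 0 -> (forall x, x \in r -> 0 <= x.1) ->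
  1 + weighted_sos r <> h * f.
Proof.
have [m] := ubnP (size f); elim: m => // m IHm in f h r *.
rewrite ltnS => szf fab r0 e.
have sf := sign_change_size fab.
have f0 : f != 0 by rewrite -size_poly_gt0 ltnW.
pose r' := [seq (x.1, x.2 %% f) | x <- r].
have r'0 x : x \in r' -> 0 <= x.1 by move=> /mapP[y yr ->] /=; exact: r0.
have /dvdpP[h' e'] : f %| 1 + weighted_sos r'.
  rewrite -(@dvdp_addl _ (- (1 + weighted_sos r))); last first.
    by rewrite dvdpNr e dvdp_mull.
  rewrite opprD addrACA subrr add0r /weighted_sos big_map -sumrB /=.
  apply: (big_ind (fun q => f %| q)) => [|p q|x _]; first exact: dvdp0.
    exact: dvdp_add.
  rewrite -scalerBr -mul_polyC dvdp_mull // subr_sqr dvdp_mulr //.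
  by rewrite {2}(divp_eq x.2 f) opprD addrCA subrr addr0 dvdpNr dvdp_mull.
have szr' : (size (1 + weighted_sos r')%R <= ((size f).-1 + (size f).-1).-1)%N.
  have k0 : (0 < (size f).-1)%N by case: (size f) sf => [|[]].
  rewrite (leq_trans (size_polyD _ _)) // geq_max size_poly1.
  apply/andP; split; first by case: (size f).-1 k0 => // l _; rewrite addSn addnS.
  rewrite /weighted_sos big_map.
  apply: (big_ind (fun q : {poly K} => (size q <= ((size f).-1 + (size f).-1).-1)%N)).
  - by rewrite size_poly0.
  - by move=> p q sp sq; rewrite (leq_trans (size_polyD _ _)) // geq_max sp.
  move=> x _; rewrite (leq_trans (size_scale_leq _ _)) // expr2.
  rewrite (leq_trans (size_polyMleq _ _)) // -!subn1 leq_sub2r //.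
  by apply: leq_add; rewrite subn1 -ltnS prednK ?(ltnW sf) // ltn_modp.
have pos c : 0 < h'.[c] * f.[c].
  by rewrite -hornerM -e' hornerD hornerC ltr_wpDr // weighted_sos_ge0.
have h'ab : h'.[a] * h'.[b] < 0.
  by move: (mulr_gt0 (pos a) (pos b)); rewrite mulrACA nmulr_lgt0.
have h'0 : h' != 0 by rewrite -size_poly_gt0 ltnW // (sign_change_size h'ab).
apply: (IHm h' f r'); rewrite 1?mulrC // -?e' 1?mulrC //.
apply: leq_trans szf; move: szr'; rewrite e' size_mul //.
have := sign_change_size h'ab; move: sf.
have aux (x y : nat) : (1 < x -> 1 < y -> (y + x).-1 <= (x.-1 + x.-1).-1 -> y < x)%N.
  by lia.
exact: aux.
Qed.

(** The preordering generated by the nonnegative constants and by the multiples of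
   f is proper, by [sign_change_not_sos]. *)
Lemma ordered_extension_root (K : realFieldType) (f : {poly K}) (a b : K) :
  f.[a] * f.[b] < 0 ->
  exists (L : realFieldType) (iota : {rmorphism K -> L}),
    (forall x, 0 <= x -> 0 <= iota x) /\ exists th, root (map_poly iota f) th.
Proof.
move=> fab.
pose T : set {poly K} := [set t | exists r h,
  (forall x, x \in r -> 0 <= x.1) /\ t = weighted_sos r + h * f].
have TP : preordering T.
  split=> [? ?|? ?|g].
  - move=> [r [h [r0 ->]]] [s [k [s0 ->]]]; exists (r ++ s), (h + k); split.
      by move=> x; rewrite mem_cat => /orP[/r0|/s0].
    by rewrite /weighted_sos big_cat /=; ring.
  - move=> [r [h [r0 ->]]] [s [k [s0 ->]]].
    exists [seq (x.1 * y.1, x.2 * y.2) | x <- r, y <- s],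
      (h * weighted_sos s + k * weighted_sos r + h * k * f); split.
      by move=> _ /allpairsP[[x y] [/r0 ? /s0 ? ->]]; apply: mulr_ge0.
    by rewrite weighted_sosM; ring.
  - exists [:: (1, g)], 0; split; first by move=> x; rewrite inE => /eqP->.
    by rewrite /weighted_sos big_seq1 scale1r mul0r addr0.
have avT : proper_at 1 T.
  move=> k [r [h [r0]]]; rewrite expr1n expr1n => e.
  apply: (@sign_change_not_sos _ a b f (- h) r) => //.
  by rewrite mulNr -[1]opprK e; ring.
have [L [phi [phiT _]]] := ordered_field_of_preordering TP avT.
exists L, (phi \o polyC : {rmorphism K -> L}); split=> [x x0|].
  apply: phiT; exists [:: (x, 1)], 0; split; first by move=> y; rewrite inE => /eqP->.
  by rewrite /weighted_sos big_seq1 /= expr1n alg_polyC mul0r addr0.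
have phif0 : phi f = 0.
  apply/eqP; rewrite eq_le; apply/andP; split; first rewrite -oppr_ge0 -rmorphN.
    by apply: phiT; exists [::], (-1); rewrite /weighted_sos big_nil; split=> //; ring.
  by apply: phiT; exists [::], 1; rewrite /weighted_sos big_nil; split=> //; ring.
by exists (phi 'X); apply/eqP; rewrite -[RHS]phif0 [RHS]poly_initial.
Qed.

(** A root of f outside the interval can be divided out without destroying the
   sign change; when f has no root at all, any root in an extension is new. *)
Lemma root_or_extension (K : realFieldType) (f : {poly K}) (a b : K) :
  a < b -> f.[a] * f.[b] < 0 ->
  (exists2 c, a < c < b & root f c) \/
  exists (L : realFieldType) (iota : {rmorphism K -> L}),
    (forall x, 0 <= x -> 0 <= iota x) /\
    exists2 th, root (map_poly iota f) th & forall c, th <> iota c.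
Proof.
move=> ab; have [m] := ubnP (size f); elim: m => // m IHm in f *.
rewrite ltnS => szf fab.
have [[c fc]|noroot] := pselect (exists c, root f c); last first.
  have [L [iota [iota0 [th fth]]]] := ordered_extension_root fab.
  right; exists L, iota; split=> //; exists th => // c e.
  by apply: noroot; exists c; rewrite -(fmorph_root iota) -e.
have [acb|nacb] := boolP (a < c < b); first by left; exists c.
have [g eg] := factor_theorem _ _ fc.
have cab : 0 < (a - c) * (b - c).
  move: nacb; rewrite negb_and -!leNgt => out.
  have fac : f.[a] != 0 by apply: contraTneq fab => ->; rewrite mul0r ltxx.
  have fbc : f.[b] != 0 by apply: contraTneq fab => ->; rewrite mulr0 ltxx.
  have ca : c != a by apply: contraNneq fac => <-.
  have cb : c != b by apply: contraNneq fbc => <-.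
  case/orP: out => le.
    have {}le : c < a by rewrite lt_neqAle ca.
    by rewrite mulr_gt0 // subr_gt0 // (lt_trans le).
  have {}le : b < c by rewrite lt_neqAle eq_sym cb.
  by rewrite nmulr_rgt0 subr_lt0 // (lt_trans ab).
have gab : g.[a] * g.[b] < 0.
  move: fab; rewrite eg !hornerM !hornerXsubC.
  by rewrite mulrACA pmulr_llt0.
have g0 : g != 0 by rewrite -size_poly_gt0 ltnW // (sign_change_size gab).
have szg : (size g < m)%N.
  by apply: leq_trans szf; rewrite eg size_Mmonic ?monicXsubC // size_XsubC addn2.
have [[d abd gd]|[L [iota [iota0 [th gth nth]]]]] := IHm g szg gab.
  by left; exists d => //; rewrite eg rootM gd.
right; exists L, iota; split=> //; exists th => //.
by rewrite eg rmorphM /= rootM gth.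
Qed.

(** Each failure of the property produces an ordered extension with a new root of
   F, which can happen only finitely often. *)
Lemma extension_with_roots (K : realFieldType) (F : {poly K}) : F != 0 ->
  exists (L : realFieldType) (iota : {rmorphism K -> L}),
    (forall x, 0 <= x -> 0 <= iota x) /\ ivt_divisors (map_poly iota F).
Proof.
suff ext m : forall (K : realFieldType) (F : {poly K}) (rs : seq K),
    F != 0 -> uniq rs -> all (root F) rs -> (size F <= size rs + m)%N ->
    exists (L : realFieldType) (iota : {rmorphism K -> L}),
      (forall x, 0 <= x -> 0 <= iota x) /\ ivt_divisors (map_poly iota F).
  by move=> F0; apply: (ext (size F) K F [::]).
elim: m => {K F} [|m IHm] K F rs F0 urs Frs szF.
  by have := max_poly_roots F0 Frs urs; rewrite ltnNge -[size rs]addn0 szF.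
have [ivtF|/existsNP[g /not_implyP[gF]]] := pselect (ivt_divisors F).
  exists K, (idfun : {rmorphism K -> K}); split=> //.
  by rewrite map_poly_id.
move=> /existsNP[a /existsNP[b /not_implyP[ab /not_implyP[gab nog]]]].
have [//|[L [iota [iota0 [th gth nth]]]]] := root_or_extension ab gab.
have [||||L' [iota' [iota'0 ivtL']]] :=
    IHm L (map_poly iota F) (th :: [seq iota x | x <- rs]).
- by rewrite map_poly_eq0.
- rewrite /= map_inj_uniq ?urs ?andbT; last exact: fmorph_inj.
  by apply/mapP => -[x _]; exact: nth.
- rewrite /=; apply/andP; split.
    by move: gF => /dvdpP[q ->]; rewrite rmorphM /= rootM gth orbT.
  by apply/allP => _ /mapP[x /(allP Frs) Fx ->]; rewrite fmorph_root.
- by rewrite size_map_poly /= size_map addSnnS.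
exists L', (iota' \o iota : {rmorphism K -> L'}); split=> [x /iota0/iota'0 //|].
by rewrite map_poly_comp.
Qed.

(** * Comparing the real roots of two families of polynomials *)

Lemma seq_argmax (T : eqType) (K : realFieldType) (key : T -> K) (s : seq T) x0 :
  x0 \in s -> exists2 m, m \in s & forall x, x \in s -> key x <= key m.
Proof.
elim: s x0 => // y s IHs x0 _; case: s IHs => [_|z s IHs].
  by exists y => [|x]; rewrite inE // => /eqP ->.
have [m ms maxm] := IHs z (mem_head _ _).
have [le|lt] := leP (key y) (key m).
  by exists m => [|x]; rewrite inE ?ms ?orbT // => /orP[/eqP -> //|/maxm].
exists y => [|x]; rewrite inE ?eqxx // => /orP[/eqP -> //|/maxm le].
exact: le_trans le (ltW lt).
Qed.

Section OneField.
Variable K : realFieldType.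
Implicit Types (u g : {poly K}) (p q x : K).

Lemma ivt_divisorsW u g : g %| u -> ivt_divisors u -> ivt_divisors g.
Proof. by move=> gu ivt h hg; apply: ivt; apply: dvdp_trans gu. Qed.

Lemma poly_roots_seq u : u != 0 -> exists rs : seq K, forall x, root u x = (x \in rs).
Proof.
have [m] := ubnP (size u); elim: m => // m IHm in u *; rewrite ltnS => szu u0.
have [[c uc]|nor] := pselect (exists c, root u c); last first.
  by exists [::] => x; apply/negP => ux; apply: nor; exists x.
have [g eg] := factor_theorem _ _ uc.
have g0 : g != 0 by apply: contraNneq u0 => g0; rewrite eg g0 mul0r.
have [|rs ers] := IHm g _ g0.
  by apply: leq_trans szu; rewrite eg size_Mmonic ?monicXsubC // size_XsubC addn2.
by exists (c :: rs) => x; rewrite eg rootM root_XsubC inE ers orbC.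
Qed.

Lemma same_sgz_noroot u p q : ivt_divisors u -> p <= q ->
  (forall x, p <= x <= q -> ~~ root u x) -> sgz u.[p] = sgz u.[q].
Proof.
move=> ivt; rewrite le_eqVlt => /orP[/eqP -> //|pq] nor.
have p0 : u.[p] != 0 by apply: nor; rewrite lexx ltW.
have q0 : u.[q] != 0 by apply: nor; rewrite lexx ltW.
have [ss|] := ltP (u.[p] * u.[q]) 0.
  have [c /andP[pc cq]] := ivt u (dvdpp u) p q pq ss.
  by apply: contraTeq => _; apply: nor; rewrite !ltW.
move: p0 q0; rewrite !neq_lt => /orP[p0|p0] /orP[q0|q0].
- by rewrite !ltr0_sgz.
- by rewrite leNgt nmulr_rlt0 ?q0.
- by rewrite leNgt pmulr_rlt0 ?q0.
- by rewrite !gtr0_sgz.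
Qed.

(** For consecutive roots, u = (X - p)^m (X - q)^k h where h has a constant sign,
   and the cofactor w of u^`() takes values of opposite signs at p and q. *)
Lemma rolle_ivt u p q : u != 0 -> ivt_divisors u -> ivt_divisors u^`() -> p < q ->
  root u p -> root u q -> exists2 c, p < c < q & root u^`() c.
Proof.
move=> u0 ivt ivt'; wlog nor : q / forall x, p < x < q -> ~~ root u x => [wl|].
  move=> pq up uq; have [rs ers] := poly_roots_seq u0.
  have [|m] := @seq_argmax _ _ -%R [seq x <- rs | p < x <= q] q.
    by rewrite mem_filter pq lexx /= -ers.
  rewrite mem_filter -ers => /andP[/andP[pm mq] um] minm.
  have [x /andP[px xm]|//|//|//|c /andP[pc cm] u'c] := wl m.
    apply/negP => ux; have := minm x; rewrite mem_filter -ers ux px.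
    by rewrite (le_trans (ltW xm) mq) lerN2 leNgt xm => /(_ isT).
  by exists c => //; rewrite pc (lt_le_trans cm).
move=> pq up uq.
have [m [g]] := multiplicity_XsubC u p; rewrite u0 /= => gp eg.
have [k [h]] := multiplicity_XsubC g q.
have g0 : g != 0 by apply: contraNneq gp => ->; rewrite root0.
rewrite g0 /= => hq eh.
have {eg}eu : u = h * ('X - q%:P) ^+ k * ('X - p%:P) ^+ m by rewrite eg eh.
have hp : ~~ root h p by apply: contra gp; rewrite eh rootM => ->.
have m0 : (0 < m)%N.
  rewrite lt0n; apply: contraTneq up => m0.
  by rewrite eu m0 expr0 mulr1 -eh.
have k0 : (0 < k)%N.
  rewrite lt0n; apply: contraTneq uq => k0.
  rewrite eu k0 expr0 mulr1 rootM negb_or hq /root horner_exp hornerXsubC.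
  by rewrite expf_eq0 subr_eq0 (gt_eqF pq) andbF.
(* u^`() is the product of w and of powers of the two linear factors *)
pose w := h * ('X - p%:P) *+ k + h * ('X - q%:P) *+ m
  + h^`() * ('X - p%:P) * ('X - q%:P).
have ew : u^`() = w * (('X - q%:P) ^+ k.-1 * ('X - p%:P) ^+ m.-1).
  have ek : ('X - q%:P) ^+ k = ('X - q%:P) * ('X - q%:P) ^+ k.-1 by rewrite -exprS prednK.
  have em : ('X - p%:P) ^+ m = ('X - p%:P) * ('X - p%:P) ^+ m.-1 by rewrite -exprS prednK.
  rewrite eu [(h * _ * _)^`()]derivM [(h * _)^`()]derivM 2!deriv_exp !derivXsubC !mul1r /w.
  by rewrite ek em; set a := _ ^+ k.-1; set b := _ ^+ m.-1; ring.
have wp : w.[p] = h.[p] * (p - q) *+ m.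
  rewrite /w !(hornerXsubC, hornerD, hornerMn, hornerM) subrr.
  by rewrite !(mulr0, mul0r, mul0rn, add0r, addr0).
have wq : w.[q] = h.[q] * (q - p) *+ k.
  rewrite /w !(hornerXsubC, hornerD, hornerMn, hornerM) subrr.
  by rewrite !(mulr0, mul0r, mul0rn, add0r, addr0).
have hpq : 0 < h.[p] * h.[q].
  have hu : h %| u by rewrite eu -mulrA dvdp_mulr.
  have sgh : sgz h.[p] = sgz h.[q].
    apply: same_sgz_noroot (ltW pq) _; first exact: ivt_divisorsW hu ivt.
    move=> x /andP[]; rewrite le_eqVlt => /orP[/eqP <- _ //|px].
    rewrite le_eqVlt => /orP[/eqP -> //|xq].
    by apply: contra (nor x _); rewrite ?px // => hx; rewrite eu !rootM hx.
  rewrite -sgz_gt0 sgzM sgh -expr2 exprn_even_gt0 //= sgz_eq0.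
  by move: hq; rewrite /root.
have wu' : w %| u^`() by rewrite ew dvdp_mulr.
have [|c pcq wc] := ivt' w wu' p q pq.
  rewrite wp wq -[_ *+ m]mulr_natr -[_ *+ k]mulr_natr.
  have -> : h.[p] * (p - q) * m%:R * (h.[q] * (q - p) * k%:R)
    = - ((h.[p] * h.[q]) * (q - p) ^+ 2 * (m%:R * k%:R)) by ring.
  rewrite oppr_lt0; apply: mulr_gt0; last by rewrite mulr_gt0 ?ltr0n.
  by apply: mulr_gt0 => //; rewrite exprn_gt0 // subr_gt0.
by exists c => //; rewrite ew rootM wc.
Qed.

(** In u = (X - x) h the factor h has no root between p and q, since a second root
   of u would give a root of u^`() by Rolle's theorem. *)
Lemma simple_root_sign_change u p x q :
  u != 0 -> ivt_divisors u -> ivt_divisors u^`() -> p < x < q -> root u x ->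
  (forall y, p < y < q -> ~~ root u^`() y) -> u.[p] * u.[q] < 0.
Proof.
move=> u0 ivt ivt' /andP[px xq] ux nor'.
have [h eu] := factor_theorem _ _ ux.
have hx : ~~ root h x.
  apply: contra (nor' x _); rewrite ?px // => hx.
  by rewrite eu derivM derivXsubC mulr1 rootE hornerD hornerM hornerXsubC subrr
    mulr0 add0r.
have hu : h %| u by rewrite eu dvdp_mulr.
have norh y : p <= y <= q -> ~~ root h y.
  move=> /andP[py yq]; apply/negP => hy.
  have uy : root u y by rewrite eu rootM hy.
  have [yx|xy|e] := ltgtP y x; last by rewrite e (negPf hx) in hy.
    have [c /andP[yc cx]] := rolle_ivt u0 ivt ivt' yx uy ux.
    by apply/negP/nor'; rewrite (le_lt_trans py) // (lt_trans cx).
  have [c /andP[xc cy]] := rolle_ivt u0 ivt ivt' xy ux uy.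
  by apply/negP/nor'; rewrite (lt_trans px) // (lt_le_trans cy).
have pq := lt_trans px xq.
have sgh : sgz h.[p] = sgz h.[q].
  exact: same_sgz_noroot (ivt_divisorsW hu ivt) (ltW pq) norh.
rewrite eu !hornerM !hornerXsubC mulrACA pmulr_rlt0.
  by rewrite nmulr_rlt0 ?subr_gt0 // subr_lt0.
rewrite -sgz_gt0 sgzM sgh -expr2 exprn_even_gt0 //= sgz_eq0.
by move: (norh q); rewrite lexx ltW // => /(_ isT).
Qed.

(** By Rolle's theorem u cannot vanish at both ends, and by the intermediate value
   property it keeps the sign of an end where it does not vanish. *)
Lemma sgz_in_cell u p x q :
  u != 0 -> ivt_divisors u -> p < x < q ->
  (forall y, p < y < q -> ~~ root u y) ->
  ((1 < size u)%N -> ivt_divisors u^`() /\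
     forall y, p < y < q -> ~~ root u^`() y) ->
  sgz u.[x] = if u.[p] != 0 then sgz u.[p] else sgz u.[q].
Proof.
move=> u0 ivt /andP[px xq] nor der.
have [p0|p0] /= := eqVneq u.[p] 0; last first.
  apply/esym/(same_sgz_noroot ivt (ltW px)) => y /andP[].
  rewrite le_eqVlt => /orP[/eqP <- _ //|py yx].
  by apply: nor; rewrite py (le_lt_trans yx).
have [q0|q0] := eqVneq u.[q] 0.
  have su : (1 < size u)%N.
    rewrite ltnNge; apply: contra u0 => /size1_polyC eu.
    by move: p0; rewrite eu hornerC => ->.
  have /rootP up := p0; have /rootP uq := q0.
  have [ivt' nor'] := der su.
  have [c pcq uc] := rolle_ivt u0 ivt ivt' (lt_trans px xq) up uq.
  by move: (nor' c pcq); rewrite uc.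
apply: (same_sgz_noroot ivt (ltW xq)) => y /andP[xy].
rewrite le_eqVlt => /orP[/eqP -> //|yq].
by apply: nor; rewrite yq (lt_le_trans px).
Qed.

Lemma sgz_at_infinity (s : seq {poly K}) (x : K) : all (fun u => u != 0) s ->
  exists2 b, - b < x < b & forall u, u \in s -> forall y, b <= y ->
    sgz u.[y] = sgz (lead_coef u) /\
    sgz u.[- y] = sgz ((-1) ^+ (size u).-1 * lead_coef u).
Proof.
elim: s => [_|u s IHs /= /andP[u0 /IHs[b xb bs]]].
  exists (1 + `|x|) => //.
  by rewrite -ltr_norml ltrDr ltr01.
have far (v : {poly K}) : v != 0 ->
    exists c, forall y, c <= y -> sgz v.[y] = sgz (lead_coef v).
  rewrite -lead_coef_eq0 neq_lt => /orP[v0|v0].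
    have [|c le] := @poly_pinfty_gt_lc _ (- v); first by rewrite lead_coefN oppr_gt0.
    exists c => y /le; rewrite lead_coefN hornerN lerN2 => vy.
    by rewrite !ltr0_sgz // (le_lt_trans vy).
  have [c le] := poly_pinfty_gt_lc v0.
  by exists c => y /le vy; rewrite !gtr0_sgz // (lt_le_trans v0).
have [c1 far1] := far u u0.
have uX0 : u \Po - 'X != 0.
  by rewrite -lead_coef_eq0 lead_coef_comp ?size_polyN ?size_polyX //
    mulf_neq0 ?lead_coef_eq0 // expf_neq0 // lead_coefN lead_coefX oppr_eq0 oner_neq0.
have [c2 far2] := far _ uX0.
exists (b + (`|c1| + `|c2|)).
  case/andP: xb => bx xb; rewrite opprD.
  by apply/andP; split; have := normr_ge0 c1; have := normr_ge0 c2; lra.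
move=> v; rewrite inE => /orP[/eqP ->|vs] y le.
  have b0 : 0 < b by move: xb => /andP[? ?]; lra.
  have := ler_norm c1; have := ler_norm c2; have := normr_ge0 c1; have := normr_ge0 c2.
  move=> *; split; first by apply: far1; lra.
  have <- : lead_coef (u \Po - 'X) = (-1) ^+ (size u).-1 * lead_coef u.
    by rewrite lead_coef_comp ?size_polyN ?size_polyX // lead_coefN lead_coefX mulrC.
  rewrite -(far2 y); last by lra.
  by rewrite horner_comp hornerN hornerX.
apply: bs => //; apply: le_trans le; rewrite lerDl addr_ge0 ?normr_ge0 //.
Qed.

End OneField.

Lemma seq_cell (T : eqType) (K : realFieldType) (key : T -> K) (s : seq T) lo hi x :
  lo \in s -> hi \in s -> key lo <= x <= key hi -> (forall z, z \in s -> key z != x) ->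
  exists p q, [/\ p \in s, q \in s, key p < x < key q
    & forall z, z \in s -> key z <= key p \/ key q <= key z].
Proof.
move=> los his /andP[lox xhi] xs.
have [|p] := @seq_argmax _ _ key [seq z <- s | key z < x] lo.
  by rewrite mem_filter los andbT lt_neqAle lox andbT xs.
rewrite mem_filter => /andP[px ps] maxp.
have [|q] := @seq_argmax _ _ (fun z => - key z) [seq z <- s | x < key z] hi.
  by rewrite mem_filter his andbT lt_neqAle xhi andbT eq_sym xs.
rewrite mem_filter => /andP[xq qs] minq.
exists p, q; split=> // [|z zs]; first by rewrite px.
have := xs z zs; rewrite neq_lt => /orP[zx|xz]; [left|right].
  by apply: maxp; rewrite mem_filter zx.
by rewrite -lerN2; apply: minq; rewrite mem_filter xz.
Qed.

Section TwoFields.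
Variables (K1 K2 : realFieldType) (fam : seq ({poly K1} * {poly K2})).

(** The two components of a pair are the images of one polynomial under two
   specializations of its coefficients.  The constants c1 and c2 in the last clause leave
   room for pseudo-division. *)
Record matching_family : Prop := MatchingFamily {
  matching_neq0 : forall w, w \in fam -> w.1 != 0;
  matching_size : forall w, w \in fam -> size w.1 = size w.2;
  matching_lead : forall w, w \in fam -> sgz (lead_coef w.1) = sgz (lead_coef w.2);
  matching_ivt1 : forall w, w \in fam -> ivt_divisors w.1;
  matching_ivt2 : forall w, w \in fam -> ivt_divisors w.2;
  matching_deriv : forall w, w \in fam -> (1 < size w.1)%N ->
    (w.1^`(), w.2^`()) \in fam;
  matching_rem : forall w f, w \in fam -> f \in fam -> (1 < size f.1)%N ->
    exists c1 q1 r1 c2 q2 r2,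
      [/\ c1 *: w.1 = q1 * f.1 + r1, c2 *: w.2 = q2 * f.2 + r2,
          sgz c1 = sgz c2 /\ c1 != 0, (size r1 < size f.1)%N
        & r1 = 0 /\ r2 = 0 \/ (r1, r2) \in fam] }.

Hypothesis famP : matching_family.
Variables (lo hi : K1 * K2).
Implicit Types (ps : seq (K1 * K2)) (w f : {poly K1} * {poly K2}).

Definition matches (z : K1 * K2) :=
  forall w, w \in fam -> sgz w.1.[z.1] = sgz w.2.[z.2].

(** A finite order isomorphism between points of the two fields, at which the two
   families have the same signs.  The pairs lo and hi bound the cells from the outside. *)
Record good ps : Prop := Good {
  good_lo : lo \in ps;
  good_hi : hi \in ps;
  good_bounds : forall z, z \in ps -> lo.1 <= z.1 <= hi.1;
  good_order : forall z t, z \in ps -> t \in ps -> sgz (z.1 - t.1) = sgz (z.2 - t.2);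
  good_matches : forall z, z \in ps -> matches z }.

Definition complete ps w :=
  (forall x, lo.1 <= x <= hi.1 -> root w.1 x -> exists2 z, z \in ps & z.1 = x) /\
  (forall x, lo.2 <= x <= hi.2 -> root w.2 x -> exists2 z, z \in ps & z.2 = x).

Lemma matching_neq0_2 w : w \in fam -> w.2 != 0.
Proof.
move=> wf; rewrite -size_poly_gt0 -(matching_size famP wf) size_poly_gt0.
exact: matching_neq0 famP _ wf.
Qed.

Lemma good_lt ps z t : good ps -> z \in ps -> t \in ps ->
  (z.1 < t.1) = (z.2 < t.2).
Proof.
move=> gps zp tp; rewrite -subr_lt0 -[RHS]subr_lt0 -sgz_lt0 -[RHS]sgz_lt0.
by rewrite (good_order gps).
Qed.

Lemma good_le ps z t : good ps -> z \in ps -> t \in ps ->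
  (z.1 <= t.1) = (z.2 <= t.2).
Proof. by move=> gps zp tp; rewrite !leNgt (good_lt gps). Qed.

Definition cell ps (p q : K1 * K2) :=
  [/\ p \in ps, q \in ps & forall z, z \in ps -> z.1 <= p.1 \/ q.1 <= z.1].

Lemma cell_noroot ps p q w : good ps -> cell ps p q -> complete ps w ->
  (forall y, p.1 < y < q.1 -> ~~ root w.1 y) /\
  (forall y, p.2 < y < q.2 -> ~~ root w.2 y).
Proof.
move=> gps [pp qp pq] [c1 c2].
have his := good_hi gps; have los := good_lo gps.
split=> y /andP[py yq]; apply/negP => wy.
  have [|z zs ez] := c1 y _ wy.
    have /andP[lop _] := good_bounds gps pp.
    have /andP[_ qhi] := good_bounds gps qp.
    by rewrite (le_trans lop (ltW py)) (le_trans (ltW yq)).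
  by have [] := pq z zs; rewrite ez leNgt ?py ?yq.
have [|z zs ez] := c2 y _ wy.
  have /andP[lop _] := good_bounds gps pp.
  have /andP[_ qhi] := good_bounds gps qp.
  rewrite (good_le gps) // in lop; rewrite (good_le gps) // in qhi.
  by rewrite (le_trans lop (ltW py)) (le_trans (ltW yq)).
by have [] := pq z zs; rewrite (good_le gps) // ez leNgt ?py ?yq.
Qed.

Lemma cell_deriv ps p q w : good ps -> cell ps p q -> w \in fam -> (1 < size w.1)%N ->
  complete ps (w.1^`(), w.2^`()) ->
  [/\ ivt_divisors w.1^`(), ivt_divisors w.2^`(),
      forall y, p.1 < y < q.1 -> ~~ root w.1^`() y
    & forall y, p.2 < y < q.2 -> ~~ root w.2^`() y].
Proof.
move=> gps pq wf sw c'; have df := matching_deriv famP wf sw.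
have [n1 n2] := cell_noroot gps pq c'.
by split; [exact: (matching_ivt1 famP df)|exact: (matching_ivt2 famP df)| |].
Qed.

Lemma cell_sgz ps p q w x y : good ps -> cell ps p q -> w \in fam -> complete ps w ->
  ((1 < size w.1)%N -> complete ps (w.1^`(), w.2^`())) ->
  p.1 < x < q.1 -> p.2 < y < q.2 -> sgz w.1.[x] = sgz w.2.[y].
Proof.
move=> gps pq wf cw c'w px py; have [pp qp _] := pq.
have [n1 n2] := cell_noroot gps pq cw.
rewrite (sgz_in_cell (matching_neq0 famP wf) (matching_ivt1 famP wf) px n1); last first.
  by move=> sw; have [] := cell_deriv gps pq wf sw (c'w sw).
rewrite (sgz_in_cell (matching_neq0_2 wf) (matching_ivt2 famP wf) py n2); last first.
  rewrite -(matching_size famP wf) => sw.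
  by have [] := cell_deriv gps pq wf sw (c'w sw).
have mp := good_matches gps pp wf; have mq := good_matches gps qp wf.
by rewrite -sgz_eq0 -[w.2.[_] == 0]sgz_eq0 mp mq.
Qed.

Lemma complete_sub ps ps' w : {subset ps <= ps'} -> complete ps w -> complete ps' w.
Proof.
move=> sub [c1 c2]; split=> x bx wx.
  by have [z /sub zs ez] := c1 x bx wx; exists z.
by have [z /sub zs ez] := c2 x bx wx; exists z.
Qed.

Section Insertion.
Variables (f : {poly K1} * {poly K2}) (ps0 : seq (K1 * K2)).
Hypothesis ff : f \in fam.
Hypothesis complete0 : forall w, w \in fam -> (size w.1 < size f.1)%N -> complete ps0 w.

Lemma complete_deriv ps : {subset ps0 <= ps} -> (1 < size f.1)%N ->
  complete ps (f.1^`(), f.2^`()).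
Proof.
move=> sub sf; apply: complete_sub sub _; apply: complete0.
  exact: matching_deriv famP _ ff sf.
by rewrite lt_size_deriv // (matching_neq0 famP ff).
Qed.

Lemma cell_sign_change ps p q : good ps -> p \in ps -> q \in ps ->
  (f.1.[p.1] * f.1.[q.1] < 0) = (f.2.[p.2] * f.2.[q.2] < 0).
Proof.
move=> gps pp qp; rewrite -sgz_lt0 -[RHS]sgz_lt0 !sgzM.
by rewrite (good_matches gps pp ff) (good_matches gps qp ff).
Qed.

(** The missing root lies in a cell, where the derivative has no root; so f.1
   changes sign between the ends of the cell, f.2 does it too, and has a root there.
   The signs at the new points are those of the remainders by f, which have a
   smaller size and whose signs on the cell are known. *)
Lemma insert_root ps xi : {subset ps0 <= ps} -> good ps -> (1 < size f.1)%N ->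
  lo.1 <= xi <= hi.1 -> root f.1 xi ->
  exists ps', [/\ {subset ps <= ps'}, good ps' & exists2 z, z \in ps' & z.1 = xi].
Proof.
move=> sub gps sf xi_b fxi.
have [|none] := pselect (exists2 z, z \in ps & z.1 = xi); first by exists ps; split.
have xs z : z \in ps -> z.1 != xi.
  by move=> zs; apply/eqP => e; apply: none; exists z.
have [p [q [pp qp pxq pq]]] := seq_cell (good_lo gps) (good_hi gps) xi_b xs.
have cpq : cell ps p q by split.
have [ivt1' ivt2' n1' n2'] := cell_deriv gps cpq ff sf (complete_deriv sub sf).
have := simple_root_sign_change (matching_neq0 famP ff) (matching_ivt1 famP ff)
  ivt1' pxq fxi n1'.
rewrite (cell_sign_change gps) // => ch2.
have p2q2 : p.2 < q.2 by rewrite -(good_lt gps) //; case/andP: pxq; exact: lt_trans.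
have [eta peq feta] := matching_ivt2 famP ff (dvdpp _) p2q2 ch2.
have [px xq] := andP pxq; have [pe eq] := andP peq.
pose z0 := (xi, eta).
have order0 t : t \in ps -> sgz (z0.1 - t.1) = sgz (z0.2 - t.2).
  move=> tp; have [tle|tge] := pq t tp.
    have tle2 : t.2 <= p.2 by rewrite -(good_le gps).
    by rewrite !gtr0_sgz // subr_gt0; [exact: le_lt_trans pe|exact: le_lt_trans px].
  have tge2 : q.2 <= t.2 by rewrite -(good_le gps).
  by rewrite !ltr0_sgz // subr_lt0; [exact: lt_le_trans tge2|exact: lt_le_trans tge].
exists (z0 :: ps); split=> [t tp|| ]; last by exists z0; rewrite ?mem_head.
  by rewrite inE tp orbT.
split=> [||z|z t|z].
- by rewrite inE (good_lo gps) orbT.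
- by rewrite inE (good_hi gps) orbT.
- by rewrite inE => /orP[/eqP ->|/(good_bounds gps)].
- rewrite !inE => /orP[/eqP ->|zp] /orP[/eqP ->|tp].
  + by rewrite !subrr !sgz0.
  + exact: order0.
  + by rewrite -opprB sgzN order0 // -sgzN opprB.
  + exact: good_order gps _ _ zp tp.
rewrite inE => /orP[/eqP ->|/(good_matches gps) //] w wf.
have [c1 [q1 [r1 [c2 [q2 [r2 [e1 e2 [sc c0] sr r_or]]]]]]] := matching_rem famP wf ff sf.
have ew1 : c1 * w.1.[xi] = r1.[xi].
  by rewrite -hornerZ e1 hornerD hornerM (rootP fxi) mulr0 add0r.
have ew2 : c2 * w.2.[eta] = r2.[eta].
  by rewrite -hornerZ e2 hornerD hornerM (rootP feta) mulr0 add0r.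
have sgr : sgz r1.[xi] = sgz r2.[eta].
  case: r_or => [[-> ->]|rf]; first by rewrite !horner0 !sgz0.
  apply: (cell_sgz gps cpq rf _ _ pxq peq).
    by apply: complete_sub sub _; apply: complete0.
  move=> sr1; apply: complete_sub sub _; apply: complete0.
    exact: (matching_deriv famP rf).
  apply: leq_ltn_trans sr; rewrite ltnW // lt_size_deriv //.
  by rewrite -size_poly_gt0 ltnW.
have := sgr; rewrite -ew1 -ew2 !sgzM sc => /mulfI; apply.
by rewrite -sc sgz_eq0.
Qed.

(** Once the roots of f.1 are matched, no root of f.2 is left: it would make f.2,
   hence f.1, change sign on a cell that contains no root of f.1. *)
Lemma insert_all_roots : good ps0 ->
  exists ps, [/\ {subset ps0 <= ps}, good ps & complete ps f].
Proof.
move=> g0; have f0 := matching_neq0 famP ff.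
have [sf|sf] := leqP (size f.1) 1.
  have const (K : realFieldType) (u : {poly K}) x :
      u != 0 -> (size u <= 1)%N -> ~~ root u x.
    by move=> u0 /size1_polyC eu; move: u0; rewrite eu rootC polyC_eq0.
  exists ps0; split=> //; split=> x _; rewrite (negPf (const _ _ _ _ _)) //.
    exact: matching_neq0_2.
  by rewrite -(matching_size famP ff).
have [rs ers] := poly_roots_seq f0.
have [ps [sub gps done1]] : exists ps, [/\ {subset ps0 <= ps}, good ps
    & forall x, x \in rs -> lo.1 <= x <= hi.1 -> exists2 z, z \in ps & z.1 = x].
  have: {subset rs <= root f.1} by move=> x; rewrite -ers.
  elim: rs {ers} => [|x rs IHrs] fr; first by exists ps0; split.
  have [|ps [sub gps dn]] := IHrs; first by move=> y yr; apply: fr; rewrite inE yr orbT.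
  have [xb|xb] := boolP (lo.1 <= x <= hi.1); last first.
    exists ps; split=> // y; rewrite inE => /orP[/eqP -> yb|/dn //].
    by rewrite yb in xb.
  have [ps' [sub' gps' zx]] := insert_root sub gps sf xb (fr x (mem_head _ _)).
  exists ps'; split=> // [z /sub/sub' //|y].
  rewrite inE => /orP[/eqP -> //|/dn dy /dy[z /sub' zp ez]].
  by exists z.
exists ps; split=> //; split=> x xb fx; first by apply: done1; rewrite // -ers.
apply: contrapT => none.
have xs z : z \in ps -> z.2 != x.
  by move=> zs; apply/eqP => e; apply: none; exists z.
have [p [q [pp qp pxq pq]]] := seq_cell (good_lo gps) (good_hi gps) xb xs.
have cpq : cell ps p q by split=> // z zs; rewrite !(good_le gps) //; exact: pq.
have [ivt1' ivt2' n1' n2'] := cell_deriv gps cpq ff sf (complete_deriv sub sf).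
have := simple_root_sign_change (matching_neq0_2 ff) (matching_ivt2 famP ff)
  ivt2' pxq fx n2'.
rewrite -(cell_sign_change gps) // => ch1.
have p1q1 : p.1 < q.1 by rewrite (good_lt gps) //; case/andP: pxq; exact: lt_trans.
have [xi /andP[px xq] fxi] := matching_ivt1 famP ff (dvdpp _) p1q1 ch1.
have [||z zp ez] := done1 xi; first by rewrite -ers.
  have /andP[lop _] := good_bounds gps pp; have /andP[_ qhi] := good_bounds gps qp.
  by rewrite (le_trans lop (ltW px)) (le_trans (ltW xq)).
have [_ _ /(_ z zp)[]] := cpq; rewrite ez leNgt ?px ?xq //.
Qed.

End Insertion.

(** Derivatives and remainders have smaller sizes, so the polynomials are processed
   by increasing sizes. *)
Lemma complete_all ps : good ps ->
  exists2 ps', good ps' & forall w, w \in fam -> complete ps' w.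
Proof.
move=> gps.
have [d dP] : exists d, forall w, w \in fam -> (size w.1 < d)%N.
  elim: fam => [|w s [d dP]]; first by exists 0.
  exists (maxn (size w.1).+1 d) => f; rewrite inE => /orP[/eqP ->|/dP lt].
    by rewrite leq_max leqnn.
  by rewrite leq_max lt orbT.
suff [ps' gps' cps'] : exists2 ps', good ps' & forall w, w \in fam ->
    (size w.1 < d)%N -> complete ps' w.
  by exists ps' => // w wf; apply: cps' => //; apply: dP.
elim: d {dP} => [|d [ps1 gps1 cps1]]; first by exists ps.
suff H : forall s : seq ({poly K1} * {poly K2}), exists ps2, [/\ {subset ps1 <= ps2}, good ps2 &
    forall w, w \in s -> w \in fam -> (size w.1 < d.+1)%N -> complete ps2 w].
  by have [ps2 [_ gps2 cps2]] := H fam; exists ps2 => // w wf; apply: cps2.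
elim=> [|f s [ps2 [sub gps2 cps2]]]; first by exists ps1; split.
have [/andP[ff sf]|nf] := boolP ((f \in fam) && (size f.1 < d.+1)%N); last first.
  exists ps2; split=> // w; rewrite inE => /orP[/eqP ->|/cps2 //] ff sf.
  by rewrite ff sf in nf.
have lower w : w \in fam -> (size w.1 < size f.1)%N -> complete ps2 w.
  move=> wf lt; apply: complete_sub sub _; apply: cps1 => //.
  exact: leq_trans lt _.
have [ps3 [sub' gps3 cps3]] := insert_all_roots ff lower gps2.
exists ps3; split=> // [z /sub/sub' //|w].
rewrite inE => /orP[/eqP -> //|ws] wf sw.
by apply: complete_sub sub' _; apply: cps2.
Qed.

End TwoFields.

(** The sign of each polynomial at x depends only on the cell, or on the point of
   the list, where x lies; any y in the corresponding place will do. *)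
Lemma transfer_point (K1 K2 : realFieldType) (fam : seq ({poly K1} * {poly K2})) (x : K1) :
  matching_family fam ->
  exists y, forall w, w \in fam -> sgz w.1.[x] = sgz w.2.[y].
Proof.
move=> famP.
have [|b1 xb1 far1] := @sgz_at_infinity _ [seq w.1 | w <- fam] x.
  by apply/allP => _ /mapP[w wf ->]; apply: matching_neq0 famP _ wf.
have [|b2 xb2 far2] := @sgz_at_infinity _ [seq w.2 | w <- fam] 0.
  by apply/allP => _ /mapP[w wf ->]; apply: matching_neq0_2 famP _ wf.
pose lo := (- b1, - b2); pose hi := (b1, b2).
have [b1n b1p] := andP xb1; have [b2n b2p] := andP xb2.
have lohi1 : lo.1 < hi.1 by apply: lt_trans b1n b1p.
have lohi2 : lo.2 < hi.2 by apply: lt_trans b2n b2p.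
have ends w : w \in fam ->
    sgz w.1.[b1] = sgz w.2.[b2] /\ sgz w.1.[- b1] = sgz w.2.[- b2].
  move=> wf; have [-> ->] := far1 _ (map_f _ wf) _ (lexx b1).
  have [-> ->] := far2 _ (map_f _ wf) _ (lexx b2).
  rewrite !sgzM (matching_lead famP wf) (matching_size famP wf); split=> //.
  by rewrite !sgzX !sgzN !sgz1.
have g0 : good fam lo hi [:: lo; hi].
  split=> [||z|z t|z]; rewrite ?inE ?eqxx ?orbT //.
  - by move=> /orP[/eqP ->|/eqP ->]; rewrite lexx ltW.
  - move=> /orP[/eqP ->|/eqP ->] /orP[/eqP ->|/eqP ->]; rewrite ?subrr ?sgz0 //.
      by rewrite !ltr0_sgz ?subr_lt0.
    by rewrite !gtr0_sgz ?subr_gt0.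
  - by move=> /orP[/eqP ->|/eqP ->] w /ends[].
have [ps gps cps] := complete_all famP g0.
have [[z zp ez]|none] := pselect (exists2 z, z \in ps & z.1 = x).
  by exists z.2 => w wf; rewrite -ez (good_matches gps).
have xs z : z \in ps -> z.1 != x.
  by move=> zs; apply/eqP => e; apply: none; exists z.
have [|p [q [pp qp pxq pq]]] := seq_cell (good_lo gps) (good_hi gps) _ xs.
  by rewrite !ltW.
have p2q2 : p.2 < q.2 by rewrite -(good_lt gps) //; case/andP: pxq; exact: lt_trans.
exists ((p.2 + q.2) / 2) => w wf.
apply: (cell_sgz famP gps (And3 pp qp pq) wf (cps w wf)) => //.
  by move=> sw; apply/cps/(matching_deriv famP).
by rewrite !midf_lt.
Qed.

(** * Transfer of sign conditions in one more variable *)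

Lemma sgz_morph (K L : realFieldType) (iota : {rmorphism K -> L}) (x : K) :
  (forall y, 0 <= y -> 0 <= iota y) -> sgz (iota x) = sgz x.
Proof.
move=> iota0; have pos y : 0 < y -> 0 < iota y.
  by move=> y0; rewrite lt_def fmorph_eq0 gt_eqF ?iota0 // ltW.
have [->|x0] := eqVneq x 0; first by rewrite rmorph0 !sgz0.
move: x0; rewrite neq_lt => /orP[x0|x0]; last by rewrite !gtr0_sgz ?pos.
by rewrite !ltr0_sgz // -oppr_gt0 -rmorphN pos // oppr_gt0.
Qed.

Section OneVariable.
Variables (S : idomainType) (L : realFieldType) (alpha : {rmorphism S -> L}).
Implicit Types (f g h q r : {poly S}) (C : seq {poly S}) (E : seq S).

Definition agree (M : realFieldType) E (beta : {rmorphism S -> M}) :=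
  forall s, s \in E -> sgz (beta s) = sgz (alpha s).

Definition nondegenerate f := alpha (lead_coef f) != 0.

(** The degree of f may drop under alpha.  It then drops in the same way under any
   beta that agrees with alpha on the coefficients of f. *)
Definition truncation f : {poly S} := \poly_(i < size (map_poly alpha f)) f`_i.

Lemma agree_eq0 (M : realFieldType) E (beta : {rmorphism S -> M}) s :
  agree E beta -> s \in E -> (beta s == 0) = (alpha s == 0).
Proof. by move=> ag sE; rewrite -sgz_eq0 ag // sgz_eq0. Qed.

Lemma agreeW (M : realFieldType) E E' (beta : {rmorphism S -> M}) :
  {subset E <= E'} -> agree E' beta -> agree E beta.
Proof. by move=> sub ag s /sub/ag. Qed.

Lemma map_truncation f : map_poly alpha (truncation f) = map_poly alpha f.
Proof.
apply/polyP => i; rewrite !coef_map coef_poly /=; case: ltnP => //.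
by move=> le; rewrite rmorph0 -coef_map nth_default.
Qed.

Lemma map_truncation_agree (M : realFieldType) (beta : {rmorphism S -> M}) f :
  agree f beta -> map_poly beta (truncation f) = map_poly beta f.
Proof.
move=> ag; apply/polyP => i; rewrite !coef_map coef_poly /=; case: ltnP => //.
move=> le; rewrite rmorph0; apply/esym/eqP.
have [lt|ge] := ltnP i (size f); last by rewrite nth_default ?rmorph0.
by rewrite (agree_eq0 ag) ?mem_nth // -coef_map nth_default.
Qed.

Lemma size_truncation f : (size (truncation f) <= size f)%N.
Proof. exact: leq_trans (size_poly _ _) (size_poly _ _). Qed.

Lemma truncation_nondegenerate f : truncation f != 0 -> nondegenerate (truncation f).
Proof.
have [af0|af0] := eqVneq (map_poly alpha f) 0.
  by rewrite /truncation af0 size_poly0 poly_def big_ord0 eqxx.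
have lc0 : alpha f`_(size (map_poly alpha f)).-1 != 0.
  by rewrite -coef_map -lead_coefE lead_coef_eq0.
rewrite /nondegenerate /truncation lead_coef_poly //.
  by rewrite size_poly_gt0.
by apply: contraNneq lc0 => ->; rewrite rmorph0.
Qed.

Lemma lead_coef_deriv f : nondegenerate f -> (1 < size f)%N ->
  [/\ nondegenerate f^`(), size f^`() = (size f).-1 &
      lead_coef f^`() = lead_coef f *+ (size f).-1].
Proof.
move=> nf sf; have c0 : alpha (f^`()`_(size f).-2) != 0.
  rewrite coef_deriv; case: (size f) sf (lead_coefE f) => [|[|n]] // _ /= <-.
  by rewrite rmorphMn mulrn_eq0 negb_or.
have szd : size f^`() = (size f).-1.
  apply/eqP; rewrite eqn_leq; apply/andP; split.
    have : (size f^`() < size f)%N by rewrite lt_size_deriv // -size_poly_gt0 ltnW.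
    by case: (size f).
  rewrite leqNgt; apply/negP => lt; move: c0.
  rewrite nth_default ?rmorph0 ?eqxx //.
  by move: lt sf; case: (size f) => [|[|k]].
have lcd : lead_coef f^`() = lead_coef f *+ (size f).-1.
  rewrite lead_coefE szd coef_deriv lead_coefE.
  by case: (size f) sf => [|[|n]].
split=> //; rewrite /nondegenerate lcd rmorphMn mulrn_eq0 negb_or -lt0n.
by rewrite [_ != 0]nf andbT; case: (size f) sf => [|[|k]].
Qed.

(** The remainder is a pseudo-remainder, truncated; this is why its defining
   identity is required after specialization only. *)
Definition closed_above D C E := forall f, f \in C -> (D < size f)%N ->
  f^`() \in C /\
  forall h, h \in C -> exists k q r, [/\ r = 0 \/ r \in C, (size r < size f)%N,
    alpha (lead_coef f) ^+ k *: map_poly alpha h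
      = map_poly alpha q * map_poly alpha f + map_poly alpha r
    & forall (M : realFieldType) (beta : {rmorphism S -> M}), agree E beta ->
      beta (lead_coef f) ^+ k *: map_poly beta h
      = map_poly beta q * map_poly beta f + map_poly beta r].

(** Derivatives and remainders have to be added for the polynomials of size D + 1
   only: what is added has size at most D, and is its own remainder by any
   polynomial of larger size. *)
Lemma closure_step D C E : (0 < D)%N -> all nondegenerate C -> closed_above D.+1 C E ->
  exists C' E', [/\ {subset C <= C'}, {subset E <= E'}, all nondegenerate C'
    & closed_above D C' E'].
Proof.
move=> D0 nC clC; pose F := [seq f : {poly S} <- C | size f == D.+1].
pose N1 := [seq f^`() | f <- F].
pose rems := [seq h %% f | h <- C, f <- F].
pose N2 := [seq g <- map truncation rems | g != 0].
exists (C ++ N1 ++ N2), (E ++ flatten (map (@polyseq S) rems)); split.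
- by move=> f fC; rewrite mem_cat fC.
- by move=> s sE; rewrite mem_cat sE.
- rewrite !all_cat nC /=; apply/andP; split; apply/allP => g.
    move=> /mapP[f]; rewrite mem_filter => /andP[/eqP szf fC] ->.
    by have [] := lead_coef_deriv (allP nC f fC); rewrite ?szf.
  rewrite mem_filter => /andP[g0 /mapP[r _ eg]].
  by rewrite eg; apply: truncation_nondegenerate; rewrite -eg.
have szN g : g \in N1 ++ N2 -> (size g <= D)%N.
  rewrite mem_cat => /orP[/mapP[f]|].
    rewrite mem_filter => /andP[/eqP szf fC] ->.
    by have [|_ ->] := lead_coef_deriv (allP nC f fC); rewrite ?szf.
  rewrite mem_filter => /andP[_ /mapP[r /allpairsP[[h f] /= [hC fF ->]] ->]].
  rewrite mem_filter in fF; have /andP[/eqP szf fC] := fF.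
  rewrite (leq_trans (size_truncation _)) // -ltnS -szf ltn_modp.
  by rewrite -size_poly_gt0 szf.
move=> f; rewrite mem_cat => /orP[fC|/szN le lt]; last by rewrite ltnNge le in lt.
rewrite leq_eqVlt eq_sym => szf.
have fF : size f = D.+1 -> f \in F by move=> e; rewrite mem_filter e eqxx.
have sf : (1 < size f)%N.
  by case/orP: szf => [/eqP ->|]; rewrite ?ltnS //; apply: leq_trans.
split.
  case/orP: szf => [/eqP szf|szf].
    rewrite !mem_cat; apply/orP; right; apply/orP; left.
    by apply/mapP; exists f; rewrite // fF.
  by rewrite mem_cat (clC f fC szf).1.
move=> h; rewrite mem_cat => /orP[hC|hN]; last first.
  exists 0%N, 0, h; split; first by right; rewrite mem_cat hN orbT.
  - rewrite (leq_ltn_trans (szN h hN)) //.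
    by case/orP: szf => [/eqP ->|szf] //; apply: ltnW.
  - by rewrite expr0 scale1r rmorph0 mul0r add0r.
  - by move=> M beta _; rewrite expr0 scale1r rmorph0 mul0r add0r.
case/orP: szf => [/eqP szf|szf]; last first.
  have [k [q [r [r_or sr ea eb]]]] := (clC f fC szf).2 h hC.
  exists k, q, r; split=> //.
    by case: r_or => [->|rC]; [left|right; rewrite mem_cat rC].
  by move=> M beta ag; apply: eb; apply: agreeW ag => s sE; rewrite mem_cat sE.
have remC : h %% f \in rems by apply/allpairsP; exists (h, f); rewrite hC fF.
have divE (K : realFieldType) (gamma : {rmorphism S -> K}) :
    gamma (lead_coef f) ^+ scalp h f *: map_poly gamma h
      = map_poly gamma (h %/ f) * map_poly gamma f + map_poly gamma (h %% f).
  by rewrite -rmorphXn -map_polyZ Pdiv.Idomain.divp_eq rmorphD rmorphM.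
exists (scalp h f), (h %/ f), (truncation (h %% f)); split.
- have [->|t0] := eqVneq (truncation (h %% f)) 0; [by left|right].
  by rewrite !mem_cat mem_filter t0 map_f ?orbT.
- rewrite (leq_ltn_trans (size_truncation _)) // ltn_modp.
  by rewrite -size_poly_gt0 ltnW.
- by rewrite map_truncation.
- move=> M beta ag; rewrite map_truncation_agree //.
  apply: agreeW ag => s sr; rewrite mem_cat; apply/orP; right.
  by apply/flattenP; exists (h %% f : seq S); rewrite ?map_f.
Qed.

Lemma closure_exists C : all nondegenerate C -> exists C' E,
  [/\ {subset C <= C'}, all nondegenerate C' & closed_above 1 C' E].
Proof.
move=> nC.
have [d dP] : exists d, forall f, f \in C -> (size f <= d)%N.
  elim: C {nC} => [|w s [d dP]]; first by exists 0%N.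
  exists (maxn (size w) d) => f; rewrite inE => /orP[/eqP ->|/dP lt].
    by rewrite leq_max leqnn.
  by rewrite leq_max lt orbT.
suff H k : exists C' E, [/\ {subset C <= C'}, all nondegenerate C'
    & closed_above (1 + (d - k)) C' E].
  by have := H d; rewrite subnn addn0.
elim: k => [|k [C1 [E1 [sub nC1 cl1]]]].
  exists C, [::]; split=> // f fC; rewrite subn0 add1n ltnNge.
  by rewrite (leq_trans (dP f fC)).
have [lt|ge] := ltnP k d; last first.
  by exists C1, E1; split=> //; have -> : (d - k.+1 = d - k)%N by lia.
have [||C2 [E2 [sub2 _ nC2 cl2]]] := @closure_step (1 + (d - k.+1)) C1 E1 _ nC1.
- by rewrite add1n.
- by rewrite add1n -subSn // subSS -add1n.
by exists C2, E2; split=> // f /sub/sub2.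
Qed.

(** The list E collects the coefficients whose signs determine the degrees, the
   leading signs and the remainders in a closed family containing Q; specializing
   this family by alpha and by beta gives a matching family. *)
Lemma transfer_one_variable (M : realFieldType) (th : L) (Q : seq {poly S}) :
  (forall u : {poly M}, u != 0 -> ivt_divisors u) ->
  exists E, forall beta : {rmorphism S -> M}, agree E beta ->
    exists z, forall q, q \in Q ->
      sgz (map_poly beta q).[z] = sgz (map_poly alpha q).[th].
Proof.
move=> ivtM.
have [|C [E [QC nC clC]]] := @closure_exists [seq f <- map truncation Q | f != 0].
  apply/allP => f; rewrite mem_filter => /andP[f0 /mapP[q _ ef]].
  by rewrite ef; apply: truncation_nondegenerate; rewrite -ef.
pose F := \prod_(f <- C) map_poly alpha f.
have map_neq0 f : f \in C -> map_poly alpha f != 0.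
  move=> fC; apply: contraNneq (allP nC f fC) => af0.
  by rewrite lead_coefE -coef_map af0 coef0.
have F0 : F != 0.
  rewrite prodf_seq_neq0; apply/allP => f fC; exact: map_neq0.
have [L1 [iota [iota0 ivtF]]] := extension_with_roots F0.
exists (E ++ [seq lead_coef f | f <- C] ++ flatten (map (@polyseq S) Q)) => beta ag.
have agC f : f \in C -> sgz (beta (lead_coef f)) = sgz (alpha (lead_coef f)).
  by move=> fC; apply: ag; rewrite !mem_cat map_f ?orbT.
have agE : agree E beta by apply: agreeW ag => s sE; rewrite mem_cat sE.
have agQ q : q \in Q -> agree q beta.
  move=> qQ; apply: agreeW ag => s sq; rewrite !mem_cat; apply/orP; right.
  by apply/orP; right; apply/flattenP; exists (q : seq S); rewrite ?map_f.
pose gamma : {rmorphism S -> L1} := iota \o alpha.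
have betaC f : f \in C -> beta (lead_coef f) != 0.
  by move=> fC; rewrite -sgz_eq0 agC // sgz_eq0; exact: (allP nC).
have gammaC f : f \in C -> gamma (lead_coef f) != 0.
  by move=> fC; rewrite fmorph_eq0; exact: (allP nC).
have sgz_gamma s : sgz (gamma s) = sgz (alpha s) by exact: sgz_morph iota0.
have map_gamma q : map_poly gamma q = map_poly iota (map_poly alpha q).
  exact: map_poly_comp.
pose im f := (map_poly gamma f, map_poly beta f).
have famP : matching_family [seq im f | f <- C].
  split=> [_ /mapP[f fC ->]|_ /mapP[f fC ->]|_ /mapP[f fC ->]|_ /mapP[f fC ->]
    |_ /mapP[f fC ->]|_ /mapP[f fC ->]|_ f' /mapP[h hC ->] /mapP[f fC ->]] /=.
  - by rewrite map_gamma map_poly_eq0 map_neq0.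
  - by rewrite !size_map_poly_id0 ?betaC ?gammaC.
  - by rewrite !lead_coef_map_id0 ?betaC ?gammaC ?rmorph0 ?[LHS]sgz_gamma ?agC.
  - apply: ivt_divisorsW ivtF; rewrite map_gamma dvdp_map.
    by rewrite /F (big_rem f) //=; apply: dvdp_mulIl.
  - by apply: ivtM; rewrite -lead_coef_eq0 lead_coef_map_id0 ?betaC ?rmorph0.
  - rewrite size_map_poly_id0 ?gammaC // => sf.
    by have [dC _] := clC f fC sf; rewrite !deriv_map; apply/mapP; exists f^`().
  rewrite size_map_poly_id0 ?gammaC // => sf.
  have [_ /(_ h hC)[k [q [r [r_or sr ea eb]]]]] := clC f fC sf.
  exists (gamma (lead_coef f) ^+ k), (map_poly gamma q), (map_poly gamma r).
  exists (beta (lead_coef f) ^+ k), (map_poly beta q), (map_poly beta r); split.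
  - rewrite !map_gamma -rmorphM -rmorphD -ea /=.
    by rewrite map_polyZ rmorphXn.
  - exact: eb.
  - by rewrite !sgzX agC // sgz_gamma expf_neq0 // gammaC.
  - by rewrite (leq_ltn_trans (size_poly _ _)).
  by case: r_or => [->|rC]; [left; rewrite !rmorph0|right; rewrite map_f].
have [z zP] := transfer_point (iota th) famP.
exists z => q qQ; rewrite -(map_truncation q) -(map_truncation_agree (agQ q qQ)).
have [->|t0] := eqVneq (truncation q) 0; first by rewrite !rmorph0 !horner0 !sgz0.
have tC : truncation q \in C by apply: QC; rewrite mem_filter t0 map_f.
rewrite -(zP (im (truncation q))) ?map_f //=.
by rewrite map_gamma horner_map sgz_morph.
Qed.

End OneVariable.

(** * Noetherian rings *)

(** Finite generation of I, expressed through the ideals that contain the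
   generators rather than through linear combinations. *)
Definition noetherian (S : comPzRingType) : Prop := forall I : ideal S,
  exists gs : seq S, (forall g, g \in gs -> I g) /\
    forall J : ideal S, (forall g, g \in gs -> J g) -> forall a, I a -> J a.

Lemma idealN (S : comPzRingType) (I : ideal S) a : I a -> I (- a).
Proof. by rewrite -mulN1r; apply: idealM. Qed.

Lemma idealB (S : comPzRingType) (I : ideal S) a b : I a -> I b -> I (a - b).
Proof. by move=> Ia /idealN; apply: idealD. Qed.

Definition zero_ideal (S : comPzRingType) : ideal S :=
  @Ideal S (fun a => a = 0) erefl
    (fun a b a0 b0 => etrans (congr2 +%R a0 b0) (addr0 0))
    (fun a b b0 => etrans (congr1 (GRing.mul a) b0) (mulr0 a)).

Section PreimageIdeal.
Variables (S T : comPzRingType) (phi : {rmorphism S -> T}) (I : ideal T).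

Lemma preimage_ideal_proof :
  [/\ I (phi 0), forall a b, I (phi a) -> I (phi b) -> I (phi (a + b)) &
    forall a b, I (phi b) -> I (phi (a * b))].
Proof.
split=> [|a b|a b]; first by rewrite rmorph0; exact: ideal0.
  by rewrite rmorphD; exact: idealD.
by rewrite rmorphM; exact: idealM.
Qed.

Definition preimage_ideal : ideal S :=
  let: And3 p0 pD pM := preimage_ideal_proof in
  @Ideal S (fun a => I (phi a)) p0 pD pM.

Lemma preimage_idealE a : preimage_ideal a = I (phi a).
Proof. by rewrite /preimage_ideal; case: preimage_ideal_proof. Qed.

End PreimageIdeal.

Lemma noetherian_surj (S T : comPzRingType) (phi : {rmorphism S -> T}) :
  (forall t, exists s, t = phi s) -> noetherian S -> noetherian T.
Proof.
move=> surj nS I; have [gs [gsI genI]] := nS (preimage_ideal phi I).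
exists [seq phi g | g <- gs]; split=> [_ /mapP[g /gsI gI ->]|J gsJ t It].
  by rewrite -preimage_idealE.
have [s es] := surj t; rewrite es in It *; rewrite -preimage_idealE.
apply: genI; last by rewrite preimage_idealE.
by move=> g gg; rewrite preimage_idealE; apply/gsJ/map_f.
Qed.

Lemma noetherian_field (F : fieldType) : noetherian F.
Proof.
move=> I; have [[a Ia a0]|I0] := pselect (exists2 a, I a & a != 0).
  exists [:: a]; split=> [g|J Ja b _]; first by rewrite inE => /eqP ->.
  by rewrite -[b](mulfVK a0); apply/idealM/Ja/mem_head.
exists [::]; split=> // J _ a Ia; have [->|a0] := eqVneq a 0; first exact: ideal0.
by case: I0; exists a.
Qed.

Section HilbertBasis.
Variables (S : comNzRingType) (nS : noetherian S) (I : ideal {poly S}).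

Definition coef_set (J : ideal {poly S}) d : set S :=
  [set a | exists f, [/\ J f, (size f <= d.+1)%N & f`_d = a]].

Lemma coef_ideal_proof J d : [/\ coef_set J d 0,
  forall a b, coef_set J d a -> coef_set J d b -> coef_set J d (a + b) &
  forall a b, coef_set J d b -> coef_set J d (a * b)].
Proof.
split=> [|a b [f [Jf sf <-]] [g [Jg sg <-]]|a b [f [Jf sf <-]]].
- by exists 0; rewrite size_poly0 coef0; split=> //; exact: ideal0.
- exists (f + g); rewrite coefD (leq_trans (size_polyD _ _)) ?geq_max ?sf //.
  by split=> //; exact: idealD.
- exists (a%:P * f); rewrite coefCM mul_polyC (leq_trans (size_scale_leq _ _)) //.
  by rewrite -mul_polyC; split=> //; exact: idealM.
Qed.

Definition coef_ideal J d : ideal S :=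
  let: And3 p0 pD pM := coef_ideal_proof J d in @Ideal S (coef_set J d) p0 pD pM.

Lemma coef_idealE J d a : coef_ideal J d a = coef_set J d a.
Proof. by rewrite /coef_ideal; case: coef_ideal_proof. Qed.

Lemma coef_idealS J d e a : (d <= e)%N -> coef_set J d a -> coef_set J e a.
Proof.
move=> de [f [Jf sf <-]]; exists (f * 'X^(e - d)); split.
- by rewrite mulrC; exact: idealM.
- rewrite (leq_trans (size_polyMleq _ _)) // size_polyXn.
  by rewrite addnS /= (leq_trans (leq_add sf (leqnn _))) // addSn subnKC.
- by rewrite coefMXn ltnNge leq_subr /= subKn.
Qed.

Definition generates_coefs (gs : seq {poly S}) d := forall J : ideal {poly S},
  (forall g, g \in gs -> J g) -> forall a, coef_set I d a -> coef_set J d a.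

Lemma generates_coefsW gs gs' d : {subset gs <= gs'} ->
  generates_coefs gs d -> generates_coefs gs' d.
Proof. by move=> sub gen J gsJ; apply: gen => g /sub/gsJ. Qed.

Lemma lift_coefs d (cs : seq S) : (forall c, c \in cs -> coef_set I d c) ->
  exists gs : seq {poly S}, [/\ forall g, g \in gs -> I g,
    forall g, g \in gs -> (size g <= d.+1)%N &
    forall c, c \in cs -> exists2 g, g \in gs & g`_d = c].
Proof.
elim: cs => [|c cs IHcs] csI; first by exists [::].
have [f [If sf ef]] := csI c (mem_head _ _).
have [|gs [gsI sgs ecs]] := IHcs; first by move=> b bc; apply: csI; rewrite inE bc orbT.
exists (f :: gs); split=> [g|g|b]; rewrite inE => /orP[/eqP ->|] //.
- exact: gsI.
- exact: sgs.
- by exists f; rewrite ?mem_head.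
- by move=> /ecs[g gg e]; exists g; rewrite // inE gg orbT.
Qed.

Lemma generates_coefs_exists d : exists2 gs : seq {poly S}, forall g, g \in gs -> I g &
  generates_coefs gs d.
Proof.
have [cs [csI gen]] := nS (coef_ideal I d).
have [c|gs [gsI sgs ecs]] := @lift_coefs d cs; first by rewrite -coef_idealE; exact: csI.
exists gs => // J gsJ a; rewrite -!coef_idealE; apply: gen => c /ecs[g gg e].
by rewrite coef_idealE; exists g; split; [exact: gsJ|exact: sgs|].
Qed.

Lemma generates_coefs_below N : exists2 gs : seq {poly S}, forall g, g \in gs -> I g &
  forall d, (d < N)%N -> generates_coefs gs d.
Proof.
elim: N => [|N [gs gsI gen]]; first by exists [::].
have [gs' gs'I gen'] := generates_coefs_exists N.
exists (gs ++ gs') => [g|d].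
  by rewrite mem_cat => /orP[/gsI|/gs'I].
rewrite ltnS leq_eqVlt => /orP[/eqP ->|/gen gend].
  by apply: generates_coefsW gen' => g gg; rewrite mem_cat gg orbT.
by apply: generates_coefsW gend => g gg; rewrite mem_cat gg.
Qed.

Lemma all_coefs_ideal_proof : [/\ exists d, coef_set I d 0,
  forall a b, (exists d, coef_set I d a) -> (exists d, coef_set I d b) ->
    exists d, coef_set I d (a + b) &
  forall a b, (exists d, coef_set I d b) -> exists d, coef_set I d (a * b)].
Proof.
split=> [|a b [d da] [e eb]|a b [d db]].
- by exists 0%N; have [] := coef_ideal_proof I 0.
- exists (maxn d e); have [_ + _] := coef_ideal_proof I (maxn d e); apply.
    exact: coef_idealS (leq_maxl _ _) da.
  exact: coef_idealS (leq_maxr _ _) eb.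
- by exists d; have [_ _] := coef_ideal_proof I d; apply.
Qed.

Definition all_coefs_ideal : ideal S :=
  let: And3 p0 pD pM := all_coefs_ideal_proof in
  @Ideal S (fun a => exists d, coef_set I d a) p0 pD pM.

(** The ideal of all leading coefficients is generated by coefficients that already
   occur in one degree N; multiplication by powers of X does the rest. *)
Lemma generates_coefs_above : exists N, exists2 gs : seq {poly S}, forall g, g \in gs -> I g &
  forall d, (N <= d)%N -> generates_coefs gs d.
Proof.
have allE a : all_coefs_ideal a = exists d, coef_set I d a.
  by rewrite /all_coefs_ideal; case: all_coefs_ideal_proof.
have [cs [csI gen]] := nS all_coefs_ideal.
have [N csN] : exists N, forall c, c \in cs -> coef_set I N c.
  elim: cs csI {gen} => [|c cs IHcs] csI; first by exists 0%N.
  have [|N csN] := IHcs; first by move=> b bc; apply: csI; rewrite inE bc orbT.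
  have [e ec] : exists d, coef_set I d c by rewrite -allE; apply/csI/mem_head.
  exists (maxn e N) => b; rewrite inE => /orP[/eqP ->|/csN Nb].
    exact: coef_idealS (leq_maxl _ _) ec.
  exact: coef_idealS (leq_maxr _ _) Nb.
have [gs [gsI sgs ecs]] := lift_coefs csN.
exists N, gs => // d Nd J gsJ a Ia; rewrite -coef_idealE.
apply: gen; last by rewrite allE; exists d.
move=> c /ecs[g gg e]; rewrite coef_idealE; apply: coef_idealS Nd _.
by exists g; split; [exact: gsJ|exact: sgs|].
Qed.

(** Induction on the degree of f: an element of both I and J has the same leading
   coefficient, and the difference is in I with a smaller degree. *)
Lemma hilbert_basis_ideal : exists gs : seq {poly S}, (forall g, g \in gs -> I g) /\
  forall J : ideal {poly S}, (forall g, g \in gs -> J g) -> forall f, I f -> J f.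
Proof.
have [N [gs1 gs1I gen1]] := generates_coefs_above.
have [gs2 gs2I gen2] := generates_coefs_below N.
have gsI g : g \in gs1 ++ gs2 -> I g.
  by rewrite mem_cat => /orP[/gs1I|/gs2I].
exists (gs1 ++ gs2); split=> // J gsJ f.
have gen d : generates_coefs (gs1 ++ gs2) d.
  have [dN|Nd] := ltnP d N.
    by apply: generates_coefsW (gen2 d dN) => g gg; rewrite mem_cat gg orbT.
  by apply: generates_coefsW (gen1 d Nd) => g gg; rewrite mem_cat gg.
pose K : ideal {poly S} := @Ideal _ (fun g => I g /\ J g)
  (conj (ideal0 I) (ideal0 J))
  (fun a b Ka Kb => conj (idealD Ka.1 Kb.1) (idealD Ka.2 Kb.2))
  (fun a b Kb => conj (idealM a Kb.1) (idealM a Kb.2)).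
have [m] := ubnP (size f); elim: m => // m IHm in f *; rewrite ltnS => sf If.
have [f0|] := posnP (size f).
  by move/eqP: f0; rewrite size_poly_eq0 => /eqP ->; exact: ideal0.
case szf : (size f) => [//|d] _.
have [||g [[Ig Jg] sg eg]] := gen d K _ f`_d.
- by move=> g gg; split; [exact: gsI|exact: gsJ].
- by exists f; split; rewrite ?szf.
rewrite -[f](subrK g); apply: idealD => //; apply: IHm; last exact: idealB.
rewrite (leq_trans _ sf) // szf ltnS; apply/leq_sizeP => j.
rewrite leq_eqVlt => /orP[/eqP <-|dj]; first by rewrite coefB eg subrr.
by rewrite coefB !nth_default ?subrr ?szf // (leq_trans sg).
Qed.

End HilbertBasis.

Lemma hilbert_basis (S : comNzRingType) : noetherian S -> noetherian {poly S}.
Proof. by move=> nS I; exact: hilbert_basis_ideal. Qed.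

(** * Multivariate polynomials *)

Lemma mpoly_morph_ext (R : nzRingType) (n : nat) (T : comPzRingType)
    (u v : {rmorphism {mpoly R[n]} -> T}) :
  (forall c, u c%:MP = v c%:MP) -> (forall i, u 'X_i = v 'X_i) -> u =1 v.
Proof.
move=> uvC uvX p; rewrite (mpolyE p) !raddf_sum; apply: eq_bigr => m _ /=.
rewrite -mul_mpolyC mpolyXE_id !rmorphM uvC !rmorph_prod; congr (_ * _).
by apply: eq_bigr => i _; rewrite !rmorphXn uvX.
Qed.

Section LastVariable.
Variables (R : comNzRingType) (n : nat).

Lemma muniXlast : muni ('X_ord_max : {mpoly R[n.+1]}) = 'X.
Proof.
rewrite muniE msuppX big_seq1 mcoeffX eqxx scale1r mnm1E eqxx expr1.
rewrite (_ : [multinom _ | _ < _] = 0%MM) ?mpolyX0 ?scale1r //.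
by apply/mnmP => i; rewrite mnmE mnm1E mnm0E -val_eqE /= gtn_eqF.
Qed.

Lemma muniXwiden (i : 'I_n) : muni ('X_(widen_ord (leqnSn n) i) : {mpoly R[n.+1]}) = ('X_i)%:P.
Proof.
rewrite muniE msuppX big_seq1 mcoeffX eqxx scale1r mnm1E.
rewrite -val_eqE /= ltn_eqF // expr0 alg_polyC; congr (_%:P).
by congr mpolyX; apply/mnmP => j; rewrite mnmE !mnm1E -!val_eqE.
Qed.

Lemma ord_lastP (P : 'I_n.+1 -> Prop) :
  P ord_max -> (forall i, P (widen_ord (leqnSn n) i)) -> forall i, P i.
Proof.
move=> Pmax Pw i; have [lt|ge] := ltnP i n.
  by have -> : i = widen_ord (leqnSn n) (Ordinal lt) by apply: val_inj.
have -> : i = ord_max by apply: val_inj; apply/eqP; rewrite eqn_leq ge -ltnS ltn_ord.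
exact: Pmax.
Qed.

Definition poly_to_mpoly : {rmorphism {poly {mpoly R[n]}} -> {mpoly R[n.+1]}} :=
  horner_morph (fun p => mulrC 'X_ord_max (mwiden p)).

Lemma poly_to_mpolyC p : poly_to_mpoly p%:P = mwiden p.
Proof. exact: horner_morphC. Qed.

Lemma poly_to_mpolyK : cancel (@muni n R) poly_to_mpoly.
Proof.
apply: (mpoly_morph_ext (u := poly_to_mpoly \o @muni n R) (v := idfun)) => [c|].
  by rewrite /= muniC poly_to_mpolyC mwidenC.
apply: ord_lastP => [|i] /=.
  by rewrite muniXlast horner_morphX.
by rewrite muniXwiden poly_to_mpolyC mwidenX mnmwiden1.
Qed.

Lemma pair_pt_last (x : 'I_n -> R) t : pair_pt x t ord_max = t.
Proof. by rewrite /pair_pt unlift_none. Qed.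

Lemma pair_pt_widen (x : 'I_n -> R) t i : pair_pt x t (widen_ord (leqnSn n) i) = x i.
Proof.
rewrite /pair_pt; have -> : widen_ord (leqnSn n) i = lift ord_max i.
  by apply: val_inj; rewrite /= /bump leqNgt ltn_ord.
by rewrite liftK.
Qed.

Lemma meval_muni (x : 'I_n -> R) t p :
  p.@[pair_pt x t] = (map_poly (meval x) (muni p)).[t].
Proof.
apply: (mpoly_morph_ext (u := meval (pair_pt x t))
  (v := horner_morph (fun c => mulrC t (meval x c)) \o @muni n R)) => [c|].
  by rewrite /= muniC mevalC [RHS]horner_morphC [RHS]mevalC.
apply: ord_lastP => [|i] /=.
  by rewrite muniXlast [RHS]horner_morphX [LHS]mevalXU pair_pt_last.
by rewrite muniXwiden [RHS]horner_morphC [RHS]mevalXU [LHS]mevalXU pair_pt_widen.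
Qed.

End LastVariable.

Arguments poly_to_mpoly {R n}.

Lemma mpoly_noetherian (F : fieldType) n : noetherian {mpoly F[n]}.
Proof.
elim: n => [|n IHn].
  apply: (@noetherian_surj F _ (@mpolyC 0 F)); last exact: noetherian_field.
  move=> p; exists p@_0%MM; apply/mpolyP => m.
  rewrite mcoeffC; have -> : m = 0%MM by apply/mnmP => -[].
  by rewrite eqxx mulr1.
apply: (@noetherian_surj _ _ (@poly_to_mpoly F n)); last exact: hilbert_basis.
by move=> p; exists (muni p); rewrite poly_to_mpolyK.
Qed.

(** * The real Nullstellensatz *)

Lemma rcf_ivt_divisors (R : rcfType) (u : {poly R}) : ivt_divisors u.
Proof.
move=> g _ a b ab gab; have [c] := poly_ivtoo (ltW ab) gab.
by rewrite in_itv; exists c.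
Qed.

(** Induction on the number of variables: alpha is seen as a specialization of
   polynomials in the last variable, whose coefficients are handled by induction. *)
Lemma transfer_mpoly (R : rcfType) n (L : realFieldType)
    (alpha : {rmorphism {mpoly R[n]} -> L}) (Q : seq {mpoly R[n]}) :
  exists x : 'I_n -> R, forall q, q \in Q -> sgz q.@[x] = sgz (alpha q).
Proof.
elim: n alpha Q => [|n IHn] alpha Q.
  exists (fun=> 0) => q _.
  have -> : q = (q@_0%MM)%:MP.
    apply/mpolyP => m; rewrite mcoeffC; have -> : m = 0%MM by apply/mnmP => -[].
    by rewrite eqxx mulr1.
  rewrite mevalC; apply/esym/(sgz_morph (iota := alpha \o @mpolyC 0 R)).
  by move=> y y0; rewrite -(sqr_sqrtr y0) rmorphXn sqr_ge0.
pose S : idomainType := {mpoly R[n]}.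
pose gamma : {rmorphism {poly S} -> L} := alpha \o @poly_to_mpoly R n.
have [E EP] := @transfer_one_variable S L (gamma \o polyC) R (gamma 'X)
  (map (@muni n R) Q) (fun u _ => @rcf_ivt_divisors R u).
have [x xE] := IHn (gamma \o polyC) E.
have [t tP] := EP (meval x) xE.
exists (pair_pt x t) => q qQ; rewrite meval_muni tP ?map_f //.
rewrite -[in RHS](poly_to_mpolyK q) -[alpha (poly_to_mpoly _)]/(gamma (muni q)).
by rewrite [in RHS]poly_initial.
Qed.

Lemma real_ideal_seq (A : comPzRingType) (I : ideal A) (s : seq A) :
  real_ideal I -> I (\sum_(a <- s) a ^+ 2) -> forall a, a \in s -> I a.
Proof.
move=> rI; rewrite (big_nth 0) big_mkord => /rI Is a /(nthP 0)[i lt <-].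
exact: (Is (Ordinal lt)).
Qed.

(** A square in I has its root in I, so that the exponent can be halved. *)
Lemma real_ideal_radical (A : comPzRingType) (I : ideal A) a k :
  real_ideal I -> I (a ^+ k) -> I a.
Proof.
move=> rI; have sq b : I (b ^+ 2) -> I b.
  move=> Ib; apply: (@real_ideal_seq _ I [:: b] rI _ b (mem_head _ _)).
  by rewrite big_seq1.
have [m] := ubnP k; elim: m => // m IHm in k *; rewrite ltnS => km Ik.
case: k => [|[|k]] in km Ik *; last 1 first.
- apply: (IHm (uphalf k.+2)).
    by lia.
  apply: sq; rewrite -exprM muln2.
  have le : (k.+2 <= (uphalf k.+2).*2)%N by lia.
  by rewrite -(subnK le) exprD; exact: idealM.
- by rewrite -[a]mulr1; apply: idealM.
- by [].
Qed.

(** The sums of squares modulo I form a preordering, which is proper at h because I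
   is real and does not contain h.  It gives a generic point where the elements of I
   vanish and h does not; the signs of h and of generators of I transfer to the reals. *)
Theorem real_nullstellensatz (R : rcfType) n (I : ideal {mpoly R[n]}) h :
  real_ideal I ->
  (forall x : 'I_n -> R, (forall p, I p -> p.@[x] = 0) -> h.@[x] = 0) -> I h.
Proof.
move=> rI vanish; apply: contrapT => nIh.
pose T : set {mpoly R[n]} :=
  [set t | exists s p, I p /\ t = \sum_(a <- s) a ^+ 2 + p].
have IT p : I p -> T p by move=> Ip; exists [::], p; rewrite big_nil add0r.
have pT : preordering T.
  split=> [? ?|? ?|a].
  - move=> [s [p [Ip ->]]] [s' [p' [Ip' ->]]]; exists (s ++ s'), (p + p').
    by split; [exact: idealD|rewrite big_cat /=; ring].
  - move=> [s [p [Ip ->]]] [s' [p' [Ip' ->]]].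
    exists [seq a * b | a <- s, b <- s'], ((\sum_(a <- s) a ^+ 2) * p'
      + (\sum_(b <- s') b ^+ 2 + p') * p); split.
      by apply: idealD; apply: idealM.
    rewrite mulrDl !mulrDr big_distrlr /= big_flatten big_map.
    under [X in _ = X + _]eq_bigr => a _ do rewrite big_map.
    under [X in X + _ + _ = _]eq_bigr => a _ do under eq_bigr => b _ do rewrite -exprMn.
    by ring.
  - by exists [:: a], 0; rewrite big_seq1 addr0; split=> //; exact: ideal0.
have [L [phi [phiT phih]]] : exists (L : realFieldType)
    (phi : {rmorphism {mpoly R[n]} -> L}), (forall a, T a -> 0 <= phi a) /\ phi h != 0.
  apply: ordered_field_of_preordering pT _ => k [s [p [Ip e]]].
  apply: nIh; apply: (@real_ideal_radical _ _ _ k) => //.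
  apply: (@real_ideal_seq _ I (h ^+ k :: s) rI _ _ (mem_head _ _)).
  rewrite big_cons; have -> : \sum_(a <- s) a ^+ 2 = - (h ^+ k) ^+ 2 - p by rewrite e; ring.
  by rewrite addrA subrr add0r; exact: idealN.
have phiI p : I p -> phi p = 0.
  move=> Ip; apply/eqP; rewrite eq_le phiT ?andbT; last exact: IT.
  by rewrite -oppr_ge0 -rmorphN phiT //; apply/IT/idealN.
have [gs [gsI gen]] := mpoly_noetherian I.
have [x xP] := transfer_mpoly phi (h :: gs).
pose J := preimage_ideal (meval x) (zero_ideal R).
have hx0 : h.@[x] = 0.
  apply: vanish => p /(gen J); rewrite preimage_idealE; apply=> g gg.
  rewrite preimage_idealE /=; apply/eqP.
  by rewrite -sgz_eq0 xP ?inE ?gg ?orbT // phiI ?sgz0 //; exact: gsI.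
by move: phih; rewrite -sgz_eq0 -xP ?mem_head // hx0 sgz0 eqxx.
Qed.


(** * Maximal ideals of localizations *)

Section MaximalIdeals.
Variable B : comPzRingType.

Lemma jacobsonD (a b : B) :
  jacobson_radical a -> jacobson_radical b -> jacobson_radical (a + b).
Proof. by move=> ra rb m mm; apply: idealD; [exact: ra|exact: rb]. Qed.

Lemma jacobsonM (a b : B) : jacobson_radical b -> jacobson_radical (a * b).
Proof. by move=> rb m mm; apply/idealM/rb. Qed.

Section AddPrincipal.
Variables (m : ideal B) (x : B).

Definition add_principal_set : set B := [set z | exists2 y, m y & exists c, z = y + c * x].

Lemma add_principal_proof : [/\ add_principal_set 0,
  forall a b, add_principal_set a -> add_principal_set b -> add_principal_set (a + b) &
  forall a b, add_principal_set b -> add_principal_set (a * b)].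
Proof.
split=> [|_ _ [y my [c ->]] [z mz [d ->]]|a _ [y my [c ->]]].
- by exists 0; [exact: ideal0|exists 0; rewrite mul0r addr0].
- by exists (y + z); [exact: idealD|exists (c + d); ring].
- by exists (a * y); [exact: idealM|exists (a * c); ring].
Qed.

Definition add_principal : ideal B :=
  let: And3 p0 pD pM := add_principal_proof in @Ideal B add_principal_set p0 pD pM.

Lemma add_principalE a : add_principal a = add_principal_set a.
Proof. by rewrite /add_principal; case: add_principal_proof. Qed.

End AddPrincipal.

Lemma maximal_inverse (m : ideal B) x : maximal_ideal m -> ~ m x ->
  exists y, m (1 - y * x).
Proof.
move=> [m1 mmax] nmx; apply: contrapT => none; apply: nmx.
apply: (mmax (add_principal m x)) => [a ma||]; rewrite add_principalE.
- by exists a => //; exists 0; rewrite mul0r addr0.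
- by move=> [y my [c e]]; apply: none; exists c; rewrite e addrK.
- by exists 0; [exact: ideal0|exists 1; rewrite add0r mul1r].
Qed.

Lemma maximal_prime (m : ideal B) : maximal_ideal m -> prime_ideal m.
Proof.
move=> mm; split; first exact: mm.1.
move=> a b mab; apply: contrapT => /not_orP[na nb].
have [y my] := maximal_inverse mm na.
apply: nb; have -> : b = b * (1 - y * a) + y * (a * b) by ring.
by apply: idealD; apply: idealM.
Qed.

Lemma prime_idealX (m : ideal B) a k : prime_ideal m -> m (a ^+ k) -> m a.
Proof.
move=> [m1 mM]; elim: k => [/m1 //|k IHk]; rewrite exprS.
by move=> /mM[//|/IHk].
Qed.

Lemma nonunit_maximal (h : B) : (forall m, maximal_ideal m -> ~ m h) ->
  exists w, w * h = 1.
Proof.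
move=> nomax; apply: contrapT => nounit.
pose G : set (set B) := [set J | exists I : ideal B, (I : set B) = J /\ ~ I 1].
have [||M [SM [I [eI I1]] maxM]] := @Zorn_above _ G (add_principal (zero_ideal B) h).
- exists (add_principal (zero_ideal B) h); split=> //; rewrite add_principalE.
  by move=> [y -> [c e]]; apply: nounit; exists c; rewrite e add0r.
- move=> F [J0 FJ0] FG totF.
  have both a b : (\bigcup_(X in F) X) a -> (\bigcup_(X in F) X) b ->
      exists2 X, F X & X a /\ X b.
    move=> [X FX Xa] [Y FY Yb].
    by have [XY|YX] := totF _ _ FX FY;
      [exists Y|exists X] => //; split=> //; [apply: XY|apply: YX].
  have u0 : (\bigcup_(X in F) X) 0.
    exists J0 => //; have [[I [<- _]] _] := FG _ FJ0; exact: ideal0.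
  have uD a b : (\bigcup_(X in F) X) a -> (\bigcup_(X in F) X) b ->
      (\bigcup_(X in F) X) (a + b).
    move=> ua ub; have [X FX [Xa Xb]] := both a b ua ub; exists X => //.
    by have [[I [eI _]] _] := FG _ FX; rewrite -eI in Xa Xb *; exact: idealD.
  have uM a b : (\bigcup_(X in F) X) b -> (\bigcup_(X in F) X) (a * b).
    move=> [X FX Xb]; exists X => //.
    by have [[I [eI _]] _] := FG _ FX; rewrite -eI in Xb *; exact: idealM.
  exists (Ideal u0 uD uM); split=> // -[X FX X1].
  by have [[I [eI nI]] _] := FG _ FX; rewrite -eI in X1.
apply: (nomax I); last first.
  rewrite -[_ h]/((I : set B) h) eI; apply: SM; rewrite add_principalE.
  by exists 0 => //; exists 1; rewrite add0r mul1r.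
split=> // J IJ J1 a Ja; rewrite -[_ a]/((I : set B) a) eI.
apply: (maxM J) => //; last by exists J.
by rewrite -eI.
Qed.

Lemma jacobson_unit (u v r : B) : u * v = 1 -> jacobson_radical r ->
  exists w, w * (u + r) = 1.
Proof.
move=> uv rr; apply: nonunit_maximal => m mm mur; apply: mm.1.
rewrite -uv mulrC; apply: idealM; rewrite -(addrK r u).
by apply: idealB => //; apply: rr.
Qed.

End MaximalIdeals.

Lemma poly_morph_ext (M : nzRingType) (B : pzRingType) (u v : {rmorphism {poly M} -> B}) :
  (forall c, u c%:P = v c%:P) -> u 'X = v 'X -> u =1 v.
Proof.
move=> uvC uvX; elim/poly_ind => [|p c IHp]; first by rewrite !rmorph0.
by rewrite !rmorphD !rmorphM IHp uvC uvX.
Qed.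

(** The target may be the zero ring, as for an empty variety; it is then treated
   apart because horner evaluation is defined for nonzero rings. *)
Lemma poly_eval_exists (M : comNzRingType) (B : comPzRingType)
    (psi : {rmorphism M -> B}) (b : B) :
  exists2 ev : {rmorphism {poly M} -> B}, (forall c, ev c%:P = psi c) & ev 'X = b.
Proof.
have [B0|B1] := eqVneq (1 : B) 0.
  have all0 (x : B) : x = 0 by rewrite -[x]mul1r B0 mul0r.
  pose ev (p : {poly M}) : B := 0.
  have evB : zmod_morphism ev by move=> p q; rewrite [RHS]all0.
  have evM : GRing.monoid_morphism ev by split=> [|p q]; rewrite [RHS]all0.
  pose ev' : {rmorphism {poly M} -> B} := HB.pack ev
    (GRing.isZmodMorphism.Build _ _ ev evB) (GRing.isMonoidMorphism.Build _ _ ev evM).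
  by exists ev' => [c|]; rewrite [RHS]all0 [LHS]all0.
pose B' : comNzRingType := HB.pack (GRing.ComPzRing.sort B)
  (GRing.PzSemiRing_isNonZero.Build B B1).
pose psi' : {rmorphism M -> B'} := psi.
have cfb : commr_rmorph psi' (b : B') by move=> c; exact: (mulrC (b : B')).
exists (horner_morph cfb : {rmorphism {poly M} -> B'}) => [c|].
  exact: (horner_morphC cfb).
exact: (horner_morphX cfb).
Qed.

Section Localization.
Variables (A B : comPzRingType) (phi : {rmorphism A -> B}).
Hypothesis phi_int : forall b, integral phi b.
Variables (p : ideal A) (pP : prime_ideal p).
Local Notation Bp := (localization (compl phi pP)).

Lemma base_invertible s (ps : ~ p s) :
  to_loc (compl phi pP) (phi s) * Defs.frac 1 (compl_den phi pP ps) = 1.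
Proof.
rewrite /to_loc fracM; apply: frac_eq; rewrite denE /= mulr1 mul1r mulr1 mul1r.
by [].
Qed.

Lemma base_notin_maximal (m : ideal Bp) s : maximal_ideal m -> ~ p s ->
  ~ m (to_loc (compl phi pP) (phi s)).
Proof.
move=> mm ps ms; apply: mm.1; rewrite -(base_invertible ps) mulrC.
exact: idealM.
Qed.

(** Otherwise the image of a would be invertible modulo m, with inverse b / sigma.
   Clearing denominators in an integral equation of b shows that m contains the image of
   some tau congruent to sigma^d modulo p; but such a tau is a unit. *)
Lemma maximal_over_prime (m : ideal Bp) a : maximal_ideal m -> p a ->
  m (to_loc (compl phi pP) (phi a)).
Proof.
move=> mm pa; apply: contrapT => nma.
have [y my] := maximal_inverse mm nma.
elim/frac_ind: y my => b s; have [sigma ps es] := set_mem (valP s) => my.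
pose T : {rmorphism B -> Bp} := @to_loc B (compl phi pP).
have {}my : m (1 - Defs.frac b s * T (phi a)) by [].
have Ts : T (phi sigma) * Defs.frac b s = T b.
  rewrite /T /= /to_loc fracM; apply: frac_eq.
  by rewrite denE denE /= mulr1 mul1r mulrC es.
pose q : {rmorphism B -> quotient_ring m} := quo m \o T.
have qa : q (b * phi a) = q (phi sigma).
  apply/quo_eqP; rewrite -opprB; apply: idealN.
  have -> : T (b * phi a) = T (phi sigma) * (Defs.frac b s * T (phi a)).
    by rewrite rmorphM -Ts mulrA.
  by rewrite -{1}[T (phi sigma)]mulr1 -mulrBr; apply: idealM.
have [d [c ec]] := phi_int b.
pose tau := sigma ^+ d + \sum_(i < d) c i * a ^+ (d - i) * sigma ^+ i.
have ptau : ~ p tau.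
  move=> ptau; apply: ps; apply: (@prime_idealX _ _ _ d pP).
  rewrite -(addrK (\sum_(i < d) c i * a ^+ (d - i) * sigma ^+ i) (sigma ^+ d)).
  apply: idealB => //; apply: (big_ind p) => [|x y|i _].
  - exact: ideal0.
  - exact: idealD.
  - rewrite -(subnSK (ltn_ord i)) exprS -!mulrA mulrCA [a * _]mulrC mulrA.
    exact: idealM.
have qtau : q (phi tau) = 0.
  transitivity (q (phi a) ^+ d * q (b ^+ d + \sum_(i < d) phi (c i) * b ^+ i)); last first.
    by rewrite ec rmorph0 mulr0.
  rewrite /tau !rmorphD !rmorph_sum mulrDr; congr (_ + _).
    by rewrite !rmorphXn -qa rmorphM exprMn mulrC.
  rewrite mulr_sumr; apply: eq_bigr => i _.
  rewrite !rmorphM !rmorphXn -qa rmorphM exprMn.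
  have -> : q (phi a) ^+ d = q (phi a) ^+ (d - i) * q (phi a) ^+ i.
    by rewrite -exprD subnK // ltnW.
  by ring.
have /quo_eqP : q (phi tau) = quo m 0 by rewrite qtau rmorph0.
by rewrite subr0; exact: base_notin_maximal.
Qed.

Lemma base_jacobson a : p a -> jacobson_radical (to_loc (compl phi pP) (phi a)).
Proof. by move=> pa m mm; exact: maximal_over_prime. Qed.

End Localization.

(** * Real points and the R-seminormalization *)

Section Variety.
Variables (R : realType) (n : nat) (X : real_variety R n).
Local Notation M := {mpoly R[n]}.
Local Notation A := (coord_ring X).
Local Notation B := (normal_ring X).
Local Notation C := (Rplus_ring X).
Implicit Types (x : real_points X) (F G : {poly M}).

Lemma eval_at_zmod x : zmod_morphism (@eval_at R n X x).
Proof.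
by move=> a b; rewrite -[a]quo_repr -[b]quo_repr -rmorphB !eval_at_quo mevalB.
Qed.

Lemma eval_at_monoid x : GRing.monoid_morphism (@eval_at R n X x).
Proof.
split=> [|a b]; first by rewrite -(rmorph1 (quo X)) eval_at_quo meval1.
by rewrite -[a]quo_repr -[b]quo_repr -rmorphM !eval_at_quo mevalM.
Qed.

HB.instance Definition _ x :=
  GRing.isZmodMorphism.Build A R (@eval_at R n X x) (eval_at_zmod x).
HB.instance Definition _ x :=
  GRing.isMonoidMorphism.Build A R (@eval_at R n X x) (eval_at_monoid x).

Definition point_ideal x : ideal A := preimage_ideal (@eval_at R n X x) (zero_ideal R).

Lemma point_idealE x a : point_ideal x a <-> eval_at x a = 0.
Proof. by rewrite /point_ideal preimage_idealE. Qed.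

Lemma point_ideal_prime x : prime_ideal (point_ideal x).
Proof.
split=> [|a b]; rewrite !point_idealE; first by rewrite rmorph1 => /eqP; rewrite oner_eq0.
by rewrite rmorphM => /eqP; rewrite mulf_eq0 => /orP[/eqP|/eqP]; [left|right].
Qed.

Lemma point_ideal_real x : real_ideal (point_ideal x).
Proof.
move=> k a; rewrite point_idealE rmorph_sum => /eqP.
rewrite psumr_eq0 => [/allP a0 i|i _]; last by rewrite rmorphXn sqr_ge0.
apply/point_idealE/eqP; have := a0 i (mem_index_enum i).
by rewrite /= rmorphXn sqrf_eq0.
Qed.

Lemma normal_integral (b : B) : integral (coord_to_normal X) b.
Proof.
have /asboolP[d [c e]] := valP b; exists d, c; apply: val_inj.
by rewrite rmorphD rmorph_sum rmorphXn -[RHS]e; congr (_ + _); apply: eq_bigr => i _;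
  rewrite rmorphM rmorphXn.
Qed.

Lemma to_fractions_inj : injective (to_fractions A).
Proof.
move=> a b /frac_eqP[u ru]; rewrite !denE !mulr1 => e.
by apply/eqP; rewrite -subr_eq0; apply/eqP/ru; rewrite mulrBr e subrr.
Qed.

Lemma coord_to_normal_inj : injective (coord_to_normal X).
Proof. by move=> a b /(congr1 val)/to_fractions_inj. Qed.

Local Notation Bx x := (localization (compl (coord_to_normal X) (point_ideal_prime x))).

Definition to_local x : {rmorphism B -> Bx x} :=
  @to_loc B (compl (coord_to_normal X) (point_ideal_prime x)).

Definition poly_coord : {rmorphism M -> B} := coord_to_normal X \o quo X.

Definition ceval x : {rmorphism M -> R[i]} := real_complex R \o meval (val x).

Lemma real_quadratic (z : R[i]) : z != 0 -> exists a b : R, b != 0 /\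
  z ^+ 2 + real_complex R a * z + real_complex R b = 0.
Proof.
case: z => a b z0; exists (- (a *+ 2)), (a ^+ 2 + b ^+ 2); split.
  apply: contraNneq z0 => /eqP; rewrite paddr_eq0 ?sqr_ge0 // !sqrf_eq0.
  by move=> /andP[/eqP -> /eqP ->]; rewrite eqxx.
by apply/eqP; rewrite eq_complex /= !(mul0r, mulr0, addr0, subr0); apply/andP; split;
  apply/eqP; ring.
Qed.

(** If z <> 0, the real polynomial k with roots z and its conjugate has a nonzero
   constant term, so that k(r) is a unit modulo the radical: k(r) w = s with s(x) <> 0.
   An integral equation of w, multiplied by k(r)^d, is a relation H(r) = 0, and H
   specializes at x and z to s(x)^d. *)
Lemma jacobson_only_zero x (r : B) (ev : {rmorphism {poly M} -> B}) (z : R[i]) :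
  jacobson_radical (to_local x r) ->
  (forall c, ev c%:P = poly_coord c) -> ev 'X = r ->
  (forall F, ev F = 0 -> (map_poly (ceval x) F).[z] = 0) -> z = 0.
Proof.
move=> jr evC evX evz; apply/eqP/negP => /negP z0.
have [a [b [b0 zab]]] := real_quadratic z0.
(* k vanishes at z and its constant coefficient b is nonzero *)
pose k : {poly M} := 'X ^+ 2 + a%:MP%:P * 'X + b%:MP%:P.
have kz : (map_poly (ceval x) k).[z] = 0.
  rewrite !rmorphD rmorphM rmorphXn /= map_polyX !map_polyC !hornerE /= !mevalC.
  exact: zab.
pose tl := to_local x; pose con c := tl (poly_coord c%:MP).
have conV : con b * con b^-1 = 1.
  by rewrite -!rmorphM divff // !rmorph1.
have ek : ev k = (ev 'X + poly_coord a%:MP) * r + poly_coord b%:MP.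
  by rewrite /k !rmorphD rmorphXn rmorphM !evC evX; ring.
have [|w] := jacobson_unit (r := tl (ev 'X + poly_coord a%:MP) * tl r) conV.
  exact: jacobsonM.
have -> : con b + tl (ev 'X + poly_coord a%:MP) * tl r = tl (ev k).
  by rewrite ek [RHS]rmorphD addrC [in RHS]rmorphM.
elim/frac_ind: w => b' s; rewrite fracM => /frac_eqP[u [s1 ps1 es1]].
have [s2 ps2 es2] := set_mem (valP s).
rewrite !denE /= !mulr1 mul1r -es1 -es2 => e.
pose s0 := s1 * s2; pose w := coord_to_normal X s1 * b'.
have kw : ev k * w = coord_to_normal X s0.
  by rewrite [RHS]rmorphM -e /w; ring.
have s0x : eval_at x s0 != 0.
  apply/eqP => /point_idealE; have [_ pM] := point_ideal_prime x.
  by move=> /pM[].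
have [d [c ec]] := normal_integral w.
pose H : {poly M} := (repr s0 ^+ d)%:P
  + \sum_(i < d) (repr (c i) * repr s0 ^+ i)%:P * k ^+ (d - i).
have pcE (y : A) : poly_coord (repr y) = coord_to_normal X y.
  by rewrite /poly_coord /= quo_repr.
have evH : ev H = 0.
  transitivity (ev k ^+ d * (w ^+ d + \sum_(i < d) coord_to_normal X (c i) * w ^+ i));
    last by rewrite ec mulr0.
  rewrite rmorphD rmorph_sum mulrDr; congr (_ + _).
    by rewrite evC rmorphXn pcE -kw exprMn.
  rewrite mulr_sumr; apply: eq_bigr => i _.
  rewrite rmorphM evC rmorphM !rmorphXn !pcE -kw exprMn.
  have -> : ev k ^+ d = ev k ^+ (d - i) * ev k ^+ i by rewrite -exprD subnK // ltnW.
  by ring.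
have := evz H evH; rewrite /H rmorphD rmorph_sum /= map_polyC hornerD hornerC /=.
rewrite horner_sum big1 ?addr0 => [|i _]; last first.
  rewrite rmorphM rmorphXn hornerM horner_exp kz expr0n subn_eq0 leqNgt ltn_ord.
  by rewrite mulr0.
move/eqP; rewrite rmorphXn /= rmorphXn /= expf_eq0 fmorph_eq0 andbC.
by move: s0x; rewrite /eval_at => /negPf ->.
Qed.

Definition value_at x (b : B) (t : R) : Prop :=
  jacobson_radical (to_local x (b - poly_coord t%:MP)).

Lemma value_at_coord x (a : A) : value_at x (coord_to_normal X a) (eval_at x a).
Proof.
rewrite /value_at; have -> : coord_to_normal X a - poly_coord (eval_at x a)%:MP
    = coord_to_normal X (a - quo X (eval_at x a)%:MP) by rewrite [RHS]rmorphB.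
apply: base_jacobson; first exact: normal_integral.
by apply/point_idealE; rewrite rmorphB /= eval_at_quo mevalC subrr.
Qed.

(** The difference of two distinct values would be a unit lying in the radical, so
   the local ring would be zero and some s with s(x) <> 0 would be zero in B. *)
Lemma value_at_uniq x b t t' : value_at x b t -> value_at x b t' -> t = t'.
Proof.
move=> vt vt'; apply: contrapT => /eqP; rewrite -subr_eq0 => tt'.
have unit : to_local x (poly_coord (t - t')%:MP) * to_local x (poly_coord (t - t')^-1%:MP) = 1.
  by rewrite -!rmorphM divff // !rmorph1.
have jac : jacobson_radical (- to_local x (poly_coord (t - t')%:MP)).
  have -> : - to_local x (poly_coord (t - t')%:MP)
      = to_local x (b - poly_coord t%:MP) + -1 * to_local x (b - poly_coord t'%:MP).
    by rewrite mulN1r -rmorphB -rmorphN; congr (to_local x _); rewrite !rmorphB /=; ring.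
  by apply: jacobsonD => //; apply: jacobsonM.
have [w] := jacobson_unit unit jac; rewrite subrr mulr0.
have -> : 0 = to_local x (coord_to_normal X 0) by rewrite !rmorph0.
rewrite -(rmorph1 (to_local x)) => /frac_eqP[u [s ps <-]].
rewrite !denE !mulr1 rmorph0 mulr0 -(rmorph0 (coord_to_normal X)).
move=> /coord_to_normal_inj s0; apply: ps; apply/point_idealE.
by rewrite -s0 rmorph0.
Qed.

Lemma value_atB x b b' t t' : value_at x b t -> value_at x b' t' -> value_at x (b - b') (t - t').
Proof.
move=> vt vt'; rewrite /value_at.
have -> : b - b' - poly_coord (t - t')%:MP
    = (b - poly_coord t%:MP) + -1 * (b' - poly_coord t'%:MP) by rewrite !rmorphB /=; ring.
by rewrite rmorphD rmorphM; apply: jacobsonD => //; apply: jacobsonM.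
Qed.

Lemma value_atM x b b' t t' : value_at x b t -> value_at x b' t' -> value_at x (b * b') (t * t').
Proof.
move=> vt vt'; rewrite /value_at.
have -> : b * b' - poly_coord (t * t')%:MP
    = b' * (b - poly_coord t%:MP) + poly_coord t%:MP * (b' - poly_coord t'%:MP).
  by rewrite !rmorphM /=; ring.
by rewrite rmorphD !rmorphM; apply: jacobsonD; apply: jacobsonM.
Qed.

(** An element of C is a / s up to the radical, and a / s - a(x) / s(x) is in the
   radical because a - (a(x) / s(x)) s vanishes at x. *)
Lemma value_at_exists x (c : C) : exists t, value_at x (val c) t.
Proof.
have /asboolP sn := valP c.
have [_ [r [[a [s [ps ->]]] jr e]]] := sn _ (point_ideal_prime x) (point_ideal_real (x := x)).
have sx : eval_at x s != 0 by apply/eqP => /point_idealE.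
exists (eval_at x a / eval_at x s); set t := _ / _.
rewrite /value_at rmorphB [to_local x (val c)]e.
have -> : Defs.frac (coord_to_normal X a) (compl_den (coord_to_normal X) (point_ideal_prime x) ps)
    = Defs.frac 1 (compl_den (coord_to_normal X) (point_ideal_prime x) ps)
      * to_local x (coord_to_normal X a).
  by rewrite fracM; apply: frac_eq; rewrite !denE /=; ring.
set i := Defs.frac 1 _.
have is1 : i * to_local x (coord_to_normal X s) = 1.
  by rewrite mulrC; exact: base_invertible.
have -> : i * to_local x (coord_to_normal X a) + r - to_local x (poly_coord t%:MP)
    = r + i * to_local x (coord_to_normal X (a - quo X t%:MP * s)).
  have -> : to_local x (coord_to_normal X (a - quo X t%:MP * s)) =
      to_local x (coord_to_normal X a)
      - to_local x (poly_coord t%:MP) * to_local x (coord_to_normal X s).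
    by rewrite -rmorphM -rmorphB; congr (to_local x _); rewrite rmorphB rmorphM.
  by rewrite mulrBr mulrCA is1; ring.
apply: jacobsonD => //; apply: jacobsonM; apply: base_jacobson.
  exact: normal_integral.
by apply/point_idealE; rewrite rmorphB rmorphM /= eval_at_quo mevalC divfK // subrr.
Qed.

Lemma Rplus_point_over x : exists2 u : Rplus_points X, Rplus_proj u = x &
  forall c, value_at x (val c) (sval u c).
Proof.
pose v (c : C) := projT1 (cid (value_at_exists x c)).
have vP c : value_at x (val c) (v c) by rewrite /v; case: cid.
have vB : zmod_morphism v.
  by move=> c d; apply: (value_at_uniq (vP _)); rewrite rmorphB; exact: value_atB (vP c) (vP d).
have vM : GRing.monoid_morphism v.
  split=> [|c d]; apply: (value_at_uniq (vP _)).
    have := @value_at_coord x 1; rewrite !rmorph1; exact.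
  by rewrite rmorphM; exact: value_atM (vP c) (vP d).
pose u0 : {rmorphism C -> R} := HB.pack v
  (GRing.isZmodMorphism.Build _ _ v vB) (GRing.isMonoidMorphism.Build _ _ v vM).
have u0C (a : A) : u0 (coord_to_Rplus X a) = eval_at x a.
  apply: (@value_at_uniq x (coord_to_normal X a)); last exact: value_at_coord.
  exact: (vP (coord_to_Rplus X a)).
have u0P c : u0 (coord_to_Rplus X (quo X c%:MP)) = c.
  by rewrite u0C eval_at_quo mevalC.
exists (exist _ u0 u0P); last exact: vP.
apply: val_inj; apply: funext => i; apply: etrans (u0C (quo X 'X_i)) _.
by rewrite eval_at_quo mevalXU.
Qed.

Definition poly_coord_Rplus : {rmorphism M -> C} := coord_to_Rplus X \o quo X.

Lemma Rplus_eval (u : Rplus_points X) (ev : {rmorphism {poly M} -> C}) F :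
  (forall c, ev c%:P = poly_coord_Rplus c) ->
  sval u (ev F) = (map_poly (meval (val (Rplus_proj u))) F).[sval u (ev 'X)].
Proof.
move=> evC; set h := meval _.
apply: (poly_morph_ext (u := sval u \o ev)
  (v := horner_morph (fun c => mulrC (sval u (ev 'X)) (h c)))) => [c|] /=.
  by rewrite evC [RHS]horner_morphC /h /= Rplus_proj_meval.
by rewrite [RHS]horner_morphX.
Qed.

Lemma ceval_real x F (t : R) :
  (map_poly (ceval x) F).[real_complex R t]
    = real_complex R (map_poly (meval (val x)) F).[t].
Proof. by rewrite -horner_map -map_poly_comp. Qed.

(** [jacobson_only_zero] applied to c - t, whose relations are those of c translated
   by t. *)
Lemma Rplus_fibre x (c : C) t (ev : {rmorphism {poly M} -> C}) (z : R[i]) :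
  (forall a, ev a%:P = poly_coord_Rplus a) -> ev 'X = c -> value_at x (val c) t ->
  (forall F, ev F = 0 -> (map_poly (ceval x) F).[z] = 0) -> z = real_complex R t.
Proof.
move=> evC evX vt evz; apply/eqP; rewrite -subr_eq0; apply/eqP.
have [ev' ev'C ev'X] := poly_eval_exists poly_coord (val c - poly_coord t%:MP).
apply: (jacobson_only_zero vt ev'C ev'X) => F F0.
pose F' := F \Po ('X - t%:MP%:P).
have -> : (map_poly (ceval x) F).[z - real_complex R t] = (map_poly (ceval x) F').[z].
  rewrite /F' map_comp_poly horner_comp rmorphB /= map_polyX map_polyC hornerXsubC /=.
  by rewrite mevalC.
apply: evz; apply: val_inj; apply: etrans F0.
apply: (poly_morph_ext (u := val \o ev \o comp_poly ('X - t%:MP%:P)) (v := ev')) => [a|] /=.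
  by rewrite comp_polyC evC ev'C.
rewrite comp_polyX ev'X.
have -> : ev ('X - t%:MP%:P) = c - poly_coord_Rplus t%:MP by rewrite rmorphB evX evC.
exact: (rmorphB (\val : {rmorphism C -> B})).
Qed.

End Variety.

(** * Functions on the real points *)

Section Functions.
Variables (R : realType) (n : nat) (X : real_variety R n) (f : real_points X -> R).
Local Notation M := {mpoly R[n]}.
Local Notation A := (coord_ring X).
Local Notation B := (normal_ring X).
Local Notation C := (Rplus_ring X).
Implicit Types (x : real_points X) (F G : {poly M}).

Definition vanishes_on_graph F : Prop :=
  forall x, (map_poly (meval (val x)) F).[f x] = 0.

Lemma muni_poly_to_mpoly F : muni (poly_to_mpoly F) = F.
Proof.
apply: (poly_morph_ext (u := @muni n R \o poly_to_mpoly) (v := idfun)) => [c|] /=.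
  rewrite poly_to_mpolyC.
  apply: (mpoly_morph_ext (u := @muni n R \o @mwiden n R) (v := polyC)) => [a|i] /=.
    by rewrite mwidenC muniC.
  by rewrite mwidenX mnmwiden1 muniXwiden.
by rewrite [poly_to_mpoly _]horner_morphX muniXlast.
Qed.

Lemma to_complex_pair m (w : 'I_m -> R) t :
  to_complex (pair_pt w t) = pair_pt (to_complex w) (real_complex R t).
Proof. by apply: funext => i; rewrite /to_complex /pair_pt; case: unlift. Qed.

Lemma ceval_muni x (P : {mpoly R[n.+1]}) (z : R[i]) :
  (map_mpoly (real_complex R) P).@[pair_pt (to_complex (val x)) z]
    = (map_poly (ceval x) (muni P)).[z].
Proof.
apply: (mpoly_morph_ext
  (u := meval (pair_pt (to_complex (val x)) z) \o map_mpoly (real_complex R))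
  (v := horner_morph (fun c => mulrC z (ceval x c)) \o @muni n R)) => [c|].
  by rewrite /= map_mpolyC muniC [RHS]horner_morphC /= !mevalC.
apply: ord_lastP => [|i] /=.
  by rewrite map_mpolyX mevalXU pair_pt_last muniXlast [RHS]horner_morphX.
by rewrite map_mpolyX mevalXU pair_pt_widen muniXwiden [RHS]horner_morphC /= mevalXU.
Qed.

Lemma meval_to_complex m (P : {mpoly R[m]}) (w : 'I_m -> R) :
  (map_mpoly (real_complex R) P).@[to_complex w] = real_complex R P.@[w].
Proof.
apply: (mpoly_morph_ext (u := meval (to_complex w) \o map_mpoly (real_complex R))
  (v := real_complex R \o meval w)) => [c|i] /=.
  by rewrite map_mpolyC !mevalC.
by rewrite map_mpolyX !mevalXU.
Qed.

Lemma real_imaginary_parts m (P : {mpoly R[i][m]}) : exists P1 P2 : {mpoly R[m]},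
  P = map_mpoly (real_complex R) P1 + ('i%C : R[i]) *: map_mpoly (real_complex R) P2.
Proof.
exists (\sum_(k <- msupp P) complex.Re (P@_k) *: 'X_[k]),
  (\sum_(k <- msupp P) complex.Im (P@_k) *: 'X_[k]).
rewrite [LHS]mpolyE !(raddf_sum (map_mpoly (real_complex R))) scaler_sumr.
rewrite -big_split; apply: eq_bigr => k _ /=.
rewrite -![complex.Re _ *: _]mul_mpolyC -![complex.Im _ *: _]mul_mpolyC !rmorphM /=.
rewrite !map_mpolyC !map_mpolyX !mul_mpolyC scalerA -scalerDl; congr (_ *: _).
case: (P@_k) => a b; apply/eqP.
by rewrite eq_complex /= !(mul0r, mul1r, subr0, addr0, add0r) !eqxx.
Qed.

Lemma real_imaginary_vanish m (P1 P2 : {mpoly R[m]}) (w : 'I_m -> R) :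
  (map_mpoly (real_complex R) P1
     + ('i%C : R[i]) *: map_mpoly (real_complex R) P2).@[to_complex w] = 0 ->
  P1.@[w] = 0 /\ P2.@[w] = 0.
Proof.
rewrite mevalD mevalZ => /(etrans (congr2 (fun a b : R[i] => a + 'i%C * b)
  (esym (meval_to_complex P1 w)) (esym (meval_to_complex P2 w)))) /eqP.
by rewrite eq_complex /= !(mul0r, mul1r, subr0, addr0, add0r) => /andP[/eqP -> /eqP ->].
Qed.

(** A complex polynomial vanishes at a real point if and only if its real and
   imaginary parts do, so the real equations of the graph define its complex closure. *)
Lemma closure_fibreP x (z : R[i]) :
  (forall F, vanishes_on_graph F -> (map_poly (ceval x) F).[z] = 0) ->
  complex_graph_closure f (pair_pt (to_complex (val x)) z).
Proof.
move=> vz; have xC : times_line (@complex_points R n X) (pair_pt (to_complex (val x)) z).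
  exists (to_complex (val x)); last by exists z.
  by move=> p Xp; rewrite meval_to_complex (set_mem (valP x)) // rmorph0.
split=> // _ [E ->] sub; split=> // P EP.
have [P1 [P2 eP]] := real_imaginary_parts P.
have vP y : P1.@[pair_pt (val y) (f y)] = 0 /\ P2.@[pair_pt (val y) (f y)] = 0.
  apply: real_imaginary_vanish; rewrite -eP.
  have [|_ /(_ P EP)] := sub (to_complex (pair_pt (val y) (f y))); last by [].
  by exists (pair_pt (val y) (f y)) => //; exists y.
have zP Q : (forall y, Q.@[pair_pt (val y) (f y)] = 0) ->
    (map_mpoly (real_complex R) Q).@[pair_pt (to_complex (val x)) z] = 0.
  by move=> vQ; rewrite ceval_muni; apply: vz => y; rewrite -meval_muni.
rewrite eP; move: (zP P1 (fun y => (vP y).1)) (zP P2 (fun y => (vP y).2)).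
set v := pair_pt _ _ => e1 e2; rewrite mevalD mevalZ.
by apply: etrans (congr2 (fun a b => a + 'i%C * b) e1 e2) _; rewrite mulr0 addr0.
Qed.

Lemma Rplus_point_eval (u : Rplus_points X) (a : A) :
  sval u (coord_to_Rplus X a) = eval_at (Rplus_proj u) a.
Proof. by rewrite -[a]quo_repr eval_at_quo Rplus_proj_meval. Qed.

Section Necessary.
Variable g : C.
Hypothesis fg : forall u : Rplus_points X, f (Rplus_proj u) = sval u g.

Lemma Rplus_rational : rational_fun f.
Proof.
have [p [q [rq gE]]] : exists p q : A, regular_set q /\
    coord_to_Rplus X q * g = coord_to_Rplus X p.
  have [p [q gE]] : exists p q, val (val g) = Defs.frac p q :> total_fractions A.
    by elim/frac_ind: (val (val g) : localization (regular A)) => p q; exists p, q.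
  exists p, (val q); split; first exact: (set_mem (valP q)).
  apply: val_inj; apply: val_inj; rewrite rmorphM.
  apply: etrans (congr2 *%R (erefl (to_fractions A (val q))) gE) _.
  apply: etrans (fracM _ _ _ _) _; apply: frac_eq; rewrite !denE; ring.
exists p, q; split=> // x qx; have [u ux _] := Rplus_point_over x.
rewrite -ux fg ux; apply/(canRL (mulfK qx)).
by rewrite -[x]ux -!Rplus_point_eval -gE rmorphM mulrC.
Qed.

Lemma Rplus_integral : integral_fun f.
Proof.
have [d [c e]] := normal_integral (val g); exists d, c => x.
have [u ux _] := Rplus_point_over x.
have eC : g ^+ d + \sum_(i < d) coord_to_Rplus X (c i) * g ^+ i = 0.
  apply: val_inj; apply: etrans e; rewrite rmorphD rmorphXn rmorph_sum; congr (_ + _).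
  by apply: eq_bigr => i _; rewrite rmorphM rmorphXn.
apply: etrans (rmorph0 (sval u)); rewrite -eC rmorphD rmorphXn rmorph_sum -ux fg.
congr (_ + _).
by apply: eq_bigr => i _; rewrite rmorphM rmorphXn Rplus_point_eval.
Qed.

(** E consists of the relations of g over the polynomial ring; by [Rplus_fibre] they
   determine the value of g over x. *)
Lemma Rplus_graph_equations : exists E : set {poly M}, (forall F, E F -> vanishes_on_graph F) /\
  forall x (z : R[i]), (forall F, E F -> (map_poly (ceval x) F).[z] = 0) ->
    z = real_complex R (f x).
Proof.
have [ev evC evX] := poly_eval_exists (poly_coord_Rplus X) g.
exists [set F | ev F = 0]; split=> [F F0 x|x z vz]; have [u ux vu] := Rplus_point_over x.
  by rewrite -[x]ux fg -evX -(Rplus_eval u F evC) F0 rmorph0.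
by rewrite -ux fg; apply: (Rplus_fibre evC evX (vu g)).
Qed.

End Necessary.

Section Equations.
Variable E : set {poly M}.
Hypothesis Ev : forall F, E F -> vanishes_on_graph F.
Hypothesis Ez : forall x (z : R[i]),
  (forall F, E F -> (map_poly (ceval x) F).[z] = 0) -> z = real_complex R (f x).

Lemma graph_closed_of_equations :
  zariski_closed_in (times_line (@real_points R n X)) (graph f).
Proof.
exists [set P | E (muni P)]; apply/seteqP; split.
  move=> _ [x _ <-]; split; first by exists (val x); [exact: (set_mem (valP x))|exists (f x)].
  by move=> P EP; rewrite meval_muni; apply: Ev.
move=> _ [[w Xw [t ->]] vt]; pose x : real_points X := exist _ w (mem_set Xw).
exists x => //; congr (pair_pt _ _); apply: (@complexI R); apply/esym/Ez => F EF.
rewrite ceval_real -[F]muni_poly_to_mpoly -meval_muni vt ?rmorph0 //=.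
by rewrite muni_poly_to_mpoly.
Qed.

Lemma complex_fibre_of_equations x :
  complex_graph_closure f `&` times_line [set to_complex (val x)]
    = [set to_complex (pair_pt (val x) (f x))].
Proof.
apply/seteqP; split=> [w [[_ cl] [v ev [z ew]]]|_ ->].
  rewrite {}ew {}ev in cl *; rewrite to_complex_pair /=; congr (pair_pt _ _); apply: Ez => F EF.
  pose E' := [set map_mpoly (real_complex R) P | P in [set P | E (muni P)]].
  have [||_ vE] := cl (times_line (@complex_points R n X) `&` zeros E').
  - by exists E'.
  - move=> _ [_ [y _ <-] <-]; rewrite to_complex_pair; split.
      exists (to_complex (val y)); last by exists (real_complex R (f y)).
      by move=> p Xp; rewrite meval_to_complex (set_mem (valP y)) // rmorph0.
    move=> _ [P EP <-]; rewrite ceval_muni ceval_real (Ev EP) ?rmorph0 //.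
  have EF' : E' (map_mpoly (real_complex R) (poly_to_mpoly F)).
    by exists (poly_to_mpoly F) => //=; rewrite muni_poly_to_mpoly.
  by rewrite -[F]muni_poly_to_mpoly -ceval_muni; exact: (vE _ EF').
split; rewrite to_complex_pair.
  by apply: closure_fibreP => F vF; rewrite ceval_real vF rmorph0.
by exists (to_complex (val x)) => //; exists (real_complex R (f x)).
Qed.

End Equations.

(** * From the graph to the R-seminormalization *)

Lemma coord_nullstellensatz (a : A) : (forall x, eval_at x a = 0) -> a = 0.
Proof.
move=> a0; rewrite -[a]quo_repr -(rmorph0 (quo X)); apply/quo_eqP; rewrite subr0.
apply: real_nullstellensatz => [|w Xw]; first exact: variety_real.
exact: (a0 (exist _ w (mem_set Xw))).
Qed.

Lemma prime_nullstellensatz (p : ideal A) (a : A) : real_ideal p ->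
  (forall x, (forall b, p b -> eval_at x b = 0) -> eval_at x a = 0) -> p a.
Proof.
move=> rp pa; rewrite -[a]quo_repr -(preimage_idealE (quo X)).
apply: real_nullstellensatz => [k b|w pw].
  rewrite preimage_idealE rmorph_sum => pb i; rewrite preimage_idealE.
  apply: (rp k (fun i => quo X (b i))); move: pb.
  by under eq_bigr => j _ do rewrite rmorphXn.
have Xw : real_points X w.
  move=> b Xb; apply: pw; rewrite preimage_idealE.
  have b0 : quo X b = 0 by rewrite -(rmorph0 (quo X)); apply/quo_eqP; rewrite subr0.
  by have := ideal0 p; rewrite -b0.
apply: (pa (exist _ w (mem_set Xw))) => b pb; apply: (pw (repr b)).
by rewrite preimage_idealE; have : p (quo X (repr b)) by rewrite quo_repr.
Qed.

(** Clearing denominators, the vanishing of q^D F(p / q) is tested at the real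
   points: where q vanishes it is multiplied by q, elsewhere F(p / q) = F(f) = 0. *)
Lemma fraction_root_of_vanishing (p q : A) (g : total_fractions A)
    (ev : {rmorphism {poly M} -> total_fractions A}) F :
  regular_set q -> (forall x, eval_at x q != 0 -> f x = eval_at x p / eval_at x q) ->
  to_fractions A q * g = to_fractions A p ->
  (forall c, ev c%:P = to_fractions A (quo X c)) -> ev 'X = g ->
  vanishes_on_graph F -> ev F = 0.
Proof.
move=> rq fpq qg evC evX vF; pose D := size F.
pose a : A := \sum_(i < D) quo X F`_i * p ^+ i * q ^+ (D - i).
have ea : ev F * to_fractions A q ^+ D = to_fractions A a.
  rewrite -[in LHS](coefK F) poly_def !rmorph_sum mulr_suml; apply: eq_bigr => i _.
  rewrite -mul_polyC !rmorphM !rmorphXn evC evX -qg exprMn.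
  have -> : to_fractions A q ^+ D = to_fractions A q ^+ (D - i) * to_fractions A q ^+ i.
    by rewrite -exprD subnK // ltnW.
  ring.
have a0 : a = 0.
  apply: rq; apply: coord_nullstellensatz => x; rewrite rmorphM /=.
  have [->|qx] := eqVneq (eval_at x q) 0; first by rewrite mul0r.
  suff -> : eval_at x a = eval_at x q ^+ D * (map_poly (meval (val x)) F).[f x].
    by rewrite vF !mulr0.
  rewrite /map_poly horner_poly mulr_sumr rmorph_sum; apply: eq_bigr => i _.
  rewrite !rmorphM !rmorphXn /= eval_at_quo fpq //.
  have -> : eval_at x q ^+ D = eval_at x q ^+ (D - i) * eval_at x q ^+ i.
    by rewrite -exprD subnK // ltnW.
  by rewrite expr_div_n; field; rewrite expf_neq0.
pose qd : set_type (mul_set_set (regular A)) := exist _ q (mem_set rq).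
have qinv : to_fractions A q * Defs.frac 1 qd = 1.
  by apply: etrans (fracM _ _ _ _) _; apply: frac_eq; rewrite !denE /=; ring.
rewrite -[ev F]mulr1 -(expr1n _ D) -[X in X ^+ D]qinv exprMn mulrA ea a0 rmorph0.
by rewrite mul0r.
Qed.

Lemma single_root_poly (P : {poly R}) c : P != 0 ->
  (forall z : R[i], root (map_poly (real_complex R) P) z -> z = real_complex R c) ->
  P = lead_coef P *: ('X - c%:P) ^+ (size P).-1.
Proof.
move=> P0 Pz; have [r er] := closed_field_poly_normal (map_poly (real_complex R) P).
have lc0 : lead_coef (map_poly (real_complex R) P) != 0.
  by rewrite lead_coef_eq0 map_poly_eq0.
have rc : r = nseq (size r) (real_complex R c).
  apply/all_pred1P/allP => z zr; apply/eqP/Pz; rewrite er rootZ //.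
  by rewrite root_prod_XsubC.
have sr : size P = (size r).+1.
  by rewrite -(size_map_poly (real_complex R)) er size_scale // size_prod_XsubC.
apply: (@map_poly_inj _ _ (real_complex R)).
rewrite {1}er map_polyZ lead_coef_map rmorphXn /= map_polyXsubC; congr (_ *: _).
by rewrite rc big_nseq iter_mulr_1 sr.
Qed.

Section Seminormal.
Variables (g : B) (ev : {rmorphism {poly M} -> B}).
Hypothesis evC : forall c, ev c%:P = poly_coord X c.
Hypothesis evX : ev 'X = g.
Hypothesis ev_vanish : forall F, vanishes_on_graph F -> ev F = 0.
Hypothesis monic_vanish : exists F i, vanishes_on_graph F /\ F`_i = 1.
Hypothesis fibre : forall x (z : R[i]),
  (forall F, vanishes_on_graph F -> (map_poly (ceval x) F).[z] = 0) ->
  z = real_complex R (f x).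

Variables (p : ideal A) (pP : prime_ideal p) (pR : real_ideal p).

Definition coefs_in F := forall i, p (quo X F`_i).
(** Relations are taken modulo p so that a leading coefficient that lies in p can be
   dropped. *)
Definition vanishes_mod F := exists2 G, vanishes_on_graph G & coefs_in (F - G).
Definition zero_of x := forall b, p b -> eval_at x b = 0.

Lemma coefs_inD F G : coefs_in F -> coefs_in G -> coefs_in (F + G).
Proof. by move=> pF pG i; rewrite coefD rmorphD; exact: idealD (pF i) (pG i). Qed.

Lemma coefs_inN F : coefs_in F -> coefs_in (- F).
Proof. by move=> pF i; rewrite coefN rmorphN; exact: idealN (pF i). Qed.

Lemma coefs_inM Q F : coefs_in F -> coefs_in (Q * F).
Proof.
move=> pF i; rewrite coefM rmorph_sum; apply: (big_ind p) => [|a b|j _].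
- exact: ideal0.
- exact: idealD.
- by rewrite rmorphM; exact: idealM (pF _).
Qed.

Lemma map_coefs_in x F : zero_of x -> coefs_in F -> map_poly (meval (val x)) F = 0.
Proof.
move=> xp pF; apply/polyP => i; rewrite coef_map coef0 /=.
by rewrite -eval_at_quo; exact: xp (pF i).
Qed.

Lemma vanishes_mod_at x F : zero_of x -> vanishes_mod F ->
  (map_poly (meval (val x)) F).[f x] = 0.
Proof.
move=> xp [G vG pFG]; rewrite -(subrK G F) rmorphD /= map_coefs_in // add0r.
exact: vG.
Qed.

Lemma map_ceval x F : map_poly (ceval x) F = map_poly (real_complex R) (map_poly (meval (val x)) F).
Proof. exact: map_poly_comp. Qed.

(** F has minimal degree among the polynomials that are relations of f modulo p
   and nonzero modulo p; so the pseudo-remainder of any relation by F is zero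
   modulo p. *)
Lemma minimal_equation : exists F, [/\ vanishes_mod F, ~ p (quo X (lead_coef F)) &
  forall G, vanishes_on_graph G -> exists k Q,
    coefs_in (lead_coef F ^+ k *: G - Q * F)].
Proof.
pose good k := `[< exists2 F : {poly M}, size F = k & vanishes_mod F /\ ~ coefs_in F >].
have exg : exists k, good k.
  have [F [i [vF Fi]]] := monic_vanish; exists (size F); apply/asboolP; exists F => //.
  split; first by exists F => // j; rewrite subrr coef0 rmorph0; exact: ideal0.
  by move=> /(_ i); rewrite Fi rmorph1; exact: pP.1.
case: (ex_minnP exg) => m /asboolP[F szF [vF nF]] minm.
have small G : vanishes_mod G -> (size G < m)%N -> coefs_in G.
  move=> vG; rewrite ltnNge => /negP lt; apply: contrapT => nG; apply: lt.
  by apply: minm; apply/asboolP; exists G.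
have F0 : F != 0.
  by apply: contra_notN nF => /eqP -> i; rewrite coef0 rmorph0; exact: ideal0.
exists F; split=> // [plc|G vG].
  (* dropping a leading coefficient that is in p would contradict minimality *)
  pose F' := \poly_(i < (size F).-1) F`_i.
  have dF : coefs_in (F - F').
    move=> i; rewrite coefB coef_poly; case: ltnP => [_|].
      by rewrite subrr rmorph0; exact: ideal0.
    rewrite subr0 leq_eqVlt => /orP[/eqP <- //|lt].
    rewrite nth_default ?rmorph0; first exact: ideal0.
    by move: lt; case: (size F).
  apply: nF; rewrite -(subrK F' F); apply: coefs_inD => //; apply: small.
    have [G vG pFG] := vF; exists G => //.
    have -> : F' - G = (F - G) + - (F - F') by ring.
    by apply: coefs_inD => //; exact: coefs_inN.
  rewrite -szF (leq_ltn_trans (size_poly _ _)) // prednK ?size_poly_gt0 //.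
have := Pdiv.Idomain.divp_eq G F; set k := scalp _ _; set Q := _ %/ _; set r := _ %% _ => e.
exists k, Q; have -> : lead_coef F ^+ k *: G - Q * F = r by rewrite e; ring.
apply: small; last by rewrite -szF ltn_modp.
have [H vH pFH] := vF; exists (lead_coef F ^+ k *: G - Q * H).
  by move=> x; rewrite rmorphB rmorphM /= map_polyZ /= !hornerE vG vH !mulr0 subr0.
have -> : r - (lead_coef F ^+ k *: G - Q * H) = (- Q) * (F - H) by rewrite e; ring.
exact: coefs_inM.
Qed.

(** At the real zeros of p where the leading coefficient s does not vanish, F is
   s (T - f)^e and its coefficient of degree e - 1 is - e s f.  Eliminating f gives an
   identity between coefficients at these points, hence modulo p by the real
   Nullstellensatz. *)
Lemma power_equation F : vanishes_mod F -> ~ p (quo X (lead_coef F)) ->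
  (forall G, vanishes_on_graph G -> exists k Q,
    coefs_in (lead_coef F ^+ k *: G - Q * F)) ->
  (1 < size F)%N /\ (let e := (size F).-1 in let s := lead_coef F in
    coefs_in ((s *+ e) ^+ e *: F - s *: ((s *+ e) *: 'X + (F`_e.-1)%:P) ^+ e)).
Proof.
move=> vF ps divF; set s := lead_coef F; set e := (size F).-1.
have Fx x : zero_of x -> s.@[val x] != 0 ->
    map_poly (meval (val x)) F = s.@[val x] *: ('X - (f x)%:P) ^+ e.
  move=> xp sx; have szFx : size (map_poly (meval (val x)) F) = size F.
    exact: size_map_poly_id0.
  have lcFx : lead_coef (map_poly (meval (val x)) F) = s.@[val x].
    exact: lead_coef_map_id0 (rmorph0 _) sx.
  rewrite -lcFx /e -szFx; apply: single_root_poly.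
    by rewrite -lead_coef_eq0 lcFx.
  move=> z /rootP Fz; apply: fibre => G vG.
  have [k [Q /(map_coefs_in xp) /eqP]] := divF G vG.
  rewrite rmorphB rmorphM /= map_polyZ /= rmorphXn subr_eq0 => /eqP e1.
  have : (map_poly (real_complex R) (s.@[val x] ^+ k *: map_poly (meval (val x)) G)).[z] = 0.
    by rewrite e1 rmorphM hornerM Fz mulr0.
  rewrite map_polyZ hornerZ -map_ceval => /eqP.
  by rewrite mulf_eq0 fmorph_eq0 expf_eq0 (negPf sx) andbF => /eqP.
(* a constant F would vanish at all the real zeros of p, and so would s *)
have sF : (1 < size F)%N.
  rewrite ltnNge; apply/negP => sF; apply: ps; apply: prime_nullstellensatz => // x xp.
  rewrite eval_at_quo; apply/eqP; apply: contraT => sx.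
  have := vanishes_mod_at xp vF; rewrite Fx // /e.
  have -> : (size F).-1 = 0%N by move: sF; case: (size F) => [|[]].
  by rewrite expr0 hornerZ hornerC mulr1 => /eqP; rewrite (negPf sx).
split=> //; cbv zeta; set D := (_ - _); move=> i.
have [_ pM] := pP; suff /pM[/ps[]|//] : p (quo X s * quo X D`_i).
apply: prime_nullstellensatz => // x xp; rewrite rmorphM /= !eval_at_quo.
have [->|sx] := eqVneq s.@[val x] 0; first by rewrite mul0r.
suff D0 : map_poly (meval (val x)) D = 0.
  by rewrite -[(D`_i).@[_]](coef_map (meval (val x))) D0 coef0 mulr0.
have Fe : (F`_e.-1).@[val x] = - (s.@[val x] * f x) *+ e.
  have e0 : e != 0%N by rewrite /e; case: (size F) sF => [|[]].
  rewrite -[LHS](coef_map (meval (val x))) Fx // coefZ.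
  have := @coefPn_prod_XsubC R (nseq e (f x)); rewrite size_nseq big_nseq iter_mulr_1.
  move=> -> //; rewrite big_nseq iter_addr_0; ring.
rewrite /D rmorphB /= !map_polyZ /= !rmorphXn /= rmorphD /= map_polyZ /= map_polyX map_polyC /=.
rewrite Fe Fx // !rmorphMn /=.
have shift (a b : R) : (a *+ e) *: 'X + (- (a * b))%:P *+ e = (a *+ e) *: ('X - b%:P).
  by rewrite scalerBr -[(a *+ e) *: b%:P]mul_polyC -polyCM -rmorphMn mulrnAl -polyCN mulNrn.
by rewrite shift exprZn !scalerA mulrC subrr.
Qed.

Lemma ev_coefs_in F (m : ideal (localization (compl (coord_to_normal X) pP))) :
  maximal_ideal m -> coefs_in F -> m (to_loc (compl (coord_to_normal X) pP) (ev F)).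
Proof.
move=> mm pF; rewrite -(coefK F) poly_def !rmorph_sum /=.
apply: (big_ind m) => [|a b|i _]; [exact: ideal0|exact: idealD|].
rewrite -mul_polyC mulrC !rmorphM /=; apply: idealM; rewrite evC.
exact: (maximal_over_prime (@normal_integral _ _ X) mm (pF i)).
Qed.

(** By [power_equation], e s g + F_(e-1) has its e-th power in every maximal ideal
   of the local ring, and e s is a unit there. *)
Lemma graph_seminormal_at : exists x r : localization (compl (coord_to_normal X) pP),
  [/\ loc_base x, jacobson_radical r &
    to_loc (compl (coord_to_normal X) pP) g = x + r].
Proof.
have [F [vF ps divF]] := minimal_equation.
have [sF pD] := power_equation vF ps divF.
set e := (size F).-1 in pD; set s := lead_coef F in ps pD.
have e0 : (e%:R : R) != 0.
  by rewrite pnatr_eq0 /e; case: (size F) sF => [|[]].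
have pse : ~ p (quo X (s *+ e)).
  rewrite -mulr_natr rmorphM => /pP.2[//|pe]; apply: pP.1.
  have -> : 1 = quo X (e%:R^-1)%:MP * quo X e%:R.
    by rewrite -rmorphM -mpolyC_nat -mpolyCM mulVf // !rmorph1.
  exact: idealM.
pose T : {rmorphism B -> _} := @to_loc B (compl (coord_to_normal X) pP).
pose l : A := quo X F`_e.-1.
pose L : B := coord_to_normal X (quo X (s *+ e)) * g + coord_to_normal X l.
have mL (m : ideal (localization (compl (coord_to_normal X) pP))) : maximal_ideal m -> m (T L).
  move=> mm; have mP := maximal_prime mm.
  have mF : m (T (ev F)).
    have [G vG pFG] := vF; rewrite -(subrK G F) rmorphD (ev_vanish vG) addr0.
    exact: ev_coefs_in.
  pose Q := (s *+ e) *: 'X + (F`_e.-1)%:P.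
  have eQ : ev Q = L by rewrite /Q -mul_polyC rmorphD rmorphM !evC evX.
  have eD : ev ((s *+ e) ^+ e *: F - s *: Q ^+ e)
      = poly_coord X ((s *+ e) ^+ e) * ev F - poly_coord X s * L ^+ e.
    rewrite rmorphB -[_ *: F]mul_polyC -[s *: _]mul_polyC.
    by rewrite !(rmorphM ev) (rmorphXn ev) !evC eQ.
  have : m (T (poly_coord X s) * T L ^+ e).
    have -> : T (poly_coord X s) * T L ^+ e = T (poly_coord X ((s *+ e) ^+ e)) * T (ev F)
        - T (ev ((s *+ e) ^+ e *: F - s *: Q ^+ e)).
      by rewrite eD rmorphB !(rmorphM T) (rmorphXn T); ring.
    by apply: idealB; [exact: idealM|exact: ev_coefs_in].
  have [_ mM] := mP; move=> /mM[ms|/(prime_idealX mP) //].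
  by case: (base_notin_maximal mm ps ms).
pose inv := Defs.frac 1 (compl_den (coord_to_normal X) pP pse).
have invE : inv * T (coord_to_normal X (quo X (s *+ e))) = 1.
  by rewrite mulrC; exact: base_invertible.
exists (inv * T (coord_to_normal X (- l))), (inv * T L); split.
- exists (- l), (quo X (s *+ e)), pse.
  by apply: etrans (fracM _ _ _ _) _; apply: frac_eq; rewrite !denE /=; ring.
- by move=> m mm; apply/idealM/mL.
- rewrite /L (rmorphD T) (rmorphM T) mulrDr mulrA invE mul1r rmorphN (rmorphN T).
  by rewrite mulrN [RHS]addrC addrK.
Qed.

End Seminormal.

Lemma pair_pt_inj (K : Type) m (v w : 'I_m -> K) (s t : K) :
  pair_pt v s = pair_pt w t -> v = w /\ s = t.
Proof.
move=> e; split; last by have := congr1 (@^~ ord_max) e; rewrite /pair_pt unlift_none.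
apply: funext => i; have := congr1 (@^~ (lift ord_max i)) e.
by rewrite /pair_pt liftK.
Qed.

Lemma integral_equation : integral_fun f -> exists F d, [/\ vanishes_on_graph F, F`_d = 1 &
  forall (T : comPzRingType) (h : {rmorphism {poly M} -> T}), exists c : 'I_d -> M,
    h F = h 'X ^+ d + \sum_(i < d) h (c i)%:P * h 'X ^+ i].
Proof.
move=> [d [c ec]]; exists ('X^d + \sum_(i < d) (repr (c i))%:P * 'X^i), d; split.
- move=> x; rewrite -[RHS](ec x) rmorphD rmorph_sum /= map_polyXn hornerD hornerXn.
  rewrite horner_sum; congr (_ + _); apply: eq_bigr => i _.
  by rewrite rmorphM /= map_polyC map_polyXn hornerM hornerC hornerXn.
- rewrite coefD coefXn eqxx coef_sum big1 ?addr0 // => i _.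
  by rewrite coefCM coefXn gtn_eqF ?mulr0.
- move=> T h; exists (fun i => repr (c i)); rewrite rmorphD rmorph_sum rmorphXn.
  by congr (_ + _); apply: eq_bigr => i _; rewrite rmorphM rmorphXn.
Qed.

(** The equation g(u) = f holds at every real point u of X^{R+} because the
   relations of f are satisfied by g and the graph of f is closed. *)
Lemma in_K_Rplus_of_graph : rational_fun f -> integral_fun f ->
  zariski_closed_in (times_line (@real_points R n X)) (graph f) ->
  (forall x, complex_graph_closure f `&` times_line [set to_complex (val x)]
    = [set to_complex (pair_pt (val x) (f x))]) ->
  in_K_Rplus f.
Proof.
move=> [p [q [rq fpq]]] /integral_equation[F0 [d [vF0 F0d F0E]]] [E graphE] fibres.
have fibre x (z : R[i]) :
    (forall F, vanishes_on_graph F -> (map_poly (ceval x) F).[z] = 0) ->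
    z = real_complex R (f x).
  move=> /closure_fibreP cl.
  have : [set to_complex (pair_pt (val x) (f x))] (pair_pt (to_complex (val x)) z).
    by rewrite -fibres; split=> //; exists (to_complex (val x)) => //; exists z.
  by rewrite /= to_complex_pair => e; exact: (pair_pt_inj e).2.
pose qd : set_type (mul_set_set (regular A)) := exist _ q (mem_set rq).
pose g0 : total_fractions A := Defs.frac p qd.
have qg0 : to_fractions A q * g0 = to_fractions A p.
  by apply: etrans (fracM _ _ _ _) _; apply: frac_eq; rewrite !denE /=; ring.
have [ev0 ev0C ev0X] := poly_eval_exists (to_fractions A \o quo X : {rmorphism M -> _}) g0.
have ev0_vanish F : vanishes_on_graph F -> ev0 F = 0.
  exact: (fraction_root_of_vanishing rq fpq qg0 ev0C ev0X).
have g0_int : integral (to_fractions A) g0.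
  have [c e] := F0E _ ev0; exists d, (fun i => quo X (c i)).
  apply: etrans (ev0_vanish F0 vF0); rewrite e ev0X; congr (_ + _).
  by apply: eq_bigr => i _; rewrite ev0C.
pose g : B := exist _ g0 (asboolT g0_int).
have [ev evC evX] := poly_eval_exists (poly_coord X) g.
have ev_vanish F : vanishes_on_graph F -> ev F = 0.
  move=> vF; apply: val_inj; apply: etrans (ev0_vanish F vF).
  apply: (poly_morph_ext (u := \val \o ev) (v := ev0)) => [c|].
    by rewrite ev0C /= evC.
  by rewrite ev0X /= evX.
have g_semi : R_seminormal (coord_to_normal X) g.
  move=> P pP rP; apply: (graph_seminormal_at evC evX ev_vanish _ fibre pP rP).
  by exists F0, d.
pose gC : C := exist _ g (asboolT g_semi).
have [evR evRC evRX] := poly_eval_exists (poly_coord_Rplus X) gC.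
have evR_vanish F : vanishes_on_graph F -> evR F = 0.
  move=> vF; apply: val_inj; apply: etrans (ev_vanish F vF).
  apply: (poly_morph_ext (u := \val \o evR) (v := ev)) => [c|].
    by rewrite evC /= evRC.
  by rewrite evX /= evRX.
exists gC => u; set x := Rplus_proj u.
have : graph f (pair_pt (val x) (sval u gC)).
  rewrite graphE; split.
    by exists (val x); [exact: (set_mem (valP x))|exists (sval u gC)].
  move=> P EP; rewrite meval_muni -[in X in _.[X]]evRX -(Rplus_eval u _ evRC).
  rewrite evR_vanish ?rmorph0 // => y; rewrite -meval_muni.
  have : graph f (pair_pt (val y) (f y)) by exists y.
  by rewrite graphE => -[_ /(_ P EP)].
by move=> [y _ e]; have [/val_inj <- <-] := pair_pt_inj e.
Qed.

End Functions.

Theorem theorem3p11 (R : realType) (n : nat) (X : real_variety R n)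
    (f : real_points X -> R) :
  in_K_Rplus f <->
  [/\ rational_fun f,
      integral_fun f,
      zariski_closed_in (times_line (real_points X)) (graph f) &
      forall x : real_points X,
        complex_graph_closure f `&` times_line [set to_complex (val x)]
        = [set to_complex (pair_pt (val x) (f x))] ].
Proof.
split=> [[g fg]|[ratf intf closedf fibref]]; last exact: in_K_Rplus_of_graph.
have [E [Ev Ez]] := Rplus_graph_equations fg.
split; first exact: Rplus_rational fg.
- exact: Rplus_integral fg.
- exact: graph_closed_of_equations Ev Ez.
- exact: complex_fibre_of_equations Ev Ez.
Qed.
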